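(* Let $f\in L^\infty([0,1]\times\mathbb{R}\times\mathbb{R})$ be real-valued and satisfy, for a constant $K>0$, $$|f(x,t,v_1)-f(x,t,v_2)|\le K|v_1-v_2|,\qquad 0\le x\le 1,\ t\in\mathbb{R},\ v_1,v_2\in\mathbb{R}.$$ Let $g,h,g^\delta,h^\delta\in L^2(\mathbb{R})$ satisfy $\|g^\delta-g\|_{L^2(\mathbb{R})}+\|h^\delta-h\|_{L^2(\mathbb{R})}\le\delta$ with $\delta>0$, let $\epsilon>0$, and let $u_\epsilon^\delta\in C([0,1];L^2(\mathbb{R}))$ be the regularized solution with parameter $\epsilon$ and data $(g^\delta,h^\delta)$. Assume that the exact problem with data $(g,h)$ has a unique (exact) solution $u$ and that, for some $M_1>0$, $$\int_{-\infty}^{+\infty}\exp\big(2(1-x)\Re(k(\omega))\big)\,|\widehat u(x,\omega)|^2\,d\omega<M_1^2,\qquad 0\le x<1 .$$ Then, with $C_1=4e^{K^2}+2M_1e^{K^2}$, for all $0\le x<1$, $$\|u_\epsilon^\delta(x,\cdot)-u(x,\cdot)\|_{L^2(\mathbb{R})}\le C_1\exp\Big(x\,\epsilon^{-\frac{\alpha}{2}}\cos\tfrac{\alpha\pi}{4}\Big)\delta+C_1\exp\Big((x-1)\,\epsilon^{-\frac{\alpha}{2}}\cos\tfrac{\alpha\pi}{4}\Big).$$ As a consequence, if $0<\delta<1$ and $\epsilon=\left(\dfrac{\cos\frac{\alpha\pi}{4}}{\ln\frac1\delta}\right)^{\frac{2}{\alpha}}$, then $$\|u_\epsilon^\delta(x,\cdot)-u(x,\cdot)\|_{L^2(\mathbb{R})}\le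 C_1\,\delta^{1-x},\qquad 0\le x<1 .$$
   Context: Fix $0<\alpha<1$. $L^2(\mathbb{R})$ consists of real-valued functions of $t\in\mathbb{R}$. The Fourier transform in $t$ is $\widehat v(\omega)=\frac{1}{\sqrt{2\pi}}\int_{-\infty}^{\infty}v(t)e^{-i\omega t}\,dt$. Put $$k(\omega)=(i\omega)^{\alpha/2}=|\omega|^{\alpha/2}\Big(\cos\tfrac{\alpha\pi}{4}+i\,\mathrm{sign}(\omega)\sin\tfrac{\alpha\pi}{4}\Big),\qquad \Re(k(\omega))=|\omega|^{\alpha/2}\cos\tfrac{\alpha\pi}{4},$$ and interpret $\sinh(k(\omega)y)/k(\omega)$ as $y$ at $\omega=0$. For a function $w$ on $[0,1]\times\mathbb{R}$, $\widehat w(x,\omega)$ denotes the Fourier transform of $w(x,\cdot)$, and $\widehat f(z,\omega,w(z,\omega))$ denotes the Fourier transform with respect to $t$ of $t\mapsto f(z,t,w(z,t))$. Standing assumption: $(z,t)\mapsto f(z,t,w(z,t))$ belongs to $L^2((0,1)\times\mathbb{R})$ for every $w\in C([0,1];L^2(\mathbb{R}))$, so that these Fourier transforms are those of $L^2$ functions. Exact problem with data $(g,h)$: find $u\in C([0,1];L^2(\mathbb{R}))$ such that for $0\le x\le1$ and a.e. $\omega\in\mathbb{R}$ $$\widehat u(x,\omega)=\cosh(k(\omega)x)\,\widehat g(\omega)+\frac{\sinh(k(\omega)x)}{k(\omega)}\,\widehat h(\omega)-\int_0^x\frac{\sinh(k(\omega)(x-z))}{k(\omega)}\,\widehat f(z,\omega,u(z,\omega))\,dz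 .$$ (This is the integral form of the problem $D_t^\alpha u-u_{xx}=f(x,t,u)$, $u(x,0)=0$, $u(0,t)=g(t)$, $u_x(0,t)=h(t)$, with $D_t^\alpha$ the Caputo derivative.) Regularized solution with parameter $\epsilon>0$ and data $(g^\delta,h^\delta)$: the unique $u_\epsilon^\delta\in C([0,1];L^2(\mathbb{R}))$ such that $w=u_\epsilon^\delta$ satisfies, for $0\le x\le1$ and a.e. $\omega\in\mathbb{R}$, $$\widehat w(x,\omega)=\chi_{[-1/\epsilon,1/\epsilon]}(\omega)\left[\cosh(k(\omega)x)\,\widehat{g^\delta}(\omega)+\frac{\sinh(k(\omega)x)}{k(\omega)}\,\widehat{h^\delta}(\omega)-\int_0^x\frac{\sinh(k(\omega)(x-z))}{k(\omega)}\,\widehat f(z,\omega,w(z,\omega))\,dz\right],$$ where $\chi_I$ is the indicator function of $I$. *)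

(* Defs.v *)
From HB Require Import structures.
From mathcomp Require Import all_boot all_order all_algebra.
From mathcomp Require Import all_classical all_reals all_analysis.
From mathcomp Require Import complex.

Set Implicit Arguments.
Unset Strict Implicit.
Unset Printing Implicit Defensive.

Import Order.TTheory GRing.Theory Num.Theory.
Import numFieldNormedType.Exports.

Local Open Scope classical_set_scope.
Local Open Scope ring_scope.
Local Open Scope complex_scope.

Definition cexp (R : realType) (z : R[i]) : R[i] :=
  (expR (complex.Re z) * cos (complex.Im z)) +i* (expR (complex.Re z) * sin (complex.Im z)).

Definition ccosh (R : realType) (z : R[i]) : R[i] :=
  (cexp z + cexp (- z)) / 2.

Definition csinh (R : realType) (z : R[i]) : R[i] :=
  (cexp z - cexp (- z)) / 2.

Definition cabs (R : realType) (z : R[i]) : R :=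
  Num.sqrt (complex.Re z ^+ 2 + complex.Im z ^+ 2).

Definition cintegral (R : realType) (D : set R) (F : R -> R[i]) : R[i] :=
  (\int[lebesgue_measure]_(t in D) complex.Re (F t))%R
  +i* (\int[lebesgue_measure]_(t in D) complex.Im (F t))%R.

(* Spaces of (classes of) functions on a line or on a strip are rendered by
   Borel functions; equality in such a space is equality almost everywhere. *)
Definition L2 (R : realType) : {pred R -> R} :=
  Lfun (@lebesgue_measure R) 2%:E.

Definition L2norm (R : realType) (v : R -> R) : \bar R :=
  'N[@lebesgue_measure R]_2%:E[EFin \o v].

Definition L2C (R : realType) (F : R -> R[i]) : Prop :=
  (fun om => complex.Re (F om)) \in @L2 R /\ (fun om => complex.Im (F om)) \in @L2 R.

Definition fourier_trunc (R : realType) (v : R -> R) (n : nat) (om : R)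
  : R[i] :=
  (Num.sqrt (2 * pi))^-1%:C *
  cintegral `[- n%:R, n%:R] (fun t => (v t)%:C * cexp (0 -i* (om * t))).

(* On L^2 the integral defining the Fourier transform converges only in
   quadratic mean (Plancherel). *)
Definition is_fourier (R : realType) (v : R -> R) (F : R -> R[i]) : Prop :=
  L2C F /\
  (L2norm (fun om => cabs (F om - fourier_trunc v n om)) @[n --> \oo]
     --> 0%E).

Definition fourier (R : realType) (v : R -> R) : R -> R[i] :=
  xget (fun=> 0) [set F | is_fourier v F].

Definition CL2 (R : realType) (w : R -> R -> R) : Prop :=
  (forall x, 0 <= x <= 1 -> w x \in @L2 R) /\
  (forall x, 0 <= x <= 1 ->
     L2norm (w y \- w x) @[y --> within `[0, 1] (nbhs x)] --> 0%E).

Definition Linfty_strip (R : realType) (f : R -> R -> R -> R) : Prop :=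
  ((fun p : (R * R) * R => f p.1.1 p.1.2 p.2) \_
     [set p : (R * R) * R | 0 <= p.1.1 <= 1])
  \in Lfun ((@lebesgue_measure R \x @lebesgue_measure R)
              \x @lebesgue_measure R)%E +oo%E.

Definition L2_strip (R : realType) (q : R * R -> R) : Prop :=
  (q \_ [set p : R * R | 0 < p.1 < 1])
  \in Lfun (@lebesgue_measure R \x @lebesgue_measure R)%E 2%:E.

(* The slices of w in C([0,1]; L^2) are determined only up to null sets that
   may depend on z, so that membership of (z, t) |-> f z t (w z t) in
   L^2((0,1) x R) is that of some jointly measurable version. *)
Definition nonlinearity_L2 (R : realType) (f : R -> R -> R -> R) : Prop :=
  forall w : R -> R -> R, CL2 w ->
  exists2 q : R * R -> R, L2_strip q &
    {ae @lebesgue_measure R, forall z, 0 < z < 1 ->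
      {ae @lebesgue_measure R, forall t, q (z, t) = f z t (w z t)}}.

(* Q is a jointly measurable version of the Fourier transform in t of
   (z, t) |-> f z t (w z t); it is unique up to a null set of (z, omega).
   Joint measurability makes its integrals over z meaningful for almost every
   omega. *)
Definition fourier_nonlinearity (R : realType) (f : R -> R -> R -> R)
    (w : R -> R -> R) (Q : R * R -> R[i]) : Prop :=
  [/\ measurable_fun [set p : R * R | 0 <= p.1 <= 1] (fun p => complex.Re (Q p)),
      measurable_fun [set p : R * R | 0 <= p.1 <= 1] (fun p => complex.Im (Q p)) &
      {ae @lebesgue_measure R, forall z, 0 < z < 1 ->
        {ae @lebesgue_measure R, forall om,
          Q (z, om) = fourier (fun t => f z t (w z t)) om}}].

Definition ksym (R : realType) (alpha om : R) : R[i] :=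
  (`|om| `^ (alpha / 2))%:C *
  (cos (alpha * pi / 4) +i* (Num.sg om * sin (alpha * pi / 4))).

Definition sinhk (R : realType) (alpha om y : R) : R[i] :=
  if om == 0 then y%:C else csinh (ksym alpha om * y%:C) / ksym alpha om.

Definition solution_formula (R : realType) (alpha : R) (g h : R -> R)
    (Q : R * R -> R[i]) (x om : R) : R[i] :=
  ccosh (ksym alpha om * x%:C) * fourier g om
  + sinhk alpha om x * fourier h om
  - cintegral `[0, x] (fun z => sinhk alpha om (x - z) * Q (z, om)).

Definition solves_exact (R : realType) (alpha : R) (f : R -> R -> R -> R)
    (g h : R -> R) (u : R -> R -> R) : Prop :=
  CL2 u /\
  exists2 Q : R * R -> R[i], fourier_nonlinearity f u Q &
    forall x, 0 <= x <= 1 ->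
      {ae @lebesgue_measure R, forall om,
        fourier (u x) om = solution_formula alpha g h Q x om}.

Definition solves_regularized (R : realType) (alpha eps : R)
    (f : R -> R -> R -> R) (g h : R -> R) (w : R -> R -> R) : Prop :=
  CL2 w /\
  exists2 Q : R * R -> R[i], fourier_nonlinearity f w Q &
    forall x, 0 <= x <= 1 ->
      {ae @lebesgue_measure R, forall om,
        fourier (w x) om =
        (\1_(`[- (1 / eps), 1 / eps] : set R) om)%:C *
        solution_formula alpha g h Q x om}.

Definition unique_in_CL2 (R : realType) (S : (R -> R -> R) -> Prop)
    (u : R -> R -> R) : Prop :=
  S u /\
  forall v, S v -> forall x, 0 <= x <= 1 ->
    {ae @lebesgue_measure R, forall t, v x t = u x t}.

(* Main.v *)
(* Put A = eps^(-alpha/2) cos(alpha pi/4), so that Re k <= A exactly on the frequencies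
   |omega| <= 1/eps kept by the cutoff.  There |cosh(k x)| <= e^(A x) and
   |sinh(k y)/k| <= y e^(A y), and the Cauchy-Schwarz inequality bounds the integral term;
   on the discarded frequencies u is at most e^(-(1-x) A) times its weighted norm.
   By Plancherel's theorem, d(x) = ||w(x) - u(x)|| satisfies
     d(x)^2 <= 4 e^(2Ax) delta^2 + 2 K^2 int_0^x e^(2A(x-z)) d(z)^2 dz + e^(-2A(1-x)) M1^2,
   and Gronwall's inequality for e^(-2Ax) d(x)^2 gives
     d(x) <= (2 delta + M1 e^(-A)) e^(K^2) e^(A x).
   This is sharper than the first claim; in the second one e^(-A) = delta.

   Plancherel's theorem is obtained by Abel summation: weighting the energy of the transform
   by e^(-e |omega|) turns it into an integral against the Poisson kernel, which is at most
   2 pi ||v||^2 and converges to 2 pi ||psi||^2 as e tends to 0 when psi is bounded and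
   continuous on its support; such psi are dense.  Riesz-Fischer then makes the truncated
   transforms converge in L^2. *)

Require Import Defs.
From HB Require Import structures.
From mathcomp Require Import all_boot all_order all_algebra.
From mathcomp Require Import all_classical all_reals all_analysis.
From mathcomp Require Import complex measurable_realfun.
From mathcomp Require Import ring lra.

Set Implicit Arguments.
Unset Strict Implicit.
Unset Printing Implicit Defensive.

Import Order.TTheory GRing.Theory Num.Theory.
Import numFieldNormedType.Exports.

Local Open Scope classical_set_scope.
Local Open Scope ring_scope.
Local Open Scope complex_scope.

(** * Squared norms in L2 and Young's inequality *)

Section square_norm.
Context {R : realType}.
Local Notation mu := (@lebesgue_measure R).
Implicit Types v : R -> R.

(** [fourier v] is a choice among quadratic-mean limits and is fixed only up to null sets, so
    pointwise it need be neither additive nor zero at the zero function. Plancherel's theorem is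
    therefore stated for a difference [fourier v1 - fourier v2], the form that the stability
    argument uses, and linearity is invoked only for truncated transforms, where it is exact. Norms
    are handled through their squares [sqint] in [\bar R], so that Tonelli, Fatou and monotone
    convergence apply before finiteness is known. In limits of squared norms, Young's inequality
    with a free parameter [eta] takes the place of Minkowski's inequality; the approximation error
    tends to 0 first and [eta] last. The other obstacle is measurability: slices of the nonlinear
    term are controlled only for almost every [z], the solution formula only for almost every
    [omega]. The jointly measurable versions [q] and [Q] let Tonelli's theorem pass from one kind of
    statement to the other. *)

Definition sqint v : \bar R := \int[mu]_t (v t ^+ 2)%:E.

Lemma sqint_ge0 v : (0 <= sqint v)%E.
Proof. by apply: integral_ge0 => t _; rewrite lee_fin sqr_ge0. Qed.

Lemma sqintE v : sqint v = (L2norm v * L2norm v)%E.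
Proof.
rewrite -expe2 /sqint.
have L0 : (0 <= L2norm v)%E by exact: Lnorm_ge0.
transitivity (L2norm v `^ 2)%E.
  rewrite poweR_Lnorm//; apply: eq_integral => t _.
  by rewrite poweR_EFin powR_mulrn// real_normK// num_real.
case: (L2norm v) L0 => [r r0|_|//].
  rewrite lee_fin in r0; by rewrite poweR_EFin powR_mulrn.
by rewrite poweRyr// expe2 mulyy.
Qed.

(** This case split stands in for square roots in [\bar R]: norms and their squares are compared as
    real numbers or are both infinite. *)
Lemma L2norm_cases v :
  (exists r, [/\ 0 <= r, L2norm v = r%:E & sqint v = (r ^+ 2)%:E]) \/
  L2norm v = +oo%E /\ sqint v = +oo%E.
Proof.
rewrite sqintE; have : (0 <= L2norm v)%E by exact: Lnorm_ge0.
case: (L2norm v) => [r r0|_|//]; first by left; exists r; rewrite -EFinM.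
by right; rewrite mulyy.
Qed.

Lemma L2P v : v \in @L2 R <-> measurable_fun setT v /\ (sqint v < +oo)%E.
Proof.
have E : (L2norm v < +oo)%E <-> (sqint v < +oo)%E.
  by have [[r [r0 -> ->]]|[-> ->]] := L2norm_cases v; rewrite ?ltry.
split=> [|[mv /E fv]].
  rewrite inE => /andP[]; rewrite !inE => mv fv; split; first exact: mv.
  exact/E.
rewrite inE; apply/andP; split; rewrite inE; first exact: mv.
exact: fv.
Qed.

(** Finiteness is required only eventually, and the bound by [e] itself provides it. *)
Lemma ge0_cvge0P {T : Type} {F : set_system T} {FF : Filter F} (a : T -> \bar R) :
  (forall x, (0 <= a x)%E) ->
  (a x @[x --> F] --> 0%E) <->
  (forall e : R, 0 < e -> \forall x \near F, (a x < e%:E)%E).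
Proof.
move=> a0; split=> [/fine_cvgP[af /cvgrPdist_lt ac] e e0|ac].
  have := ac _ e0; apply: filter_app2 af; near=> x.
  move=> afx; rewrite sub0r normrN ger0_norm ?fine_ge0// -lte_fin fineK//.
apply/fine_cvgP; split.
  by apply: filterS (ac _ ltr01) => x; rewrite ge0_fin_numE// => /lt_trans; apply; exact: ltry.
apply/cvgrPdist_lt => e e0; apply: filterS (ac _ e0) => x ax.
rewrite sub0r normrN ger0_norm ?fine_ge0// -lte_fin fineK//.
by rewrite ge0_fin_numE// (lt_trans ax)// ltry.
Unshelve. all: by end_near. Qed.

Lemma L2norm_cvg0P {T : Type} {F : set_system T} {FF : Filter F} (w : T -> R -> R) :
  (L2norm (w x) @[x --> F] --> 0%E) <-> (sqint (w x) @[x --> F] --> 0%E).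
Proof.
rewrite !ge0_cvge0P; last 2 first.
- by move=> x; exact: sqint_ge0.
- by move=> x; exact: Lnorm_ge0.
split=> wc e e0.
  have se0 : 0 < Num.sqrt e by rewrite sqrtr_gt0.
  apply: filterS (wc _ se0) => x.
  have [[r [r0 -> ->]]|[-> ->]//] := L2norm_cases (w x); rewrite !lte_fin => re.
  by rewrite -[ltRHS]sqr_sqrtr ?ltW// ltr_sqr// nnegrE ltW.
have ee0 : 0 < e ^+ 2 by rewrite exprn_gt0.
apply: filterS (wc _ ee0) => x.
have [[r [r0 -> ->]]|[-> ->]//] := L2norm_cases (w x); rewrite !lte_fin => re.
by rewrite -ltr_sqr// nnegrE ltW.
Qed.

Lemma measurable_sqr (D : set R) v : measurable_fun D v ->
  measurable_fun D (fun t => (v t ^+ 2)%:E).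
Proof. by move=> mv; apply/measurable_EFinP; exact: measurable_funX. Qed.

(** The difference of the two sides is [eta (a - b / eta)^2]. A small [eta] brings the leading
    factor close to 1, which makes the inequality sharp in limits. *)
Lemma sqrD_young (eta a b : R) : 0 < eta ->
  (a + b) ^+ 2 <= (1 + eta) * a ^+ 2 + (1 + eta^-1) * b ^+ 2.
Proof.
move=> e0; rewrite -subr_ge0.
have -> : (1 + eta) * a ^+ 2 + (1 + eta^-1) * b ^+ 2 - (a + b) ^+ 2
          = eta * (a - eta^-1 * b) ^+ 2.
  by field; rewrite gt_eqF.
by rewrite mulr_ge0 ?sqr_ge0// ltW.
Qed.

Lemma ge0_integralZl_real (D : set R) (c : R) v : measurable D ->
  measurable_fun D v -> (forall t, D t -> 0 <= v t) -> 0 <= c ->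
  (\int[mu]_(t in D) (c * v t)%:E = c%:E * \int[mu]_(t in D) (v t)%:E)%E.
Proof.
move=> mD mv v0 c0; under eq_integral do rewrite EFinM.
by rewrite ge0_integralZl_EFin//; exact/measurable_EFinP.
Qed.

Lemma ge0_integralD_real (D : set R) v1 v2 : measurable D ->
  measurable_fun D v1 -> measurable_fun D v2 ->
  (forall t, D t -> 0 <= v1 t) -> (forall t, D t -> 0 <= v2 t) ->
  (\int[mu]_(t in D) (v1 t + v2 t)%:E =
   \int[mu]_(t in D) (v1 t)%:E + \int[mu]_(t in D) (v2 t)%:E)%E.
Proof.
move=> mD m1 m2 p1 p2; under eq_integral do rewrite EFinD.
by rewrite ge0_integralD//; exact/measurable_EFinP.
Qed.

Lemma sqint_young (a b : R -> R) (eta : R) : 0 < eta ->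
  measurable_fun setT a -> measurable_fun setT b ->
  (sqint (a \+ b)%R <= (1 + eta)%:E * sqint a + (1 + eta^-1)%:E * sqint b)%E.
Proof.
move=> e0 ma mb.
have e1 : 0 <= 1 + eta by rewrite addr_ge0// ltW.
have e2 : 0 <= 1 + eta^-1 by rewrite addr_ge0// invr_ge0 ltW.
have ma2 : measurable_fun setT (fun t => a t ^+ 2) by exact: measurable_funX.
have mb2 : measurable_fun setT (fun t => b t ^+ 2) by exact: measurable_funX.
rewrite /sqint -!ge0_integralZl_real//; try by move=> t _; exact: sqr_ge0.
rewrite -ge0_integralD_real//; try (by move=> t _; rewrite mulr_ge0// sqr_ge0);
  try exact: measurable_funM.
apply: ge0_le_integral => //.
- by move=> t _; rewrite lee_fin sqr_ge0.
- by apply: measurable_sqr; apply: measurable_funD.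
- by apply/measurable_EFinP/measurable_funD; exact: measurable_funM.
- by move=> t _; rewrite lee_fin; exact: sqrD_young.
Qed.

Lemma sqintN v : sqint (\- v) = sqint v.
Proof. by apply: eq_integral => t _; rewrite sqrrN. Qed.

(** For fixed [eta] the total coefficient of [e] is a constant [p], so [e] tends to 0 and leaves
    [A <= (1 + eta) B]; then [eta] tends to 0. *)
Lemma le_of_young (A B : R) :
  (forall eta e : R, 0 < eta -> 0 < e ->
     A <= (1 + eta) * (B + e) + (1 + eta^-1) * e) -> A <= B.
Proof.
move=> H.
have H2 eta : 0 < eta -> A <= (1 + eta) * B.
  move=> eta0; apply/ler_addgt0Pr => e e0.
  set p := (1 + eta) + (1 + eta^-1).
  have p0 : 0 < p by rewrite !addr_gt0// invr_gt0.
  apply: (le_trans (H eta (e / p) eta0 (divr_gt0 e0 p0))).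
  rewrite [leLHS](_ : _ = (1 + eta) * B + p * (e / p)); last by rewrite /p; ring.
  by rewrite mulrCA mulfV ?gt_eqF// mulr1.
have B0 : 0 <= B \/ B < 0 by case: (leP 0 B); [left|right].
apply/ler_addgt0Pr => e e0.
case: B0 => B0.
  have p : 0 < B + 1 by lra.
  (* Dividing by [B + 1] instead of [B] covers the case [B = 0]. *)
  have := H2 (e / (B + 1)) (divr_gt0 e0 p); move/le_trans; apply.
  rewrite mulrDl mul1r lerD2l -mulrA ler_piMr ?ltW//.
  by rewrite mulrC ltr_pdivrMr//; lra.
(* For negative [B], [eta = 1] already gives [A <= 2 B < B]. *)
have := H2 1 ltr01; lra.
Qed.

End square_norm.

(** * The Poisson kernel *)

Section poisson_kernel.
Context {R : realType}.
Local Notation mu := (@lebesgue_measure R).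

Let dexp (e x : R) : is_derive x 1 (fun x => expR (- (e * x))) (- e * expR (- (e * x))).
Proof.
have h1 : is_derive x 1 (fun y : R => (- e) * y) (- e).
  apply: (is_derive_eq (@is_deriveZ _ _ _ id (- e) x 1 1 _)).
  by rewrite /GRing.scale /= mulr1.
have := @is_derive1_comp R expR _ x _ _ (is_derive_expR _) h1.
rewrite mulNr mulrC; congr (is_derive _ _ _ _).
by apply/funext => y /=; rewrite mulNr.
Qed.

Let dcos (r x : R) : is_derive x 1 (fun x => cos (x * r)) (- sin (x * r) * r).
Proof.
have h1 : is_derive x 1 (fun y : R => y * r) r.
  rewrite (_ : (fun y => y * r) = r \*: id); last first.
    by apply/funext => y /=; rewrite mulrC.
  apply: (is_derive_eq (@is_deriveZ _ _ _ id r x 1 1 _)).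
  by rewrite /GRing.scale /= mulr1.
exact: (@is_derive1_comp R cos _ x _ _ (is_derive_cos _) h1).
Qed.

Let dsin (r x : R) : is_derive x 1 (fun x => sin (x * r)) (cos (x * r) * r).
Proof.
have h1 : is_derive x 1 (fun y : R => y * r) r.
  rewrite (_ : (fun y => y * r) = r \*: id); last first.
    by apply/funext => y /=; rewrite mulrC.
  apply: (is_derive_eq (@is_deriveZ _ _ _ id r x 1 1 _)).
  by rewrite /GRing.scale /= mulr1.
exact: (@is_derive1_comp R sin _ x _ _ (is_derive_sin _) h1).
Qed.

Lemma cvg_expRNM (e : R) : 0 < e -> expR (- (e * x)) @[x --> +oo] --> (0 : R).
Proof.
move=> e0; apply/cvgr0Pnorm_lt => eps eps0; near=> x.
rewrite ger0_norm ?expR_ge0// -[ltRHS]lnK ?posrE// ltr_expR.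
rewrite ltrNl -ltr_pdivrMl//; near: x; apply: nbhs_pinfty_gt; exact: num_real.
Unshelve. all: by end_near. Qed.

(** The antiderivative of [exp (- e x) (1 + cos (x r))] that vanishes at infinity. Adding 1 to the
    cosine keeps the integrand nonnegative, as the fundamental theorem on a half-line and the
    reduction by symmetry require; the added term is subtracted afterwards. *)
Let F (e r x : R) := expR (- (e * x)) *
  ((r * sin (x * r) - e * cos (x * r)) / (e ^+ 2 + r ^+ 2) - e^-1).

Let dF (e r x : R) : 0 < e ->
  is_derive x 1 (F e r) (expR (- (e * x)) * (1 + cos (x * r))).
Proof.
move=> e0; set d := e ^+ 2 + r ^+ 2.
have d0 : 0 < d by rewrite ltr_pwDl ?exprn_gt0// sqr_ge0.
pose G (x : R) := d^-1 * (r * sin (x * r) + (- e) * cos (x * r)) + (- e^-1).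
have h : is_derive x 1 G (d^-1 * (r * (cos (x * r) * r) + (- e) * (- sin (x * r) * r)) + 0).
  apply: is_deriveD; apply: (@is_deriveZ _ _ _ _ d^-1); apply: is_deriveD.
    exact: (@is_deriveZ _ _ _ _ r).
  exact: (@is_deriveZ _ _ _ _ (- e)).
have -> : F e r = (fun x => expR (- (e * x))) * G.
  apply/funext => y; transitivity (expR (- (e * y)) * G y) => //.
  by rewrite /F /G -/d; ring.
apply: (is_derive_eq (is_deriveM (dexp e x) h)).
rewrite /G /GRing.scale /=; move: (expR _) (cos _) (sin _) => E C S.
by rewrite /d; field; rewrite !gt_eqF.
Qed.

Lemma integral_expR_1Dcos (e r : R) : 0 < e ->
  (\int[mu]_(x in `[0%R, +oo[) (expR (- (e * x)) * (1 + cos (x * r)))%:E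
   = (e^-1 + e / (e ^+ 2 + r ^+ 2))%:E)%E.
Proof.
move=> e0; have d0 : 0 < e ^+ 2 + r ^+ 2 by rewrite ltr_pwDl ?exprn_gt0// sqr_ge0.
have dcont f f' : (forall x : R, is_derive x 1 f (f' x : R)) -> continuous f.
  move=> df x; apply: differentiable_continuous; apply/derivable1_diffP.
  exact: ex_derive.
rewrite (@ge0_continuous_FTC2y _ _ (F e r) 0 0).
- rewrite /F mulr0 oppr0 expR0 mul0r sin0 cos0 -EFinB; congr EFin; field.
  by rewrite !gt_eqF.
- by move=> x _; rewrite mulr_ge0 ?expR_ge0// -lerBlDl sub0r cos_geN1.
- apply: continuous_subspaceT => x; apply: cvgM; first exact: (dcont _ _ (dexp e)).
  by apply: cvgD; [exact: cvg_cst|exact: (dcont _ _ (dcos r))].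
- apply: norm_cvg0.
  pose C := (`|r| + `|e|) / (e ^+ 2 + r ^+ 2) + e^-1.
  apply: (@squeeze_cvgr _ _ _ _ (cst 0) (fun x => expR (- (e * x)) * C)).
  + apply: nearW => x /=; rewrite normr_ge0/= /F normrM ger0_norm ?expR_ge0//.
    rewrite ler_wpM2l ?expR_ge0//; apply: (le_trans (ler_normB _ _)).
    rewrite /C; apply: lerD; last by rewrite ger0_norm // invr_ge0 ltW.
    rewrite normrM [X in _ * X]ger0_norm; last by rewrite invr_ge0 ltW.
    apply: ler_wpM2r; first by rewrite invr_ge0 ltW.
    apply: (le_trans (ler_normB _ _)); rewrite !normrM lerD// ler_piMr//.
      exact: sin_max.
    exact: cos_max.
  + exact: cvg_cst.
  + by rewrite -(mul0r C); apply: cvgM; [exact: cvg_expRNM|exact: cvg_cst].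
- by move=> x _; apply: ex_derive; exact: (dF r x e0).
- apply: cvg_at_right_filter; exact: (dcont _ _ (fun x => dF r x e0)).
- by move=> x _; rewrite derive1E; apply: derive_val; exact: (dF r x e0).
Qed.

Lemma integralT_expR_1Dcos (e r : R) : 0 < e ->
  (\int[mu]_x (expR (- (e * `|x|)) * (1 + cos (x * r)))%:E
   = (2 / e + 2 * e / (e ^+ 2 + r ^+ 2))%:E)%E.
Proof.
move=> e0; rewrite (@ge0_symfun_integralT _ (fun x => expR (- (e * `|x|)) * (1 + cos (x * r)))).
- rewrite -set_itvcy.
  transitivity (2%:E * \int[mu]_(x in `[0%R, +oo[)
     (expR (- (e * x)) * (1 + cos (x * r)))%:E)%E.
    congr *%E; apply: eq_integral => x; rewrite inE/= in_itv/= andbT => x0.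
    by rewrite ger0_norm.
  by rewrite integral_expR_1Dcos// -EFinM mulrDr -!mulrA.
- by move=> x; rewrite mulr_ge0 ?expR_ge0// -lerBlDl sub0r cos_geN1.
- move=> x; apply: cvgM.
    apply: (@continuous_comp _ _ _ (fun x : R => - (e * `|x|)) expR); last exact: continuous_expR.
    apply: cvgN; apply: cvgMr; exact: norm_continuous.
  apply: cvgD; first exact: cvg_cst.
  apply: (@continuous_comp _ _ _ (fun x : R => x * r) cos); last exact: continuous_cos.
  by apply: cvgMl; exact: cvg_id.
- by move=> x /=; rewrite normrN mulNr cosN.
Qed.

Lemma measurable_expR_norm (e : R) :
  measurable_fun setT (fun x : R => expR (- (e * `|x|))).
Proof.
apply: measurableT_comp => //; apply: measurableT_comp => //.
exact: measurable_funM.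
Qed.

Lemma integrable_expR_norm (e : R) : 0 < e ->
  mu.-integrable setT (EFin \o (fun x => expR (- (e * `|x|)))).
Proof.
move=> e0; apply/integrableP; split.
  apply/measurable_EFinP; exact: measurable_expR_norm.
have := integralT_expR_1Dcos 0 e0.
under eq_integral do rewrite mulr0 cos0.
move=> h; apply: (@le_lt_trans _ _ (2 / e + 2 * e / (e ^+ 2 + 0 ^+ 2))%:E); last exact: ltry.
rewrite -h; apply: ge0_le_integral => //.
- by apply: measurableT_comp => //; apply/measurable_EFinP; exact: measurable_expR_norm.
- by apply/measurable_EFinP; apply: measurable_funM => //; exact: measurable_expR_norm.
- move=> x _; rewrite /= lee_fin ger0_norm ?expR_ge0// ler_peMr ?expR_ge0//; lra.
Qed.

(** The Poisson kernel of the half-plane at height [e], scaled to have mass [2 pi]; it is the cosine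
    transform of [exp (- e |x|)]. *)
Definition pker (e r : R) := 2 * e / (e ^+ 2 + r ^+ 2).

Lemma integral_expR_cos (e r : R) : 0 < e ->
  (\int[mu]_x (expR (- (e * `|x|)) * cos (x * r))%:E = (pker e r)%:E)%E.
Proof.
move=> e0.
have h1 := integralT_expR_1Dcos r e0.
(* At [r = 0] the same formula has integrand [2 exp (- e |x|)], which yields the term to
   subtract. *)
have h0 : (\int[mu]_x (expR (- (e * `|x|)))%:E = (2 / e)%:E)%E.
  have := integralT_expR_1Dcos 0 e0.
  under eq_integral do rewrite mulr0 cos0 mulrC.
  have p2 : (0 : R) <= 1 + 1 by rewrite addr_ge0.
  rewrite (ge0_integralZl_real measurableT (measurable_expR_norm e) _ p2); last first.
    by move=> t _; exact: expR_ge0.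
  have := integrable_fin_num (measurableT) (integrable_expR_norm e0).
  rewrite /comp; move: (\int[mu]_x _)%E => [y _|//|//].
  rewrite -EFinM => -[H]; congr EFin.
  have -> : 2 / e = (2 / e + 2 * e / (e ^+ 2 + 0 ^+ 2)) / 2 by field; rewrite gt_eqF.
  by rewrite -H; lra.
have i1 : mu.-integrable setT (EFin \o (fun x => expR (- (e * `|x|)) * (1 + cos (x * r)))).
  have mm : measurable_fun setT (fun x : R => expR (- (e * `|x|)) * (1 + cos (x * r))).
    apply: measurable_funM; first exact: measurable_expR_norm.
    apply: measurable_funD => //; apply: measurableT_comp.
      by apply: continuous_measurable_fun; exact: continuous_cos.
    exact: measurable_funM.
  apply/integrableP; split; first exact/measurable_EFinP.
  apply: (@le_lt_trans _ _ (2 / e + 2 * e / (e ^+ 2 + r ^+ 2))%:E); last exact: ltry.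
  rewrite -h1; apply: ge0_le_integral => //.
  + by apply: measurableT_comp => //; exact/measurable_EFinP.
  + exact/measurable_EFinP.
  + move=> x _; have p : 0 <= expR (- (e * `|x|)) * (1 + cos (x * r)).
      by rewrite mulr_ge0 ?expR_ge0// -lerBlDl sub0r cos_geN1.
    by rewrite /= lee_fin ger0_norm.
transitivity (\int[mu]_x ((expR (- (e * `|x|)) * (1 + cos (x * r)))%:E - (expR (- (e * `|x|)))%:E))%E.
  by apply: eq_integral => x _; rewrite -EFinB; congr EFin; ring.
rewrite integralB//; last exact: integrable_expR_norm.
by rewrite h1 h0 -EFinB /pker; congr EFin; ring.
Qed.

Lemma pker_ge0 (e r : R) : 0 < e -> 0 <= pker e r.
Proof.
by move=> e0; rewrite /pker divr_ge0 ?addr_ge0 ?sqr_ge0// mulr_ge0// ltW.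
Qed.

Lemma pkerN (e r : R) : pker e (- r) = pker e r.
Proof. by rewrite /pker sqrrN. Qed.

Lemma pker_den_gt0 (e r : R) : 0 < e -> 0 < e ^+ 2 + r ^+ 2.
Proof. by move=> e0; rewrite ltr_pwDl ?exprn_gt0// sqr_ge0. Qed.

Lemma continuous_pker (e : R) : 0 < e -> continuous (pker e).
Proof.
move=> e0 x; apply: cvgMr; apply: cvgV; first by rewrite gt_eqF// pker_den_gt0.
by apply: cvgD; [exact: cvg_cst|exact: exprn_continuous].
Qed.

Lemma measurable_pker (e : R) : 0 < e -> measurable_fun setT (pker e).
Proof. by move=> /continuous_pker; exact: continuous_measurable_fun. Qed.

(** The substitution [y = (t - s) / e] reduces the integral to that of [2 / (1 + y^2)], whose
    half-line part is an arctangent. *)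
Lemma integral_pker (e s : R) : 0 < e ->
  (\int[mu]_t (pker e (t - s))%:E = (2 * pi)%:E)%E.
Proof.
move=> e0; pose H (t : R) := e^-1 * (t - s); pose G (y : R) := 2 * (oneDsqr y)^-1.
have dH (x : R) : is_derive x 1 H e^-1.
  apply: (is_derive_eq (@is_deriveZ _ _ _ (id - cst s) e^-1 x 1 (1 - 0) _)).
  by rewrite subr0 /GRing.scale/= mulr1.
have dH1 : derive1 H = cst e^-1.
  by apply/funext => x; rewrite derive1E; apply: derive_val; exact: dH.
have cG : continuous G.
  by move=> x; apply: cvgMr; exact: continuous_oneDsqrV.
have G0 y : 0 <= G y by rewrite /G mulr_ge0// invr_ge0 ltW// oneDsqr_gt0.
have IG : (\int[mu]_y (G y)%:E = (2 * pi)%:E)%E.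
  rewrite ge0_symfun_integralT//; last by move=> x; rewrite /G/= /oneDsqr sqrrN.
  have mV : measurable_fun (`[0, +oo[ : set R) (fun y : R => (oneDsqr y)^-1).
    apply: measurable_funTS; apply: continuous_measurable_fun.
    exact: continuous_oneDsqrV.
  have V0 (y : R) : [set` `[(0 : R), +oo[] y -> 0 <= (oneDsqr y)^-1.
    by move=> _; rewrite invr_ge0 ltW// oneDsqr_gt0.
  rewrite -set_itvcy (ge0_integralZl_real _ mV V0)//.
  by rewrite integral0y_oneDsqr -!EFinM; congr EFin; field.
rewrite -IG (@increasing_ge0_integration_by_substitutionT _ H G)//.
- apply: eq_integral => t _; congr EFin; rewrite /= dH1 /GRing.mul/= /G /H /pker /oneDsqr.
  field; rewrite !gt_eqF// ?pker_den_gt0//.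
- by move=> x y xy; rewrite /H ltr_pM2l ?invr_gt0// ltrD2r.
- by rewrite dH1; move=> x; exact: cvg_cst.
- by rewrite dH1; exact: is_cvg_cst.
- by rewrite dH1; exact: is_cvg_cst.
- apply/cvgrNyPlt => A; near=> x; rewrite /H.
  rewrite ltr_pdivrMl// ltrBlDr; near: x; apply: nbhs_ninfty_lt; exact: num_real.
- apply/cvgryPgt => A; near=> x; rewrite /H.
  rewrite ltr_pdivlMl// ltrBrDr; near: x; apply: nbhs_pinfty_gt; exact: num_real.
Unshelve. all: by end_near. Qed.

End poisson_kernel.

(** * Fubini's theorem for bounded kernels with integrable weights *)

Section real_fubini.
Context {R : realType}.
Local Notation mu := (@lebesgue_measure R).
Variables (a b : R -> R) (k : R * R -> R) (B : R).
Hypothesis ia : mu.-integrable setT (EFin \o a).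
Hypothesis ib : mu.-integrable setT (EFin \o b).
Hypothesis mk : measurable_fun setT k.
Hypothesis kB : forall p, `|k p| <= B.

Let ma : measurable_fun setT a.
Proof. by apply/measurable_EFinP; exact: (measurable_int mu ia). Qed.

Let mb : measurable_fun setT b.
Proof. by apply/measurable_EFinP; exact: (measurable_int mu ib). Qed.

(** The function is dominated by [B |a x| |b y|], whose iterated integral is a product of two finite
    integrals. *)
Lemma integrable_tensor :
  (mu \x mu)%E.-integrable setT (fun p : R * R => (a p.1 * b p.2 * k p)%:E).
Proof.
have mf : measurable_fun setT (fun p : R * R => (a p.1 * b p.2 * k p)%:E).
  apply/measurable_EFinP; apply: measurable_funM => //; apply: measurable_funM.
    exact: (measurableT_comp ma measurable_fst).
  exact: (measurableT_comp mb measurable_snd).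
apply: (proj2 (integrable12ltyP mu mu mf)).
have B0 : 0 <= B by apply: le_trans (kB (0, 0)).
apply: (@le_lt_trans _ _ (\int[mu]_x (`|a x|%:E * (B%:E * \int[mu]_y (`|b y|%:E))))%E).
  apply: ge0_le_integral => //.
  - by move=> x _; apply: integral_ge0.
  - have := @measurable_fun_fubini_tonelli_F _ _ _ _ R mu
      (abse \o (fun p : R * R => (a p.1 * b p.2 * k p)%:E)).
    apply; first by apply: measurableT_comp => //.
    by move=> p; rewrite /= lee_fin.
  - apply: emeasurable_funM => //; apply/measurable_EFinP.
    exact: measurableT_comp.
  - move=> x _; rewrite muleA -EFinM -ge0_integralZl_real ?mulr_ge0//; last first.
      exact: measurableT_comp.
    apply: ge0_le_integral => //.
    + by apply: measurableT_comp => //; exact: (measurable_fun_pair2 _ mf).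
    + by apply/measurable_EFinP; apply: measurable_funM => //; exact: measurableT_comp.
    + move=> y _; rewrite /= lee_fin !normrM mulrAC ler_wpM2r//.
      by rewrite ler_wpM2l.
rewrite ge0_integralZr//; last 2 first.
- by apply/measurable_EFinP; exact: measurableT_comp.
- by rewrite mule_ge0// integral_ge0.
have /integrableP[_ fa] := ia; have /integrableP[_ fb] := ib.
by apply: lte_mul_pinfty => //; rewrite ?mule_ge0 ?integral_ge0//;
  [rewrite ge0_fin_numE// integral_ge0|apply: lte_mul_pinfty].
Qed.

Lemma integrable_bounded_mul x : mu.-integrable setT (EFin \o (fun y => b y * k (x, y))).
Proof.
apply: (@le_integrable _ _ _ mu _ measurableT _ (EFin \o (fun y => B * b y))).
- apply/measurable_EFinP; apply: measurable_funM => //.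
  exact: (measurable_fun_pair2 _ mk).
- move=> y _; rewrite /= lee_fin !normrM mulrC ler_wpM2r//.
  by rewrite (le_trans (kB _))// ler_norm.
- have := integrableZl measurableT B ib.
  by congr (integrable _ _ _); apply/funext => y /=; rewrite EFinM.
Qed.

End real_fubini.

Section fubini_tensor.
Context {R : realType}.
Local Notation mu := (@lebesgue_measure R).
Variables (a b : R -> R) (k : R * R -> R) (B : R).
Hypothesis ia : mu.-integrable setT (EFin \o a).
Hypothesis ib : mu.-integrable setT (EFin \o b).
Hypothesis mk : measurable_fun setT k.
Hypothesis kB : forall p, `|k p| <= B.

Let inner x : (\int[mu]_y (a x * b y * k (x, y))%:E =
  (a x * \int[mu]_y (b y * k (x, y)))%:E)%E.
Proof.
rewrite EFinM /Rintegral fineK; last first.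
  exact: (integrable_fin_num measurableT (integrable_bounded_mul ib mk kB x)).
rewrite -integralZl//; last exact: (integrable_bounded_mul ib mk kB x).
by apply: eq_integral => y _; rewrite -EFinM mulrA.
Qed.

Let outer y : (\int[mu]_x (a x * b y * k (x, y))%:E =
  (b y * \int[mu]_x (a x * k (x, y)))%:E)%E.
Proof.
have mk' : measurable_fun setT (fun p : R * R => k (p.2, p.1)).
  by apply: measurableT_comp => //; exact: measurable_fun_pair.
have kB' (p : R * R) : `|k (p.2, p.1)| <= B by [].
rewrite EFinM /Rintegral fineK; last first.
  exact: (integrable_fin_num measurableT (integrable_bounded_mul ia mk' kB' y)).
rewrite -integralZl//; last exact: (integrable_bounded_mul ia mk' kB' y).
by apply: eq_integral => x _; rewrite -EFinM mulrA [b y * _]mulrC.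
Qed.

(** The inner integrals are real-valued, so that formulas for [cosT], [sinT] and the Poisson
    integral can be substituted in them directly. *)
Lemma Fubini_tensor :
  (\int[mu]_x (a x * \int[mu]_y (b y * k (x, y)))%:E =
   \int[mu]_y (b y * \int[mu]_x (a x * k (x, y)))%:E)%E.
Proof.
under eq_integral do rewrite -inner.
under [RHS]eq_integral do rewrite -outer.
exact: (Fubini (integrable_tensor ia ib mk kB)).
Qed.

Lemma measurable_param_weighted :
  measurable_fun setT (fun x => a x * \int[mu]_y (b y * k (x, y))).
Proof.
have mF : measurable_fun setT (fubini_F mu (fun p : R * R => (a p.1 * b p.2 * k p)%:E)).
  exact: (measurable_fubini_F (integrable_tensor ia ib mk kB)).
apply/measurable_EFinP; move: mF; congr (measurable_fun _ _).
by apply/funext => x; rewrite /fubini_F/= inner.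
Qed.

End fubini_tensor.

(* The weight [exp (- |x|)] makes the tensor integrable, so that Fubini's theorem
   gives measurability; it is then divided out. *)
Lemma measurable_param {R : realType} (b : R -> R) (k : R * R -> R) (B : R) :
  (@lebesgue_measure R).-integrable setT (EFin \o b) ->
  measurable_fun setT k -> (forall p, `|k p| <= B) ->
  measurable_fun setT (fun x => \int[@lebesgue_measure R]_y (b y * k (x, y))).
Proof.
move=> ib mk kB.
have := measurable_param_weighted (integrable_expR_norm ltr01) ib mk kB.
set g := (fun x => _ * _) => mg.
rewrite (_ : (fun x => _) = (fun x => expR `|x| * g x)).
  by apply: measurable_funM => //; apply: measurableT_comp.
apply/funext => x; rewrite /g mul1r mulrA -expRD subrr expR0 mul1r//.
Qed.

(** * Plancherel's theorem for compactly supported functions *)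

Section cosine_sine_transform.
Context {R : realType}.
Local Notation mu := (@lebesgue_measure R).
Implicit Types v : R -> R.

Definition cosT v (om : R) : R := \int[mu]_t (v t * cos (om * t)).
Definition sinT v (om : R) : R := \int[mu]_t (v t * sin (om * t)).

(** Without the factor [1 / sqrt (2 pi)] of the transform, hence the constant [2 pi] in every
    comparison with [sqint]. *)
Definition energy v : \bar R := \int[mu]_om (cosT v om ^+ 2 + sinT v om ^+ 2)%:E.

Lemma measurable_cos : measurable_fun setT (@cos R).
Proof. by apply: continuous_measurable_fun; exact: continuous_cos. Qed.

Lemma measurable_sin : measurable_fun setT (@sin R).
Proof. by apply: continuous_measurable_fun; exact: continuous_sin. Qed.

Lemma measurable_cos_mul : measurable_fun setT (fun p : R * R => cos (p.1 * p.2)).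
Proof.
apply: (measurableT_comp measurable_cos).
by apply: measurable_funM; [exact: measurable_fst|exact: measurable_snd].
Qed.

Lemma measurable_sin_mul : measurable_fun setT (fun p : R * R => sin (p.1 * p.2)).
Proof.
apply: (measurableT_comp measurable_sin).
by apply: measurable_funM; [exact: measurable_fst|exact: measurable_snd].
Qed.

Section integrable_v.
Variable v : R -> R.
Hypothesis iv : mu.-integrable setT (EFin \o v).

Let mv : measurable_fun setT v.
Proof. by apply/measurable_EFinP; exact: (measurable_int mu iv). Qed.

Lemma integrable_mul_cos om : mu.-integrable setT (EFin \o (fun t => v t * cos (om * t))).
Proof.
exact: (integrable_bounded_mul iv measurable_cos_mul (fun p => cos_max _) om).
Qed.

Lemma integrable_mul_sin om : mu.-integrable setT (EFin \o (fun t => v t * sin (om * t))).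
Proof.
exact: (integrable_bounded_mul iv measurable_sin_mul (fun p => sin_max _) om).
Qed.

Lemma measurable_cosT : measurable_fun setT (cosT v).
Proof. exact: (measurable_param iv measurable_cos_mul (fun p => cos_max _)). Qed.

Lemma measurable_sinT : measurable_fun setT (sinT v).
Proof. exact: (measurable_param iv measurable_sin_mul (fun p => sin_max _)). Qed.

Let N := \int[mu]_t `|v t|.

Let iN : mu.-integrable setT (EFin \o (fun t => `|v t|)).
Proof. exact: integrable_norm. Qed.

Let cosT_le om : `|cosT v om| <= N.
Proof.
apply: (le_trans (le_normr_Rintegral measurableT (integrable_mul_cos om))).
apply: le_Rintegral => //.
  by have := integrable_norm (integrable_mul_cos om).
by move=> t _; rewrite normrM ler_piMr// cos_max.
Qed.

Let sinT_le om : `|sinT v om| <= N.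
Proof.
apply: (le_trans (le_normr_Rintegral measurableT (integrable_mul_sin om))).
apply: le_Rintegral => //.
  by have := integrable_norm (integrable_mul_sin om).
by move=> t _; rewrite normrM ler_piMr// sin_max.
Qed.

(** The real part of [exp (i om s)] times the transform [cosT v - i sinT v] at [om]. Integrated
    against [v s] it returns the energy density; integrated against [exp (- e |om|)] it gives the
    Poisson integral of [v] at [s]. *)
Let K (p : R * R) := cosT v p.1 * cos (p.1 * p.2) + sinT v p.1 * sin (p.1 * p.2).

Let mK : measurable_fun setT K.
Proof.
apply: measurable_funD; apply: measurable_funM.
- exact: (measurableT_comp measurable_cosT measurable_fst).
- exact: measurable_cos_mul.
- exact: (measurableT_comp measurable_sinT measurable_fst).
- exact: measurable_sin_mul.
Qed.

Let K_le p : `|K p| <= N + N.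
Proof.
apply: (le_trans (ler_normD _ _)); rewrite !normrM.
have N0 : 0 <= N by apply: Rintegral_ge0.
apply: lerD.
  apply: le_trans (cosT_le p.1); rewrite ler_piMr//; exact: cos_max.
apply: le_trans (sinT_le p.1); rewrite ler_piMr//; exact: sin_max.
Qed.

Let w (e om : R) := expR (- (e * `|om|)).

Let K_shift om s : K (om, s) = \int[mu]_t (v t * cos (om * (t - s))).
Proof.
rewrite /K /cosT /sinT /=.
rewrite -!RintegralZr//; try exact: integrable_mul_cos; try exact: integrable_mul_sin.
rewrite -RintegralD//; last 2 first.
- have := integrableZr measurableT (cos (om * s)) (integrable_mul_cos om).
  by congr (integrable _ _ _).
- have := integrableZr measurableT (sin (om * s)) (integrable_mul_sin om).
  by congr (integrable _ _ _).
by apply: eq_Rintegral => t _; rewrite mulrBr cosB; ring.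
Qed.

Let poisson_at (e s : R) : 0 < e ->
  \int[mu]_om (w e om * K (om, s)) = \int[mu]_t (v t * pker e (t - s)).
Proof.
move=> e0.
have iw := integrable_expR_norm e0.
pose k (p : R * R) := cos (p.1 * (p.2 - s)).
have mk : measurable_fun setT k.
  apply: (measurableT_comp measurable_cos); apply: measurable_funM => //.
  by apply: measurable_funB => //; exact: measurable_snd.
have := congr1 fine (Fubini_tensor iw iv mk (fun p => cos_max _)).
rewrite -![fine _]/(Rintegral _ _ _).
under eq_Rintegral do rewrite /k/= -K_shift.
move=> ->; apply: eq_Rintegral => t _; congr (_ * _).
by rewrite /k/= /Rintegral integral_expR_cos.
Qed.

(** Both sides are the double integral of [exp (- e |om|) v s K (om, s)], in the two orders. The
    exponential weight is what makes it absolutely convergent. *)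
Lemma abel_energy (e : R) : 0 < e ->
  (\int[mu]_om (expR (- (e * `|om|)) * (cosT v om ^+ 2 + sinT v om ^+ 2))%:E =
   \int[mu]_s (v s * \int[mu]_t (v t * pker e (t - s)))%:E)%E.
Proof.
move=> e0; have iw := integrable_expR_norm e0.
under [RHS]eq_integral do rewrite -poisson_at//.
rewrite -(Fubini_tensor iw iv mK K_le).
apply: eq_integral => om _; congr (_ * _)%:E.
rewrite /K /=.
transitivity (\int[mu]_y (cosT v om * (v y * cos (om * y)) + sinT v om * (v y * sin (om * y)))).
  rewrite RintegralD//; last 2 first.
  - have := integrableZl measurableT (cosT v om) (integrable_mul_cos om).
    by congr (integrable _ _ _).
  - have := integrableZl measurableT (sinT v om) (integrable_mul_sin om).
    by congr (integrable _ _ _).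
  rewrite !RintegralZl//; try exact: integrable_mul_cos; try exact: integrable_mul_sin.
by apply: eq_Rintegral => t _; ring.
Qed.

Lemma measurable_energy_density :
  measurable_fun setT (fun om => cosT v om ^+ 2 + sinT v om ^+ 2).
Proof.
by apply: measurable_funD; apply: measurable_funX;
  [exact: measurable_cosT|exact: measurable_sinT].
Qed.

Lemma measurable_abel_energy (e : R) :
  measurable_fun setT (fun om : R => expR (- (e * `|om|)) * (cosT v om ^+ 2 + sinT v om ^+ 2)).
Proof.
apply: measurable_funM; first exact: measurable_expR_norm.
exact: measurable_energy_density.
Qed.

Lemma abel_energy_le (e : R) : 0 < e ->
  (\int[mu]_om (expR (- (e * `|om|)) * (cosT v om ^+ 2 + sinT v om ^+ 2))%:E
   <= energy v)%E.
Proof.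
move=> e0; apply: ge0_le_integral => //.
- by move=> om _; rewrite lee_fin mulr_ge0 ?expR_ge0// addr_ge0 ?sqr_ge0.
- by apply/measurable_EFinP; exact: measurable_abel_energy.
- by apply/measurable_EFinP; exact: measurable_energy_density.
- move=> om _; rewrite lee_fin ler_piMl ?addr_ge0 ?sqr_ge0//.
  by rewrite -[leRHS]expR0 ler_expR oppr_le0 mulr_ge0// ltW.
Qed.

(** The weights increase to 1, so monotone convergence applies even when the energy is not yet known
    to be finite. *)
Lemma cvg_abel_energy :
  (\int[mu]_om (expR (- (n.+1%:R^-1 * `|om|)) * (cosT v om ^+ 2 + sinT v om ^+ 2))%:E)%E
    @[n --> \oo] --> energy v.
Proof.
pose g n om := (expR (- (n.+1%:R^-1 * `|om|)) * (cosT v om ^+ 2 + sinT v om ^+ 2))%:E.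
have -> : energy v = (\int[mu]_om (fun x => limn (g ^~ x)) om)%E.
  apply: eq_integral => om _; apply/esym/cvg_lim => //.
  apply: cvg_EFin; first exact: nearW.
  rewrite /g /= -[X in _ --> X]mul1r; apply: cvgMl.
  have A : (- (n.+1%:R^-1 * `|om|)) @[n --> \oo] --> (0 : R).
    rewrite -[X in _ --> X]oppr0; apply: cvgN; rewrite -[X in _ --> X](mul0r `|om|).
    by apply: cvgMl; exact: cvg_harmonic.
  by have := cvg_comp _ _ A (@continuous_expR R 0); rewrite expR0.
apply: (@cvg_monotone_convergence _ _ R mu setT measurableT g).
- by move=> n; apply/measurable_EFinP; exact: measurable_abel_energy.
- by move=> n om _; rewrite lee_fin mulr_ge0 ?expR_ge0// addr_ge0 ?sqr_ge0.
- move=> om _ m n mn; rewrite lee_fin ler_wpM2r ?addr_ge0 ?sqr_ge0//.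
  rewrite ler_expR lerN2 ler_wpM2r// lef_pV2 ?posrE//.
  by rewrite ler_nat.
Qed.

End integrable_v.

Lemma integrable_pker (e s : R) : 0 < e ->
  mu.-integrable setT (EFin \o (fun t : R => pker e (t - s))).
Proof.
move=> e0; have m : measurable_fun setT (fun t : R => pker e (t - s)).
  by apply: (measurableT_comp (measurable_pker e0)); exact: measurable_funB.
apply/integrableP; split; first exact/measurable_EFinP.
rewrite (_ : (\int[mu]_x _)%E = (2 * pi)%:E) ?ltry//.
rewrite -(integral_pker s e0); apply: eq_integral => t _.
by rewrite /= ger0_norm// pker_ge0.
Qed.

Lemma pker_le (e r : R) : 0 < e -> `|pker e r| <= 2 / e.
Proof.
move=> e0; rewrite ger0_norm ?pker_ge0// /pker ler_pdivrMr ?pker_den_gt0//.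
have -> : 2 / e * (e ^+ 2 + r ^+ 2) = 2 * e + 2 / e * r ^+ 2.
  by field; rewrite gt_eqF.
by rewrite lerDl mulr_ge0 ?sqr_ge0// divr_ge0// ltW.
Qed.

Lemma measurable_pker2 (e : R) : 0 < e ->
  measurable_fun setT (fun p : R * R => pker e (p.2 - p.1)).
Proof.
move=> e0; apply: (measurableT_comp (measurable_pker e0)).
by apply: measurable_funB; [exact: measurable_snd|exact: measurable_fst].
Qed.

(* AM-GM: [v s * v t <= (v s ^+ 2 + v t ^+ 2) / 2], and the Poisson kernel has mass [2 pi]. *)
Lemma abel_energy_bessel v (e : R) : 0 < e -> mu.-integrable setT (EFin \o v) ->
  (\int[mu]_s (v s * \int[mu]_t (v t * pker e (t - s)))%:E <= (2 * pi)%:E * sqint v)%E.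
Proof.
move=> e0 iv.
have mv : measurable_fun setT v by apply/measurable_EFinP; exact: (measurable_int mu iv).
have mv2 : measurable_fun setT (fun t => v t ^+ 2) by exact: measurable_funX.
have mp s : measurable_fun setT (fun t : R => pker e (t - s)).
  by apply/measurable_EFinP; exact: (measurable_int mu (integrable_pker s e0)).
(* The two halves of the majorant. Each has iterated integral [pi * sqint v], the second after
   exchanging the order of integration and using that the kernel is even. *)
pose h1 (p : R * R) := (v p.1 ^+ 2 / 2 * pker e (p.2 - p.1))%:E.
pose h2 (p : R * R) := (v p.2 ^+ 2 / 2 * pker e (p.2 - p.1))%:E.
have mv3 : measurable_fun setT (fun t => v t ^+ 2 / 2) by exact: measurable_funM.
have mh1 : measurable_fun setT h1.
  apply/measurable_EFinP; apply: measurable_funM; last exact: measurable_pker2.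
  exact: (measurableT_comp mv3 measurable_fst).
have mh2 : measurable_fun setT h2.
  apply/measurable_EFinP; apply: measurable_funM; last exact: measurable_pker2.
  exact: (measurableT_comp mv3 measurable_snd).
have v0 t : 0 <= v t ^+ 2 / 2 by rewrite divr_ge0// sqr_ge0.
have h10 p : (0 <= h1 p)%E by rewrite lee_fin mulr_ge0 ?pker_ge0.
have h20 p : (0 <= h2 p)%E by rewrite lee_fin mulr_ge0 ?pker_ge0.
have pi0 : 0 <= pi :> R by exact: pi_ge0.
have E0 : (\int[mu]_s (pi * v s ^+ 2)%:E = pi%:E * sqint v)%E.
  by rewrite /sqint -ge0_integralZl_real// => t _; exact: sqr_ge0.
have E1 : (\int[mu]_s \int[mu]_t h1 (s, t) = pi%:E * sqint v)%E.
  rewrite -E0; apply: eq_integral => s _; rewrite /h1/= ge0_integralZl_real//; last first.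
    by move=> t _; exact: pker_ge0.
  by rewrite integral_pker// -EFinM; congr EFin; field.
have E2 : (\int[mu]_s \int[mu]_t h2 (s, t) = pi%:E * sqint v)%E.
  rewrite fubini_tonelli// -E0; apply: eq_integral => t _.
  transitivity (\int[mu]_s (v t ^+ 2 / 2 * pker e (s - t))%:E)%E.
    by apply: eq_integral => s _; rewrite /h2/= -opprB pkerN.
  rewrite ge0_integralZl_real//; last by move=> s _; exact: pker_ge0.
  by rewrite integral_pker// -EFinM; congr EFin; field.
have i1 s : (\int[mu]_t (h1 (s, t) + h2 (s, t)) = \int[mu]_t h1 (s, t) + \int[mu]_t h2 (s, t))%E.
  rewrite ge0_integralD//.
  - exact: (measurable_fun_pair2 _ mh1).
  - exact: (measurable_fun_pair2 _ mh2).
have m1 := @measurable_fun_fubini_tonelli_F _ _ _ _ R mu h1 mh1 h10.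
have m2 := @measurable_fun_fubini_tonelli_F _ _ _ _ R mu h2 mh2 h20.
have Eh : (\int[mu]_s \int[mu]_t (h1 (s, t) + h2 (s, t)) = (2 * pi)%:E * sqint v)%E.
  under eq_integral do rewrite i1.
  rewrite ge0_integralD//; try (by move=> s _; apply: integral_ge0).
  rewrite E1 E2 -ge0_muleDl ?lee_fin// -EFinD; congr (_%:E * _)%E; ring.
have mP : measurable_fun setT (fun s : R => \int[mu]_t (v t * pker e (t - s))).
  exact: (measurable_param iv (measurable_pker2 e0) (fun p => pker_le _ e0)).
rewrite -Eh; apply: (le_trans (lee_abs _)); apply: (le_trans (le_abse_integral _ _ _)) => //.
  by apply/measurable_EFinP; exact: measurable_funM.
apply: ge0_le_integral => //.
- by apply: measurableT_comp => //; apply/measurable_EFinP; exact: measurable_funM.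
- apply: (eq_measurable_fun (fun s => \int[mu]_t h1 (s, t) + \int[mu]_t h2 (s, t))%E).
    by move=> s _; rewrite i1.
  exact: emeasurable_funD.
- move=> s _.
  have is_ := integrable_bounded_mul iv (measurable_pker2 e0) (fun p => pker_le _ e0) s.
  rewrite /= normrM EFinM EFin_normr_Rintegral//.
  apply: (@le_trans _ _ (`|v s|%:E * \int[mu]_t `|(v t * pker e (t - s))%:E|)%E).
    rewrite lee_wpmul2l// le_abse_integral//; exact: (measurable_int mu is_).
  rewrite -ge0_integralZl_EFin//; last first.
    by apply: measurableT_comp => //; exact: (measurable_int mu is_).
  apply: ge0_le_integral => //.
  + by apply: emeasurable_funM => //; apply: measurableT_comp => //; exact: (measurable_int mu is_).
  + by apply: emeasurable_funD; [exact: (measurable_fun_pair2 _ mh1)|exact: (measurable_fun_pair2 _ mh2)].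
  + move=> t _; rewrite /h1 /h2 /= -EFinM -EFinD lee_fin -mulrDl normrM mulrA.
    rewrite [X in _ * X]ger0_norm ?pker_ge0// ler_wpM2r ?pker_ge0//.
    rewrite -subr_ge0 -(real_normK (num_real (v s))) -(real_normK (num_real (v t))).
    rewrite (_ : _ - _ = (`|v s| - `|v t|) ^+ 2 / 2); last by field.
    by rewrite divr_ge0// sqr_ge0.
Qed.

Lemma energy_bessel v : mu.-integrable setT (EFin \o v) ->
  (energy v <= (2 * pi)%:E * sqint v)%E.
Proof.
move=> iv; apply: (cvge_to_le (cvg_abel_energy iv)); apply: nearW => n.
by rewrite abel_energy// abel_energy_bessel.
Qed.

End cosine_sine_transform.

(** * Convergence of Poisson integrals at continuity points *)

Section poisson_approximation.
Context {R : realType}.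
Local Notation mu := (@lebesgue_measure R).

Lemma integrable_mul_bounded (b c : R -> R) (B : R) :
  mu.-integrable setT (EFin \o b) -> measurable_fun setT c ->
  (forall t, `|c t| <= B) -> mu.-integrable setT (EFin \o (fun t => c t * b t)).
Proof.
move=> ib mc cB.
have mb : measurable_fun setT b by apply/measurable_EFinP; exact: (measurable_int mu ib).
apply: (@le_integrable _ _ _ mu _ measurableT _ (EFin \o (fun y => B * b y))).
- by apply/measurable_EFinP; exact: measurable_funM.
- move=> y _; rewrite /= lee_fin !normrM ler_wpM2r//.
  by rewrite (le_trans (cB _))// ler_norm.
- have := integrableZl measurableT B ib.
  by congr (integrable _ _ _); apply/funext => y /=; rewrite EFinM.
Qed.

(** For [|r| >= rho], [1 / r^2] is at most [(1 + rho^-2) / (1 + r^2)]. Outside a neighbourhood of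
    the origin the kernel is thus [e] times a fixed integrable function. *)
Lemma pker_tail (e rho r : R) : 0 < e -> 0 < rho -> rho <= `|r| ->
  pker e r <= e * (1 + (rho ^+ 2)^-1) * pker 1 r.
Proof.
move=> e0 rho0 rr; have r2 : rho ^+ 2 <= r ^+ 2.
  by rewrite -(real_normK (num_real r)) ler_sqr// ?nnegrE// ltW.
have rho2 : 0 < rho ^+ 2 by rewrite exprn_gt0.
have r20 : 0 < r ^+ 2 by exact: lt_le_trans r2.
apply: (@le_trans _ _ (2 * e / r ^+ 2)).
  rewrite /pker ler_wpM2l ?mulr_ge0 ?(ltW e0)// lef_pV2 ?posrE ?pker_den_gt0//.
  by rewrite lerDr sqr_ge0.
rewrite /pker ler_pdivrMr// expr1n mulr1.
have -> : e * (1 + (rho ^+ 2)^-1) * (2 / (1 + r ^+ 2)) * r ^+ 2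
        = 2 * e * ((1 + (rho ^+ 2)^-1) * r ^+ 2 / (1 + r ^+ 2)) by ring.
rewrite ler_pMr ?mulr_gt0// ler_pdivlMr ?mul1r; last by rewrite addr_gt0.
rewrite mulrDl mul1r addrC lerD2l mulrC ler_pdivlMr// mul1r//.
Qed.

Lemma Rintegral_pker (e s : R) : 0 < e -> \int[mu]_t pker e (t - s) = 2 * pi.
Proof. by move=> e0; rewrite /Rintegral integral_pker. Qed.

Section at_continuity_point.
Variables (psi : R -> R) (B s : R).
Hypothesis mpsi : measurable_fun setT psi.
Hypothesis psiB : forall t, `|psi t| <= B.

Lemma poisson_le (e : R) : 0 < e ->
  `|\int[mu]_t (psi t * pker e (t - s))| <= B * (2 * pi).
Proof.
move=> e0.
have i := integrable_mul_bounded (integrable_pker s e0) mpsi psiB.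
apply: (le_trans (le_normr_Rintegral measurableT i)).
rewrite -(Rintegral_pker s e0) -RintegralZl//; last exact: integrable_pker.
apply: le_Rintegral => //.
- exact: (integrable_norm i).
- have := integrableZl measurableT B (integrable_pker s e0).
  by congr (integrable _ _ _); apply/funext => y /=; rewrite EFinM.
- move=> t _; rewrite normrM [X in _ * X]ger0_norm ?pker_ge0// ler_wpM2r ?pker_ge0//.
Qed.

(** The usual approximate-identity argument: continuity controls [|t - s| < rho], and [pker_tail]
    together with [|psi s - psi t| <= 2 B] controls the rest. The kernel has mass [2 pi], so the
    choice of [eta] makes the near part [eps / 2]. *)
Lemma poisson_cvg : {for s, continuous psi} ->
  \int[mu]_t (psi t * pker n.+1%:R^-1 (t - s)) @[n --> \oo] --> 2 * pi * psi s.
Proof.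
move=> cpsi; apply/cvgrPdist_le => eps eps0.
have pi0 : 0 < 2 * pi :> R by rewrite mulr_gt0// pi_gt0.
have B0 : 0 <= B by apply: le_trans (psiB 0).
pose eta := eps / 2 / (2 * pi).
have eta0 : 0 < eta by rewrite !divr_gt0.
have /cvgrPdist_le/(_ _ eta0)/nbhs_ballP[rho rho0 Hrho] := cpsi.
pose c := 2 * B * (1 + (rho ^+ 2)^-1).
have c0 : 0 <= c.
  by rewrite /c !mulr_ge0// addr_ge0// invr_ge0 sqr_ge0.
(* The [+ 1] keeps the divisor positive when [B], and with it [c], is 0. *)
have C0 : 0 < 2 * pi * c + 1 by rewrite ltr_wpDl// mulr_ge0// ltW.
have := @cvg_harmonic R; move/cvgrPdist_le/(_ _ (divr_gt0 (divr_gt0 eps0 (@ltr0Sn R 1)) C0)).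
apply: filterS => n; rewrite sub0r normrN /harmonic ger0_norm ?invr_ge0//.
set e := n.+1%:R^-1 => he.
have e0 : 0 < e by rewrite invr_gt0.
have i := integrable_mul_bounded (integrable_pker s e0) mpsi psiB.
have ip := integrable_pker s e0; have ip1 := integrable_pker s (@ltr01 R).
have iZ a e' : 0 < e' -> mu.-integrable setT (EFin \o (fun t : R => a * pker e' (t - s))).
  move=> e'0; have := integrableZl measurableT a (integrable_pker s e'0).
  by congr (integrable _ _ _); apply/funext => y /=; rewrite EFinM.
have -> : 2 * pi * psi s - \int[mu]_t (psi t * pker e (t - s))
        = \int[mu]_t (psi s * pker e (t - s) - psi t * pker e (t - s)).
  by rewrite RintegralB//; [rewrite RintegralZl// Rintegral_pker// mulrC|exact: iZ].
have id : mu.-integrable setT (EFin \o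
    (fun t : R => psi s * pker e (t - s) - psi t * pker e (t - s))).
  have := integrableB measurableT (iZ (psi s) e e0) i.
  by congr (integrable _ _ _).
apply: (le_trans (le_normr_Rintegral measurableT id)).
(* The sum of the near and far bounds is a majorant on the whole line, which avoids splitting the
   domain of integration. *)
apply: (@le_trans _ _ (\int[mu]_t (eta * pker e (t - s) + (c * e) * pker 1 (t - s)))).
  apply: le_Rintegral => //.
  - exact: (integrable_norm id).
  - have := integrableD measurableT (iZ eta e e0) (iZ (c * e) 1 ltr01).
    by congr (integrable _ _ _).
  - move=> t _; rewrite -mulrBl normrM [X in _ * X]ger0_norm ?pker_ge0//.
    have [ts|ts] := ltP `|t - s| rho.
      rewrite (@le_trans _ _ (eta * pker e (t - s)))//.
        by rewrite ler_wpM2r ?pker_ge0//; apply: Hrho; rewrite /ball/= distrC.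
      by rewrite lerDl mulr_ge0 ?pker_ge0// mulr_ge0// ltW.
    rewrite (@le_trans _ _ (2 * B * (e * (1 + (rho ^+ 2)^-1) * pker 1 (t - s))))//.
      apply: ler_pM => //; first exact: pker_ge0.
        by rewrite (le_trans (ler_normB _ _))// mulr_natl mulr2n lerD.
      exact: pker_tail.
    rewrite /c (_ : 2 * B * (e * _ * _) =
       2 * B * (1 + (rho ^+ 2)^-1) * e * pker 1 (t - s)); last by ring.
    by rewrite lerDr mulr_ge0 ?pker_ge0// ltW.
rewrite RintegralD//; try exact: iZ.
have E1 : \int[mu]_t (eta * pker e (t - s)) = eta * (2 * pi).
  by rewrite RintegralZl// Rintegral_pker.
have E2 : \int[mu]_t (c * e * pker 1 (t - s)) = c * e * (2 * pi).
  by rewrite RintegralZl// Rintegral_pker.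
rewrite E1 E2.
have -> : eta * (2 * pi) = eps / 2 by rewrite /eta divfK// gt_eqF.
rewrite [leRHS](_ : eps = eps / 2 + eps / 2); last by field.
rewrite lerD2l; move: he; rewrite ler_pdivlMr// => he.
apply: le_trans he.
rewrite (_ : e * (2 * pi * c + 1) = c * e * (2 * pi) + e); last by ring.
by rewrite lerDl ltW.
Qed.

End at_continuity_point.

(** The Abel means stay below the energy, and by dominated convergence, with majorant
    [2 pi B |psi|], they tend to the left side. Where [psi s = 0] the integrand vanishes
    identically, so continuity is needed only where [psi] is nonzero. *)
Lemma energy_ge (psi : R -> R) (B : R) : mu.-integrable setT (EFin \o psi) ->
  (forall t, `|psi t| <= B) ->
  (forall s, psi s != 0 -> {for s, continuous psi}) ->
  ((2 * pi)%:E * sqint psi <= energy psi)%E.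
Proof.
move=> ipsi psiB cpsi.
have mpsi : measurable_fun setT psi.
  by apply/measurable_EFinP; exact: (measurable_int mu ipsi).
have pi0 : 0 <= 2 * pi :> R by rewrite mulr_ge0// pi_ge0.
have B0 : 0 <= B by apply: le_trans (psiB 0).
pose e n : R := n.+1%:R^-1.
have e0 n : 0 < e n by rewrite invr_gt0.
pose f n s := (psi s * \int[mu]_t (psi t * pker (e n) (t - s)))%:E.
have mf n : measurable_fun setT (f n).
  apply/measurable_EFinP; apply: measurable_funM => //.
  exact: (measurable_param ipsi (measurable_pker2 (e0 n)) (fun p => pker_le _ (e0 n))).
have ml : measurable_fun setT (fun s => (2 * pi * psi s ^+ 2)%:E).
  by apply/measurable_EFinP; apply: measurable_funM => //; exact: measurable_funX.
have cf : {ae mu, forall s, setT s -> f n s @[n --> \oo] --> (2 * pi * psi s ^+ 2)%:E}.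
  apply/aeW => s _; apply: cvg_EFin; first exact: nearW.
  rewrite /f/=; have [->|/cpsi cs] := eqVneq (psi s) 0.
    by rewrite expr0n/= mulr0; under eq_fun do rewrite mul0r; exact: cvg_cst.
  rewrite (_ : 2 * pi * psi s ^+ 2 = psi s * (2 * pi * psi s)); last by ring.
  by apply: cvgMr; exact: (poisson_cvg mpsi psiB cs).
have ig : mu.-integrable setT (fun s => (B * (2 * pi) * `|psi s|)%:E).
  have := integrableZl measurableT (B * (2 * pi)) (integrable_norm ipsi).
  by congr (integrable _ _ _); apply/funext => t /=; rewrite EFinM.
have df : {ae mu, forall s n, setT s -> (`|f n s| <= (B * (2 * pi) * `|psi s|)%:E)%E}.
  apply/aeW => s n _; rewrite /f/= lee_fin normrM mulrC ler_wpM2r//.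
  exact: poisson_le.
have [_ _ H] := @dominated_convergence _ _ R mu setT measurableT f _ _ mf ml cf ig df.
have -> : ((2 * pi)%:E * sqint psi = \int[mu]_s (2 * pi * psi s ^+ 2)%:E)%E.
  by rewrite ge0_integralZl_real//; [exact: measurable_funX|move=> t _; exact: sqr_ge0].
apply: (cvge_to_le H).
by apply: nearW => n; rewrite /f /= -abel_energy//; exact: abel_energy_le.
Qed.

End poisson_approximation.

(** * Approximation in L2 by functions continuous on their support *)

Section density.
Context {R : realType}.
Local Notation mu := (@lebesgue_measure R).

(** [|v| <= 1 + v^2], and constants are integrable on a set of finite measure. *)
Lemma sq_integrable_integrable (D : set R) (v : R -> R) : measurable D ->
  (mu D < +oo)%E -> measurable_fun D v ->
  (\int[mu]_(t in D) (v t ^+ 2)%:E < +oo)%E -> mu.-integrable D (EFin \o v).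
Proof.
move=> mD Doo mv voo; apply/integrableP; split; first exact/measurable_EFinP.
have mv2 : measurable_fun D (fun t => v t ^+ 2) by exact: measurable_funX.
apply: (@le_lt_trans _ _ (\int[mu]_(t in D) (1 + v t ^+ 2)%:E)%E).
  apply: ge0_le_integral => //.
  - by apply: measurableT_comp => //; exact/measurable_EFinP.
  - by apply/measurable_EFinP; exact: measurable_funD.
  - move=> t _; rewrite /= lee_fin -(real_normK (num_real (v t))).
    by have := sqr_ge0 (`|v t| - 1); have := normr_ge0 (v t); nra.
rewrite ge0_integralD_real//; last by move=> t _; exact: sqr_ge0.
by rewrite lte_add_pinfty// integral_cst// mul1e.
Qed.

(** For [0 <= B], the projection of [x] on [[- B, B]], written with absolute values so that
    continuity is immediate. *)
Definition clamp (B x : R) : R := (`|x + B| - `|x - B|) / 2.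

(** One factor [|u - clamp B x|] is at most [2 B], the other at most [|u - x|]. This turns an L1
    approximation of a bounded function into an L2 approximation. *)
Lemma clamp_dist (B x u : R) : `|u| <= B -> (u - clamp B x) ^+ 2 <= 2 * B * `|u - x|.
Proof.
rewrite ler_norml => /andP[uB1 uB2]; rewrite /clamp.
have [h1|h1] := ger0P (x + B); have [h2|h2] := ger0P (x - B);
  have [h3|h3] := ger0P (u - x); nra.
Qed.

Lemma clamp_le (B x : R) : 0 <= B -> `|clamp B x| <= B.
Proof.
move=> B0; rewrite /clamp ler_norml; apply/andP; split;
  have [h1|h1] := ger0P (x + B); have [h2|h2] := ger0P (x - B); lra.
Qed.

Lemma continuous_clamp (B : R) : continuous (clamp B).
Proof.
move=> x; apply: cvgMl; apply: cvgB.
  apply: cvg_norm; apply: cvgD; [exact: cvg_id|exact: cvg_cst].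
apply: cvg_norm; apply: cvgB; [exact: cvg_id|exact: cvg_cst].
Qed.

Lemma bounded_approx (v : R -> R) (eps : R) : 0 < eps -> measurable_fun setT v ->
  (sqint v < +oo)%E ->
  exists B : R, 0 < B /\
    (sqint (v \- (fun t => if `|v t| <= B then v t else 0))%R < eps%:E)%E.
Proof.
move=> eps0 mv voo.
pose u (n : nat) t := if `|v t| <= n%:R then v t else 0.
have mvu n : measurable_fun setT (u n).
  apply: measurable_fun_ifT => //.
  by apply: measurable_fun_ler => //; exact: measurableT_comp.
pose f n t := ((v t - u n t) ^+ 2)%:E.
have mf n : measurable_fun setT (f n).
  by apply: measurable_sqr; exact: measurable_funB.
have cf : {ae mu, forall t, setT t -> f n t @[n --> \oo] --> (0 : R)%:E}.
  apply/aeW => t _; apply: (@cvg_near_cst _ _ _ _ _ _ _); near=> n.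
  rewrite /f /u ifT ?subrr ?expr0n//.
  by near: n; exact: nbhs_infty_ger.
have ig : mu.-integrable setT (fun t => (v t ^+ 2)%:E).
  apply/integrableP; split; first exact: measurable_sqr.
  apply: le_lt_trans voo; rewrite le_eqVlt; apply/orP; left; apply/eqP.
  by apply: eq_integral => t _; rewrite gee0_abs// lee_fin sqr_ge0.
have df : {ae mu, forall t n, setT t -> (`|f n t| <= (v t ^+ 2)%:E)%E}.
  apply/aeW => t n _; rewrite /f /u gee0_abs ?lee_fin ?sqr_ge0//.
  by case: ifP => _; rewrite ?subr0// subrr expr0n sqr_ge0.
have [_ _ H] := @dominated_convergence _ _ R mu setT measurableT f _ _ mf
  (measurable_cst _) cf ig df.
have {H} : (sqint (v \- u n)%R) @[n --> \oo] --> 0%E.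
  by move: H; rewrite /= integral0.
move/ge0_cvge0P => /(_ (fun n => sqint_ge0 _) _ eps0)[n _ /(_ n.+1) /(_ (leqnSn n))] H.
(* [n.+1] rather than [n], so that [B] is positive. *)
exists n.+1%:R; split => //.
Unshelve. all: by end_near. Qed.

(* Only continuity on the support is asked of [psi], which may therefore be cut off
   sharply at [N] and [- N]. *)
Lemma dense_continuous (v : R -> R) (N eps : R) : 0 < eps ->
  measurable_fun setT v -> (sqint v < +oo)%E ->
  (forall t, t \notin `]- N, N[ -> v t = 0) ->
  exists psi B, [/\ mu.-integrable setT (EFin \o psi),
    forall t, `|psi t| <= B,
    forall s, psi s != 0 -> {for s, continuous psi} &
    (sqint (v \- psi)%R <= eps%:E)%E].
Proof.
move=> eps0 mv voo vN.
(* There are two errors, from truncating [v] and from approximating the truncation; Young's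
   inequality with [eta = 1] doubles each. *)
have eps4 : 0 < eps / 4 by rewrite divr_gt0.
have [B [B0 vB]] := bounded_approx eps4 mv voo.
set u := (fun t => if `|v t| <= B then v t else 0) in vB.
have mvu : measurable_fun setT u.
  apply: measurable_fun_ifT => //.
  by apply: measurable_fun_ler => //; exact: measurableT_comp.
have uB t : `|u t| <= B by rewrite /u; case: ifP => // _; rewrite normr0 ltW.
have uN t : t \notin `]- N, N[ -> u t = 0.
  by move=> /vN ut; rewrite /u ut if_same.
pose E : set R := [set` `]- N, N[].
have mE : measurable E by exact: measurable_itv.
have Eoo : (mu E < +oo)%E.
  by rewrite /E lebesgue_measure_itv/=; case: ifP => // _; rewrite -EFinB ltry.
have iu : mu.-integrable E (EFin \o u).
  apply: sq_integrable_integrable => //; first exact: measurable_funTS.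
  apply: (@le_lt_trans _ _ (\int[mu]_(t in E) (cst (B ^+ 2)%:E) t)%E); last first.
    by rewrite integral_cst// lte_mul_pinfty// lee_fin sqr_ge0.
  apply: ge0_le_integral => //.
  - by move=> t _; rewrite lee_fin sqr_ge0.
  - by apply: measurable_sqr; exact: measurable_funTS.
  - move=> t _; rewrite /= lee_fin -(real_normK (num_real (u t))) ler_sqr ?nnegrE//.
    exact: ltW.
have [g [cg ig]] := approximation_continuous_integrable mE Eoo iu.
(* [g n] approximates [u] in L1 on [E]; the factor [2 B] of [clamp_dist] turns this tolerance into
   [eps / 4]. *)
have e' : 0 < eps / (8 * B) by rewrite divr_gt0// mulr_gt0.
have g0 n : (0 <= \int[mu]_(z in E) `|(u z - g n z)%:E|)%E.
  by apply: integral_ge0.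
move=> gcvg; have [n _ /(_ n (leqnn n)) gn] := (ge0_cvge0P g0).1 gcvg _ e'.
pose psi := (clamp B \o g n) \_ E.
have mclg : measurable_fun setT (clamp B \o g n).
  apply: measurableT_comp; first by apply: continuous_measurable_fun; exact: continuous_clamp.
  by apply: continuous_measurable_fun; exact: cg.
have mpsi : measurable_fun setT psi.
  by apply/(measurable_restrictT _ _).1 => //; exact: measurable_funTS.
have psiB t : `|psi t| <= B.
  rewrite /psi patchE; case: ifP => _; first exact/clamp_le/ltW.
  by rewrite normr0 ltW.
exists psi, B; split => //.
- rewrite (_ : EFin \o psi = (EFin \o (clamp B \o g n)) \_ E); last first.
    by rewrite restrict_EFin.
  apply/(integrable_mkcond _ _).1 => //.
  apply: sq_integrable_integrable => //; first exact: measurable_funTS.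
  apply: (@le_lt_trans _ _ (\int[mu]_(t in E) (cst (B ^+ 2)%:E) t)%E); last first.
    by rewrite integral_cst// lte_mul_pinfty// lee_fin sqr_ge0.
  apply: ge0_le_integral => //.
  + by move=> t _; rewrite lee_fin sqr_ge0.
  + by apply: measurable_sqr; exact: measurable_funTS.
  + move=> t _; rewrite /= lee_fin -(real_normK (num_real (clamp B (g n t)))) ler_sqr ?nnegrE//.
      exact/clamp_le/ltW.
    exact: ltW.
- move=> s; rewrite /psi patchE; case: ifPn => [|_]; last by rewrite eqxx.
  rewrite inE => Es _.
  have cc : {for s, continuous (clamp B \o g n)}.
    by apply: continuous_comp; [exact: cg|exact: continuous_clamp].
  have oE : nbhs s E by apply: open_nbhs_nbhs; split => //; exact: interval_open.
  suff : psi t @[t --> s] --> psi s by [].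
  have -> : psi s = (clamp B \o g n) s by rewrite /psi patchE mem_set.
  apply: cvg_trans cc; apply: near_eq_cvg; apply: filterS oE => t Et.
  by rewrite /psi patchE mem_set.
have H2 : (sqint (u \- psi)%R <= (eps / 4)%:E)%E.
  apply: (@le_trans _ _ (\int[mu]_(t in E) (2 * B * `|u t - g n t|)%:E)%E).
    rewrite [leRHS]integral_mkcond /sqint; apply: ge0_le_integral => //.
    - by move=> t _; rewrite lee_fin sqr_ge0.
    - by apply: measurable_sqr; exact: measurable_funB.
    - apply/(measurable_restrictT _ _).1 => //; apply/measurable_EFinP.
      apply: measurable_funTS; apply: measurable_funM => //.
      apply: measurableT_comp => //; apply: measurable_funB => //.
      by apply: continuous_measurable_fun; exact: cg.
    - move=> t _; rewrite /psi /= !patchE; case: ifPn => tE.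
        by rewrite lee_fin; apply: clamp_dist.
      rewrite uN ?subrr ?expr0n//.
      by apply: contra tE => tE; rewrite inE.
  rewrite ge0_integralZl_real//; last 2 first.
  - apply: measurable_funTS; apply: measurableT_comp => //; apply: measurable_funB => //.
    by apply: continuous_measurable_fun; exact: cg.
  - by rewrite mulr_ge0// ltW.
  apply: (@le_trans _ _ ((2 * B)%:E * (eps / (8 * B))%:E)%E).
    rewrite lee_wpmul2l// ?lee_fin ?mulr_ge0// ?(ltW B0)//.
    by apply: ltW; move: gn.
  rewrite -EFinM lee_fin (_ : 2 * B * _ = eps / 4)//.
  by field; rewrite gt_eqF.
have -> : (v \- psi)%R = ((v \- u) \+ (u \- psi))%R.
  by apply/funext => t /=; ring.
apply: (le_trans (sqint_young ltr01 _ _)).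
- exact: measurable_funB.
- exact: measurable_funB.
have -> : 1 + 1^-1 = 2 :> R by rewrite invr1; ring.
apply: (@le_trans _ _ (2%:E * (eps / 4)%:E + 2%:E * (eps / 4)%:E)%E).
  by apply: leeD; rewrite lee_wpmul2l// ?lee_fin// ltW.
by rewrite -!EFinM -EFinD lee_fin le_eqVlt; apply/orP; left; apply/eqP; field.
Qed.

End density.

(** * From Bessel's inequality to equality *)

Section plancherel.
Context {R : realType}.
Local Notation mu := (@lebesgue_measure R).

(** The variant of [le_of_young] for two quantities that are compared through an approximant [X],
    which may depend on [eta] and [e]. Composing the two bounds gives [(1 + eta)^2 B] plus a
    multiple of [e]. *)
Lemma le_of_young2 (A B : R) : 0 <= B ->
  (forall eta e : R, 0 < eta -> 0 < e -> exists X,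
     A <= (1 + eta) * X + (1 + eta^-1) * e /\
     X <= (1 + eta) * B + (1 + eta^-1) * e) -> A <= B.
Proof.
move=> B0 H.
have H2 eta : 0 < eta -> A <= (1 + eta) ^+ 2 * B.
  move=> eta0; apply/ler_addgt0Pr => e e0.
  set q := (1 + eta) * (1 + eta^-1) + (1 + eta^-1).
  have i0 : 0 < eta^-1 by rewrite invr_gt0.
  have q0 : 0 < q by rewrite /q addr_gt0// ?mulr_gt0// addr_gt0.
  have [X [AX XB]] := H eta (e / q) eta0 (divr_gt0 e0 q0).
  apply: (le_trans AX).
  apply: (@le_trans _ _ ((1 + eta) * ((1 + eta) * B + (1 + eta^-1) * (e / q)) +
    (1 + eta^-1) * (e / q))).
    by rewrite lerD2r ler_wpM2l// addr_ge0// ltW.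
  rewrite [leLHS](_ : _ = (1 + eta) ^+ 2 * B + q * (e / q)); last by rewrite /q; ring.
  by rewrite mulrCA mulfV ?gt_eqF// mulr1.
apply/ler_addgt0Pr => e e0.
have p0 : 0 < 3 * B + e by rewrite ltr_wpDl// mulr_ge0.
(* This [eta] is at most 1, so [(1 + eta)^2 <= 1 + 3 eta], and it satisfies [3 eta B <= e]. *)
pose eta := e / (3 * B + e).
have eta0 : 0 < eta by rewrite divr_gt0.
have eta1 : eta <= 1 by rewrite ler_pdivrMr// mul1r lerDr mulr_ge0.
have h : eta * (3 * B) <= e.
  rewrite /eta mulrAC ler_pdivrMr// ler_wpM2l ?ltW//.
  by rewrite ltrDl.
have := H2 eta eta0; nra.
Qed.

Lemma energy_ge0 (v : R -> R) : (0 <= energy v)%E.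
Proof. by apply: integral_ge0 => t _; rewrite lee_fin addr_ge0 ?sqr_ge0. Qed.

Lemma cosTD (a b : R -> R) om : mu.-integrable setT (EFin \o a) ->
  mu.-integrable setT (EFin \o b) -> cosT (a \+ b) om = cosT a om + cosT b om.
Proof.
move=> ia ib; rewrite /cosT -RintegralD//; try exact: integrable_mul_cos.
by apply: eq_Rintegral => t _ /=; rewrite mulrDl.
Qed.

Lemma sinTD (a b : R -> R) om : mu.-integrable setT (EFin \o a) ->
  mu.-integrable setT (EFin \o b) -> sinT (a \+ b) om = sinT a om + sinT b om.
Proof.
move=> ia ib; rewrite /sinT -RintegralD//; try exact: integrable_mul_sin.
by apply: eq_Rintegral => t _ /=; rewrite mulrDl.
Qed.

Lemma energy_young (a b : R -> R) (eta : R) : 0 < eta ->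
  mu.-integrable setT (EFin \o a) -> mu.-integrable setT (EFin \o b) ->
  (energy (a \+ b)%R <= (1 + eta)%:E * energy a + (1 + eta^-1)%:E * energy b)%E.
Proof.
move=> e0 ia ib.
have e1 : 0 <= 1 + eta by rewrite addr_ge0// ltW.
have e2 : 0 <= 1 + eta^-1 by rewrite addr_ge0// invr_ge0 ltW.
have ma := measurable_energy_density ia; have mb := measurable_energy_density ib.
have iab : mu.-integrable setT (EFin \o (a \+ b)).
  by have := integrableD measurableT ia ib; congr (integrable _ _ _).
have p c t : 0 <= cosT c t ^+ 2 + sinT c t ^+ 2 :> R by rewrite addr_ge0 ?sqr_ge0.
rewrite /energy -!ge0_integralZl_real//; try by move=> t _; exact: p.
rewrite -ge0_integralD_real//; try (by move=> t _; rewrite mulr_ge0);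
  try exact: measurable_funM.
apply: ge0_le_integral => //.
- by move=> t _; rewrite lee_fin.
- by apply/measurable_EFinP; exact: measurable_energy_density.
- by apply/measurable_EFinP; apply: measurable_funD; exact: measurable_funM.
- move=> t _; rewrite lee_fin cosTD// sinTD// !mulrDr addrACA.
  by apply: lerD; exact: sqrD_young.
Qed.

(** Bessel's inequality serves twice: it is one half of the equality, and in the other half it
    bounds the energy of the error [psi - v]. The intermediate quantity for [le_of_young2] is [2 pi]
    times the squared norm of [psi]. *)
Theorem plancherel_compact_support (v : R -> R) (N : R) :
  measurable_fun setT v -> (sqint v < +oo)%E ->
  (forall t, t \notin `]- N, N[ -> v t = 0) ->
  mu.-integrable setT (EFin \o v) /\ energy v = ((2 * pi)%:E * sqint v)%E.
Proof.
move=> mv voo vN.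
have pi0 : 0 < 2 * pi :> R by rewrite mulr_gt0// pi_gt0.
have iv : mu.-integrable setT (EFin \o v).
  pose E : set R := [set` `]- N, N[].
  have mE : measurable E by exact: measurable_itv.
  have Eoo : (mu E < +oo)%E.
    by rewrite /E lebesgue_measure_itv/=; case: ifP => // _; rewrite -EFinB ltry.
  have -> : EFin \o v = (EFin \o v) \_ E.
    apply/funext => t; rewrite patchE; case: ifPn => // tE; rewrite /= vN//.
    by apply: contra tE => tE; rewrite inE.
  apply/(integrable_mkcond _ _).1 => //.
  apply: sq_integrable_integrable => //; first exact: measurable_funTS.
  apply: le_lt_trans voo; apply: ge0_subset_integral => //.
    exact: measurable_sqr.
  by move=> t _; rewrite lee_fin sqr_ge0.
split=> //; have B := energy_bessel iv.
have vfin : sqint v \is a fin_num by rewrite ge0_fin_numE// sqint_ge0.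
have efin : energy v \is a fin_num.
  rewrite ge0_fin_numE ?energy_ge0// (le_lt_trans B)// lte_mul_pinfty// lee_fin ltW//.
apply/eqP; rewrite eq_le B/=.
rewrite -(fineK vfin) -(fineK efin) -EFinM lee_fin.
apply: le_of_young2; first by rewrite fine_ge0// energy_ge0.
move=> eta e eta0 e0.
(* With this tolerance both [2 pi ||v - psi||^2] and, by Bessel, the energy of [psi - v] are at most
   [e]. *)
have ee : 0 < e / (2 * pi) by rewrite divr_gt0.
have [psi [M [ipsi psiM cpsi vpsi]]] := dense_continuous ee mv voo vN.
have mpsi : measurable_fun setT psi.
  by apply/measurable_EFinP; exact: (measurable_int mu ipsi).
have e1 : 0 <= 1 + eta by rewrite addr_ge0// ltW.
have e2 : 0 <= 1 + eta^-1 by rewrite addr_ge0// invr_ge0 ltW.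
have vpsi' : (sqint (psi \- v)%R <= (e / (2 * pi))%:E)%E.
  by rewrite -sqintN (_ : (\- _) = (v \- psi)%R)//; apply/funext => t /=; rewrite opprB.
have D : (sqint psi <= (1 + 1)%:E * sqint v + (1 + 1^-1)%:E * sqint (psi \- v)%R)%E.
  rewrite {1}(_ : psi = v \+ (psi \- v)); last by apply/funext => t /=; ring.
  by apply: sqint_young => //; exact: measurable_funB.
have pfin : sqint psi \is a fin_num.
  rewrite ge0_fin_numE ?sqint_ge0// (le_lt_trans D)// lte_add_pinfty// lte_mul_pinfty//.
  by rewrite (le_lt_trans vpsi')// ltry.
exists (2 * pi * fine (sqint psi)); split.
  have := @sqint_young _ psi (v \- psi) eta eta0 mpsi (measurable_funB mv mpsi).
  rewrite (_ : psi \+ (v \- psi) = v); last by apply/funext => t /=; ring.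
  move=> H; have : (sqint v <= (1 + eta)%:E * sqint psi + (1 + eta^-1)%:E * (e / (2 * pi))%:E)%E.
    by apply: (le_trans H); rewrite leeD2l// lee_wpmul2l.
  rewrite -(fineK vfin) -(fineK pfin) -!EFinM -EFinD lee_fin => {}H.
  have := ler_wpM2l (ltW pi0) H; move/le_trans; apply.
  have E : 2 * pi * (e / (2 * pi)) = e :> R by rewrite mulrCA mulfV ?gt_eqF// mulr1.
  rewrite [leLHS](_ : _ = (1 + eta) * (2 * pi * fine (sqint psi)) +
    (1 + eta^-1) * (2 * pi * (e / (2 * pi)))); last by ring.
  by rewrite E.
have := energy_ge ipsi psiM cpsi.
have ipv : mu.-integrable setT (EFin \o (psi \- v)).
  by have := integrableB measurableT ipsi iv; congr (integrable _ _ _).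
have H := energy_young eta0 iv ipv.
rewrite (_ : v \+ (psi \- v) = psi) in H; last by apply/funext => t /=; ring.
move=> H2; have := le_trans H2 H => {H H2} H.
have B2 : (energy (psi \- v)%R <= e%:E)%E.
  apply: (le_trans (energy_bessel ipv)).
  apply: (@le_trans _ _ ((2 * pi)%:E * (e / (2 * pi))%:E)%E).
    by rewrite lee_wpmul2l// lee_fin ltW.
  by rewrite -EFinM mulrCA mulfV ?gt_eqF// mulr1.
have {H} : ((2 * pi)%:E * sqint psi <= (1 + eta)%:E * energy v + (1 + eta^-1)%:E * e%:E)%E.
  by apply: (le_trans H); rewrite leeD2l// lee_wpmul2l.
by rewrite -(fineK pfin) -(fineK efin) -!EFinM -EFinD lee_fin.
Qed.

End plancherel.

(** * The Fourier transform on L2 *)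

Section riesz_fischer.
Context {R : realType}.
Local Notation mu := (@lebesgue_measure R).

(* A subsequence with squared increments [<= 4^-k / 2] has
   [sum_k 2^k |d_k|^2] integrable, hence converges almost everywhere. *)
Lemma riesz_fischer (F : nat -> R -> R) : (forall n, measurable_fun setT (F n)) ->
  (forall e : R, 0 < e -> exists N, forall m n, (N <= m)%N -> (N <= n)%N ->
     (sqint (F m \- F n)%R <= e%:E)%E) ->
  exists2 G : R -> R, measurable_fun setT G &
    sqint (G \- F n)%R @[n --> \oo] --> 0%E.
Proof.
move=> mF FC.
(* The first factor cancels the weight [2^k] in [q k]; the second factors sum to 1. *)
pose e k : R := (2 ^ k)%:R^-1 * (1 / (2 ^ (k + 0.+1))%:R).
have p2 k : 0 < (2 ^ k)%:R :> R by rewrite ltr0n expn_gt0.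
have e0 k : 0 < e k by rewrite mulr_gt0// ?divr_gt0// invr_gt0.
have /choice[N HN] : forall k, exists N, forall m n, (N <= m)%N -> (N <= n)%N ->
  (sqint (F m \- F n)%R <= (e k)%:E)%E by move=> k; exact: FC.
(* Summing the successors makes [s] nondecreasing with both [N k <= s k] and [k <= s k]. *)
pose s k := (\sum_(i < k.+1) (N i).+1)%N.
have sN k : (N k <= s k)%N by rewrite /s big_ord_recr/= addnS -addSn leq_addl.
have sS k : (s k <= s k.+1)%N by rewrite /s [leqRHS]big_ord_recr/= leq_addr.
have sid k : (k <= s k)%N.
  elim: k => // k ih; rewrite /s big_ord_recr/= addnS ltnS.
  exact: leq_trans ih (leq_addr _ _).
pose d k t := F (s k.+1) t - F (s k) t.
have md k : measurable_fun setT (d k) by exact: measurable_funB.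
have dk k : (\int[mu]_t (d k t ^+ 2)%:E <= (e k)%:E)%E.
  by apply: HN; [exact: leq_trans (sN k) (sS k)|exact: sN].
pose q k t := ((2 ^ k)%:R * d k t ^+ 2)%:E : \bar R.
have q0 k t : (0 <= q k t)%E by rewrite lee_fin mulr_ge0 ?sqr_ge0// ltW.
have mq k : measurable_fun setT (q k).
  by apply/measurable_EFinP; apply: measurable_funM => //; exact: measurable_funX.
pose S t := (\sum_(k <oo) q k t)%E.
have S0 t : (0 <= S t)%E by apply: nneseries_ge0.
have mS : measurable_fun setT S by exact: ge0_emeasurable_sum.
have iS : (\int[mu]_t S t <= 1)%E.
  rewrite integral_nneseries//.
  apply: (@le_trans _ _ (\sum_(k <oo) (1 / (2 ^ (k + 0.+1))%:R)%:E)%E); last first.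
    have := @cvg_geometric_eseries_half R 1 0; rewrite expr0 divr1.
    by move/cvg_lim => ->.
  apply: lee_nneseries => [k _ _|k _]; first exact: integral_ge0.
  have md2 : measurable_fun setT (fun t => d k t ^+ 2) by exact: measurable_funX.
  rewrite (ge0_integralZl_real measurableT md2 (fun t _ => sqr_ge0 _) (ltW (p2 k))).
  apply: (@le_trans _ _ ((2 ^ k)%:R%:E * (e k)%:E)%E).
    by rewrite lee_wpmul2l// lee_fin ltW.
  by rewrite -EFinM /e mulVKf// gt_eqF.
have aS : {ae mu, forall t, setT t -> S t \is a fin_num}.
  apply: (@integrable_ae _ _ R mu setT measurableT S).
  apply/integrableP; split => //.
  under eq_integral do rewrite gee0_abs//.
  by rewrite (le_lt_trans iS)// ltry.
(* Off the set [A] the subsequence will be replaced by 0, so that it converges at every point and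
   its limit is measurable. *)
pose A := [set t | (S t < +oo)%E].
have mA : measurable A.
  by have := emeasurable_fun_infty_o measurableT mS +oo%E; rewrite setTI.
have cA t : A t -> cvgn (fun k => F (s k) t).
  move=> At.
  have c1 : cvgn (series (fun k => (2 ^ k)%:R * d k t ^+ 2)).
    apply: nondecreasing_is_cvgn.
      apply/nondecreasing_seqP => n; rewrite /series/= big_nat_recr//= lerDl.
      by rewrite mulr_ge0 ?sqr_ge0// ltW.
    exists (fine (S t)) => _ [n _ <-].
    rewrite -lee_fin fineK ?ge0_fin_numE// /series/= -sumEFin.
    exact: (@nneseries_lim_ge R (fun k => q k t) xpredT 0%N n (fun i _ _ => q0 i t)).
  have c2 : cvgn (series (geometric 1 (2^-1 : R))).
    by apply: is_cvg_geometric_series; rewrite ger0_norm//; lra.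
  have c3 : cvgn (series (d ^~ t)).
    apply: normed_cvg.
    (* By AM-GM, [|d_k| <= 2^k d_k^2 + 2^-k], and both series on the right converge on [A]. *)
    apply: (@series_le_cvg _ _ (fun k => (2 ^ k)%:R * d k t ^+ 2 + geometric 1 2^-1 k)) => //.
    - by move=> k /=.
    - move=> k /=; apply: addr_ge0; first by rewrite mulr_ge0 ?sqr_ge0// ltW.
      by rewrite mul1r exprn_ge0// invr_ge0.
    - move=> k; rewrite /= mul1r exprVn -natrX -(real_normK (num_real (d k t))).
      have := p2 k; move: (2 ^ k)%:R `|d k t| (normr_ge0 (d k t)) => x y y0 x0.
      rewrite -subr_ge0.
      have -> : x * y ^+ 2 + x^-1 - y = x * (y - x^-1 / 2) ^+ 2 + x^-1 * 3 / 4.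
        by field; rewrite gt_eqF.
      apply: addr_ge0; first by rewrite mulr_ge0 ?sqr_ge0// ltW.
      by rewrite !mulr_ge0// invr_ge0 ltW.
    - rewrite (_ : series _ = series (fun k => (2 ^ k)%:R * d k t ^+ 2) \+ series (geometric 1 2^-1)).
        exact: is_cvgD.
      by apply/funext => n; rewrite /series/= big_split.
  have c4 : cvgn (fun n => F (s 0%N) t + series (d ^~ t) n).
    by apply: is_cvgD => //; exact: is_cvg_cst.
  rewrite (_ : (fun k => F (s k) t) = (fun n => F (s 0%N) t + series (d ^~ t) n))//.
  apply/funext => n; rewrite /series/= /d (telescope_sumr (fun k => F (s k) t))//.
  by rewrite addrC subrK.
pose H k := F (s k) \_ A.
have mH k : measurable_fun setT (H k).
  by apply/(measurable_restrictT _ _).1 => //; exact: measurable_funTS.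
have cH t : cvgn (fun k => H k t).
  rewrite /H; have [tA|tA] := boolP (t \in A).
    by under eq_fun do rewrite patchE tA; apply: cA; rewrite -inE.
  by under eq_fun do rewrite patchE (negbTE tA); exact: is_cvg_cst.
pose G t := limn (fun k => H k t).
have mG : measurable_fun setT G.
  by apply: (@measurable_fun_cvg _ _ R setT H G) => // t _; exact: cH.
exists G => //.
apply/ge0_cvge0P => [n|eps eps0]; first exact: sqint_ge0.
have eps2 : 0 < eps / 2 by rewrite divr_gt0.
have [M HM] := FC _ eps2.
exists M => // n /= Mn.
apply: (@le_lt_trans _ _ (eps / 2)%:E); last by rewrite lte_fin; lra.
pose f k t := ((F (s k) t - F n t) ^+ 2)%:E.
have mf k : measurable_fun setT (f k).
  by apply: measurable_sqr; exact: measurable_funB.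
have f0 k t : (0 <= f k t)%E by rewrite lee_fin sqr_ge0.
(* Fatou's lemma carries the Cauchy bound for [F (s k) - F n] over to the limit [G - F n]. *)
have Fat := @fatou _ _ R mu setT measurableT f mf (fun k t _ => f0 k t).
apply: (@le_trans _ _ (\int[mu]_t limn_einf (f ^~ t))%E).
  apply: ae_ge0_le_integral => //.
  - by move=> t _; rewrite lee_fin sqr_ge0.
  - by apply: measurable_sqr; exact: measurable_funB.
  - by move=> t _; rewrite limn_einf_lim; apply: lime_ge;
      [exact: is_cvg_einfs|apply: nearW => k; apply: le_ereal_inf_tmp => _ [i /= _ <-]].
  - rewrite (_ : (fun t => limn_einf (f ^~ t)) = (fun t => - limn_esup (fun k => - f k t))%E).
      apply: measurableT_comp => //; apply: measurable_fun_limn_esup => k.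
      exact: (measurableT_comp (@oppe_measurable R setT) (mf k)).
    by apply/funext => t; rewrite -limn_einfN; congr limn_einf; apply/funext => k; rewrite /f /= opprK.
  - case: aS => Z [mZ Z0 sZ]; exists Z; split => // t nt; apply: sZ => h; apply: nt => _.
    have {h} St := h I.
    have At : A t by rewrite /A/= -ge0_fin_numE.
    suff c : f k t @[k --> \oo] --> ((G t - F n t) ^+ 2)%:E.
      by rewrite (cvg_limn_einf_sup c).1.
    apply: cvg_EFin; first exact: nearW.
    apply: (@cvg_comp _ _ _ (fun k => F (s k) t - F n t) (fun x => x ^+ 2) _ (nbhs (G t - F n t)));
      last exact: exprn_continuous.
    apply: cvgB; last exact: cvg_cst.
    have HF : (fun k => H k t) = (fun k => F (s k) t).
      by apply/funext => k; rewrite /H patchE mem_set.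
    by rewrite /G HF; exact: cA.
apply: (le_trans Fat).
rewrite limn_einf_lim; apply: lime_le; first exact: is_cvg_einfs.
exists 0%N => // k _.
(* The infimum over a tail is at most its term of index [k + M], and [s (k + M) >= M] puts that term
   in the Cauchy range. *)
apply: (@le_trans _ _ (\int[mu]_t f (k + M)%N t)%E).
  by apply: ereal_inf_lbound; exists (k + M)%N => //=; exact: leq_addr.
apply: HM => //; exact: leq_trans (leq_addl k M) (sid _).
Qed.

End riesz_fischer.

(** * Existence and isometry of the L2 transform *)

Section fourier_L2.
Context {R : realType}.
Local Notation mu := (@lebesgue_measure R).

Lemma cabs_sqr (z : R[i]) : cabs z ^+ 2 = complex.Re z ^+ 2 + complex.Im z ^+ 2.
Proof. by rewrite /cabs sqr_sqrtr// addr_ge0 ?sqr_ge0. Qed.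

Lemma ReB (z w : R[i]) : complex.Re (z - w) = complex.Re z - complex.Re w.
Proof. by case: z w => [a b] [c d]. Qed.

Lemma ImB (z w : R[i]) : complex.Im (z - w) = complex.Im z - complex.Im w.
Proof. by case: z w => [a b] [c d]. Qed.

Lemma ReD (z w : R[i]) : complex.Re (z + w) = complex.Re z + complex.Re w.
Proof. by case: z w => [a b] [c d]. Qed.

Lemma ImD (z w : R[i]) : complex.Im (z + w) = complex.Im z + complex.Im w.
Proof. by case: z w => [a b] [c d]. Qed.

Definition cmeasurable (F : R -> R[i]) :=
  measurable_fun setT (fun om => complex.Re (F om)) /\
  measurable_fun setT (fun om => complex.Im (F om)).

Lemma cmeasurableB (F G : R -> R[i]) : cmeasurable F -> cmeasurable G ->
  cmeasurable (fun om => F om - G om).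
Proof.
move=> [F1 F2] [G1 G2]; split.
  by under eq_fun do rewrite ReB; exact: measurable_funB.
by under eq_fun do rewrite ImB; exact: measurable_funB.
Qed.

Definition csqint (F : R -> R[i]) : \bar R := sqint (fun om => cabs (F om)).

Lemma csqint_ge0 F : (0 <= csqint F)%E.
Proof. exact: sqint_ge0. Qed.

Lemma csqintE (F : R -> R[i]) : cmeasurable F ->
  csqint F = (sqint (fun om => complex.Re (F om)) +
              sqint (fun om => complex.Im (F om)))%E.
Proof.
move=> [F1 F2]; rewrite /csqint /sqint -ge0_integralD_real//.
- by apply: eq_integral => t _; rewrite cabs_sqr.
- exact: measurable_funX.
- exact: measurable_funX.
- by move=> t _; exact: sqr_ge0.
- by move=> t _; exact: sqr_ge0.
Qed.

Lemma csqint_young (F G : R -> R[i]) (eta : R) : 0 < eta ->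
  cmeasurable F -> cmeasurable G ->
  (csqint (fun om => F om + G om)%R <=
   (1 + eta)%:E * csqint F + (1 + eta^-1)%:E * csqint G)%E.
Proof.
move=> e0 [F1 F2] [G1 G2].
have e1 : 0 <= 1 + eta by rewrite addr_ge0// ltW.
have e2 : 0 <= 1 + eta^-1 by rewrite addr_ge0// invr_ge0 ltW.
rewrite !csqintE//; last first.
  split.
    by under eq_fun do rewrite ReD; exact: measurable_funD.
  by under eq_fun do rewrite ImD; exact: measurable_funD.
have dl (c : R) (a b : R -> R) :
    (c%:E * (sqint a + sqint b) = c%:E * sqint a + c%:E * sqint b)%E.
  by rewrite ge0_muleDr ?sqint_ge0.
rewrite !dl [leRHS]addeACA; apply: leeD.
  rewrite [X in (sqint X <= _)%E](_ : _ =
    (fun om => complex.Re (F om)) \+ (fun om => complex.Re (G om))).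
    exact: sqint_young.
  by apply/funext => om; rewrite ReD.
rewrite [X in (sqint X <= _)%E](_ : _ =
    (fun om => complex.Im (F om)) \+ (fun om => complex.Im (G om))).
  exact: sqint_young.
by apply/funext => om; rewrite ImD.
Qed.

Lemma csqintC (F G : R -> R[i]) :
  csqint (fun om => F om - G om) = csqint (fun om => G om - F om).
Proof.
by apply: eq_integral => t _; rewrite !cabs_sqr !ReB !ImB; congr EFin; ring.
Qed.

Let c0 : R := (Num.sqrt (2 * pi))^-1.

Definition ftL1 (a : R -> R) (om : R) : R[i] :=
  (c0 * cosT a om) -i* (c0 * sinT a om).

Lemma cmeasurable_ftL1 a : mu.-integrable setT (EFin \o a) -> cmeasurable (ftL1 a).
Proof.
move=> ia; split=> /=.
  by apply: measurable_funM => //; exact: measurable_cosT.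
apply: measurable_funN.
by apply: measurable_funM => //; exact: measurable_sinT.
Qed.

Lemma ftL1B (a b : R -> R) : mu.-integrable setT (EFin \o a) ->
  mu.-integrable setT (EFin \o b) ->
  ftL1 (a \- b) = (fun om => ftL1 a om - ftL1 b om).
Proof.
move=> ia ib; apply/funext => om.
have iab : mu.-integrable setT (EFin \o (a \- b)).
  by have := integrableB measurableT ia ib; congr (integrable _ _ _).
have abE : a = (a \- b) \+ b by apply/funext => t /=; ring.
have hc : cosT a om = cosT (a \- b) om + cosT b om by rewrite -cosTD// -abE.
have hs : sinT a om = sinT (a \- b) om + sinT b om by rewrite -sinTD// -abE.
rewrite /ftL1 hc hs.
apply/eqP; rewrite eq_complex /=; apply/andP; split; apply/eqP; ring.
Qed.

Lemma csqint_ftL1 (a : R -> R) (N : R) :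
  measurable_fun setT a -> (sqint a < +oo)%E ->
  (forall t, t \notin `]- N, N[ -> a t = 0) ->
  csqint (ftL1 a) = sqint a.
Proof.
move=> ma aoo aN; have [ia E] := plancherel_compact_support ma aoo aN.
have pi0 : 0 < 2 * pi :> R by rewrite mulr_gt0// pi_gt0.
have c02 : c0 ^+ 2 = (2 * pi)^-1 by rewrite /c0 exprVn sqr_sqrtr// ltW.
transitivity ((c0 ^+ 2)%:E * energy a)%E.
  rewrite /energy -ge0_integralZl_real ?sqr_ge0//.
  - by apply: eq_integral => t _; rewrite cabs_sqr/= sqrrN !exprMn -mulrDr.
  - exact: measurable_energy_density.
  - by move=> t _; rewrite addr_ge0 ?sqr_ge0.
by rewrite E muleA -EFinM c02 mulVf ?mul1e// gt_eqF.
Qed.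

Definition cut (v : R -> R) (n : nat) : R -> R := v \_ `[- n%:R, n%:R].

(** The cut keeps the end points [n] and [- n], while Plancherel's theorem above asks for an open
    interval, hence the enlargement by 1. *)
Lemma cut_support v n t : t \notin `]- n.+1%:R, n.+1%:R[ -> cut v n t = 0.
Proof.
move=> tn; rewrite /cut patchE; case: ifPn => //; rewrite inE/= in_itv/= => /andP[h1 h2].
case/negP: tn; rewrite in_itv/= (lt_le_trans _ h1) ?ltrN2 ?ltr_nat//=.
by rewrite (le_lt_trans h2)// ltr_nat.
Qed.

Lemma measurable_cut v n : measurable_fun setT v -> measurable_fun setT (cut v n).
Proof.
move=> mv; apply/(measurable_restrictT _ _).1; first exact: measurable_itv.
exact: measurable_funTS.
Qed.

Lemma sqint_cut_le v n : measurable_fun setT v -> (sqint (cut v n) <= sqint v)%E.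
Proof.
move=> mv; apply: ge0_le_integral => //.
- by move=> t _; rewrite lee_fin sqr_ge0.
- by apply: measurable_sqr; exact: measurable_cut.
- exact: measurable_sqr.
- move=> t _; rewrite lee_fin /cut patchE; case: ifP => // _.
  by rewrite expr0n sqr_ge0.
Qed.

Lemma integrable_cut v n : measurable_fun setT v -> (sqint v < +oo)%E ->
  mu.-integrable setT (EFin \o cut v n).
Proof.
move=> mv voo.
by have [] := plancherel_compact_support (measurable_cut n mv)
  (le_lt_trans (sqint_cut_le n mv) voo) (@cut_support v n).
Qed.

Lemma cvg_cut v : measurable_fun setT v -> (sqint v < +oo)%E ->
  sqint (v \- cut v n)%R @[n --> \oo] --> 0%E.
Proof.
move=> mv voo.
pose f n t := ((v t - cut v n t) ^+ 2)%:E.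
have mf n : measurable_fun setT (f n).
  by apply: measurable_sqr; apply: measurable_funB => //; exact: measurable_cut.
have cf : {ae mu, forall t, setT t -> f n t @[n --> \oo] --> (0 : R)%:E}.
  apply/aeW => t _; apply: (@cvg_near_cst _ _ _ _ _ _ _); near=> n.
  rewrite /f /cut patchE ifT ?subrr ?expr0n//.
  rewrite inE/= in_itv/= -ler_norml.
  by near: n; exact: nbhs_infty_ger.
have ig : mu.-integrable setT (fun t => (v t ^+ 2)%:E).
  apply/integrableP; split; first exact: measurable_sqr.
  apply: le_lt_trans voo; rewrite le_eqVlt; apply/orP; left; apply/eqP.
  by apply: eq_integral => t _; rewrite gee0_abs// lee_fin sqr_ge0.
have df : {ae mu, forall t n, setT t -> (`|f n t| <= (v t ^+ 2)%:E)%E}.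
  apply/aeW => t n _; rewrite /f /cut patchE gee0_abs ?lee_fin ?sqr_ge0//.
  by case: ifP => _; rewrite ?subr0// subrr expr0n sqr_ge0.
have [_ _ H] := @dominated_convergence _ _ R mu setT measurableT f _ _ mf
  (measurable_cst _) cf ig df.
by move: H; rewrite /= integral0.
Unshelve. all: by end_near. Qed.

Lemma fourier_truncE v n : measurable_fun setT v -> (sqint v < +oo)%E ->
  fourier_trunc v n = ftL1 (cut v n).
Proof.
move=> mv voo; have ic := integrable_cut n mv voo.
apply/funext => om; rewrite /fourier_trunc /ftL1 /cintegral.
have -> : \int[mu]_(t in `[- n%:R, n%:R]) complex.Re ((v t)%:C * cexp (0 -i* (om * t))) =
    cosT (cut v n) om.
  rewrite /cosT Rintegral_mkcond; apply: eq_Rintegral => t _.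
  rewrite /cut !patchE; case: ifP => _; last by rewrite mul0r.
  by rewrite /cexp/= expR0 mul1r mul0r subr0 cosN.
have -> : \int[mu]_(t in `[- n%:R, n%:R]) complex.Im ((v t)%:C * cexp (0 -i* (om * t))) =
    - sinT (cut v n) om.
  rewrite -[RHS]mulN1r /sinT -RintegralZl//; last exact: integrable_mul_sin.
  rewrite Rintegral_mkcond; apply: eq_Rintegral => t _.
  rewrite /cut !patchE; case: ifP => _; last by rewrite mul0r mulr0.
  rewrite /cexp/= expR0 mul1r mul0r addr0 sinN; ring.
apply/eqP; rewrite eq_complex /= -/c0; apply/andP; split; apply/eqP; ring.
Qed.

Lemma csqint_trunc v n : measurable_fun setT v -> (sqint v < +oo)%E ->
  csqint (fourier_trunc v n) = sqint (cut v n).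
Proof.
move=> mv voo; rewrite fourier_truncE//; apply: (csqint_ftL1 (N := n.+1%:R)).
- exact: measurable_cut.
- exact: le_lt_trans (sqint_cut_le n mv) voo.
- exact: cut_support.
Qed.

Lemma cmeasurable_trunc v n : measurable_fun setT v -> (sqint v < +oo)%E ->
  cmeasurable (fourier_trunc v n).
Proof.
by move=> mv voo; rewrite fourier_truncE//; apply: cmeasurable_ftL1; exact: integrable_cut.
Qed.

Lemma sqintB_le2 (a b : R -> R) : measurable_fun setT a -> measurable_fun setT b ->
  (sqint (a \- b)%R <= 2%:E * sqint a + 2%:E * sqint b)%E.
Proof.
move=> ma mb; have mNb : measurable_fun setT (\- b) by exact: measurable_funN.
have := sqint_young ltr01 ma mNb; rewrite sqintN invr1.
by rewrite (_ : 1 + 1 = 2 :> R); last by ring.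
Qed.

Lemma csqint_trunc_cauchy v m n : measurable_fun setT v -> (sqint v < +oo)%E ->
  (csqint (fun om => fourier_trunc v m om - fourier_trunc v n om)%R <=
   2%:E * sqint (v \- cut v m)%R + 2%:E * sqint (v \- cut v n)%R)%E.
Proof.
move=> mv voo; rewrite !fourier_truncE// -ftL1B; try exact: integrable_cut.
have mm := measurable_cut m mv; have mn := measurable_cut n mv.
rewrite (@csqint_ftL1 _ (maxn m n).+1%:R); last 3 first.
- exact: measurable_funB.
- apply: (le_lt_trans (sqintB_le2 mm mn)).
  rewrite lte_add_pinfty// lte_mul_pinfty//.
    exact: le_lt_trans (sqint_cut_le m mv) voo.
  exact: le_lt_trans (sqint_cut_le n mv) voo.
- move=> t tn /=; have H k : (k <= maxn m n)%N -> cut v k t = 0.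
    move=> km; apply: cut_support; apply: contra tn; rewrite !in_itv/= => /andP[h1 h2].
    have kk : k.+1%:R <= (maxn m n).+1%:R :> R by rewrite ler_nat ltnS.
    by rewrite (le_lt_trans _ h1) ?lerN2//= (lt_le_trans h2).
  by rewrite !H ?subrr ?leq_maxl ?leq_maxr.
rewrite -sqintN.
have -> : \- (cut v m \- cut v n) = (v \- cut v m) \- (v \- cut v n).
  by apply/funext => t /=; ring.
by apply: sqintB_le2; exact: measurable_funB.
Qed.

(** Riesz-Fischer is applied to the real and imaginary parts of the truncated transforms. [FC]
    treats both at once, since it asks only that [p] respect subtraction and be bounded by
    [cabs]. *)
Lemma fourier_exists v : v \in @L2 R -> exists F, is_fourier v F.
Proof.
move=> /L2P[mv voo].
have cc : forall e : R, 0 < e -> \forall n \near \oo, (sqint (v \- cut v n)%R < e%:E)%E.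
  exact: ((ge0_cvge0P (fun n => sqint_ge0 _)).1 (cvg_cut mv voo)).
have mF n := cmeasurable_trunc n mv voo.
have FC (p : R[i] -> R) : (forall z w, p (z - w) = p z - p w) ->
    (forall z, p z ^+ 2 <= cabs z ^+ 2) ->
    (forall n, measurable_fun setT (fun om => p (fourier_trunc v n om))) ->
    exists2 G : R -> R, measurable_fun setT G &
      sqint (G \- (fun om => p (fourier_trunc v n om)))%R @[n --> \oo] --> 0%E.
  move=> pB pz mp; apply: riesz_fischer => // e e0.
  have e4 : 0 < e / 4 by rewrite divr_gt0.
  have [N _ HN] := cc _ e4; exists N => m n Nm Nn.
  apply: (@le_trans _ _ (csqint (fun om => fourier_trunc v m om - fourier_trunc v n om)%R)).
    apply: ge0_le_integral => //.
    - by move=> t _; rewrite lee_fin sqr_ge0.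
    - by apply: measurable_sqr; exact: measurable_funB.
    - have [H1 H2] := cmeasurableB (mF m) (mF n).
      apply: (eq_measurable_fun (fun om =>
         (complex.Re (fourier_trunc v m om - fourier_trunc v n om) ^+ 2 +
          complex.Im (fourier_trunc v m om - fourier_trunc v n om) ^+ 2)%:E)).
        by move=> om _; rewrite cabs_sqr.
      by apply/measurable_EFinP; apply: measurable_funD; exact: measurable_funX.
    - by move=> om _; rewrite lee_fin /= -pB.
  apply: (le_trans (csqint_trunc_cauchy m n mv voo)).
  apply: (@le_trans _ _ (2%:E * (e / 4)%:E + 2%:E * (e / 4)%:E)%E).
    by apply: leeD; rewrite lee_wpmul2l// ltW//; exact: HN.
  by rewrite -!EFinM -EFinD lee_fin le_eqVlt; apply/orP; left; apply/eqP; field.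
have [G1 mG1 cG1] := FC (@complex.Re R) ReB
  (fun z => ltac:(by rewrite cabs_sqr lerDl sqr_ge0)) (fun n => (mF n).1).
have [G2 mG2 cG2] := FC (@complex.Im R) ImB
  (fun z => ltac:(by rewrite cabs_sqr lerDr sqr_ge0)) (fun n => (mF n).2).
have GL2 (G : R -> R) (f : nat -> R -> R) : measurable_fun setT G ->
    (forall n, measurable_fun setT (f n)) -> (forall n, (sqint (f n) < +oo)%E) ->
    sqint (G \- f n)%R @[n --> \oo] --> 0%E -> G \in @L2 R.
  move=> mG mf foo Gf.
  have [n _ /(_ n (leqnn n))/= H] : \forall n \near \oo, (sqint (G \- f n)%R < 1%:E)%E.
    exact: ((ge0_cvge0P (fun n => sqint_ge0 _)).1 Gf _ ltr01).
  apply/L2P; split=> //.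
  have -> : G = (G \- f n) \- (\- f n) by apply/funext => t /=; ring.
  apply: (le_lt_trans (sqintB_le2 _ _)); [exact: measurable_funB|exact: measurable_funN|].
  rewrite sqintN lte_add_pinfty// lte_mul_pinfty//.
  exact: lt_trans H (ltry _).
have toc n : (csqint (fourier_trunc v n) < +oo)%E.
  by rewrite csqint_trunc// (le_lt_trans (sqint_cut_le n mv)).
have toc12 n : (sqint (fun om => complex.Re (fourier_trunc v n om)) < +oo)%E /\
    (sqint (fun om => complex.Im (fourier_trunc v n om)) < +oo)%E.
  have := toc n; rewrite csqintE//; have := sqint_ge0 (fun om => complex.Re (fourier_trunc v n om)).
  have := sqint_ge0 (fun om => complex.Im (fourier_trunc v n om)).
  move: (sqint _) (sqint _) => x y x0 y0 xy; split.
    by apply: le_lt_trans xy; rewrite leeDl.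
  by apply: le_lt_trans xy; rewrite leeDr.
exists (fun om => G1 om +i* G2 om); split.
  split=> /=.
    exact: (GL2 G1 _ mG1 (fun n => (mF n).1) (fun n => (toc12 n).1)).
  exact: (GL2 G2 _ mG2 (fun n => (mF n).2) (fun n => (toc12 n).2)).
apply/L2norm_cvg0P.
rewrite (_ : (fun n => _) = (fun n => sqint (G1 \- (fun om => complex.Re (fourier_trunc v n om)))%R +
   sqint (G2 \- (fun om => complex.Im (fourier_trunc v n om)))%R)%E); last first.
  apply/funext => n.
  have /csqintE : cmeasurable (fun om => (G1 om +i* G2 om) - fourier_trunc v n om).
    by apply: cmeasurableB.
  rewrite /csqint => ->; congr (_ + _)%E.
by rewrite -[X in _ --> X]adde0; apply: cvgeD.
Qed.

(** [fourier] defaults to 0 when no quadratic-mean limit exists; existence rules out that case for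
    [v] in L2. *)
Lemma fourierP v : v \in @L2 R -> is_fourier v (fourier v).
Proof. by move=> /fourier_exists h; exact: (xgetPex (fun=> 0) h). Qed.

Lemma fourier_cmeasurable v : v \in @L2 R -> cmeasurable (fourier v).
Proof. by move=> /fourierP[[/L2P[h1 _] /L2P[h2 _]] _]. Qed.

Lemma fourier_cvg v : v \in @L2 R ->
  csqint (fun om => fourier v om - fourier_trunc v n om) @[n --> \oo] --> 0%E.
Proof. by move=> /fourierP[_ /L2norm_cvg0P]. Qed.

Lemma csqint_fourier_lty v : v \in @L2 R -> (csqint (fourier v) < +oo)%E.
Proof.
move=> vL; rewrite csqintE; last exact: fourier_cmeasurable.
have [[/L2P[_ h1] /L2P[_ h2]] _] := fourierP vL.
exact: lte_add_pinfty.
Qed.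

Lemma cutB (v1 v2 : R -> R) n : cut (v1 \- v2) n = cut v1 n \- cut v2 n.
Proof.
by apply/funext => t; rewrite /cut /= !patchE; case: ifP => //; rewrite subrr.
Qed.

Lemma fourier_truncB (v1 v2 : R -> R) n :
  measurable_fun setT v1 -> (sqint v1 < +oo)%E ->
  measurable_fun setT v2 -> (sqint v2 < +oo)%E ->
  fourier_trunc (v1 \- v2) n = (fun om => fourier_trunc v1 n om - fourier_trunc v2 n om).
Proof.
move=> m1 f1 m2 f2; rewrite !fourier_truncE//; last 2 first.
- exact: measurable_funB.
- by apply: (le_lt_trans (sqintB_le2 m1 m2)); rewrite lte_add_pinfty// lte_mul_pinfty.
by rewrite cutB ftL1B//; exact: integrable_cut.
Qed.

Lemma L2B (v1 v2 : R -> R) : v1 \in @L2 R -> v2 \in @L2 R -> v1 \- v2 \in @L2 R.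
Proof.
move=> /L2P[m1 f1] /L2P[m2 f2]; apply/L2P; split; first exact: measurable_funB.
by apply: (le_lt_trans (sqintB_le2 m1 m2)); rewrite lte_add_pinfty// lte_mul_pinfty.
Qed.

(** The difference of the two chosen transforms is a quadratic-mean limit of the truncated
    transforms of [v1 - v2], because truncated transforms subtract exactly. For these, the isometry
    is the compactly supported case. *)
Theorem fourier_isometry (v1 v2 : R -> R) : v1 \in @L2 R -> v2 \in @L2 R ->
  csqint (fun om => fourier v1 om - fourier v2 om) = sqint (v1 \- v2).
Proof.
move=> L1 L2; have [m1 f1] := (L2P _).1 L1; have [m2 f2] := (L2P _).1 L2.
have Lu := L2B L1 L2; have [mvu fu] := (L2P _).1 Lu; set u := v1 \- v2 in Lu mvu fu *.
pose F1 := fourier v1; pose F2 := fourier v2.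
pose D om := F1 om - F2 om; pose T n := fourier_trunc u n.
have cF1 := fourier_cmeasurable L1; have cF2 := fourier_cmeasurable L2.
have cD : cmeasurable D := cmeasurableB cF1 cF2.
have cT n : cmeasurable (T n) by exact: cmeasurable_trunc.
have ct1 n := cmeasurable_trunc n m1 f1; have ct2 n := cmeasurable_trunc n m2 f2.
have TE n : csqint (T n) = sqint (cut u n) by exact: csqint_trunc.
have B2 (a b : \bar R) (e : R) : (a < (e / 4)%:E -> b < (e / 4)%:E ->
    2%:E * a + 2%:E * b <= e%:E)%E.
  move=> ae be; apply: (@le_trans _ _ (2%:E * (e / 4)%:E + 2%:E * (e / 4)%:E)%E).
    by apply: leeD; rewrite lee_wpmul2l// ltW.
  by rewrite -!EFinM -EFinD lee_fin le_eqVlt; apply/orP; left; apply/eqP; field.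
have near_ (a : nat -> \bar R) (e : R) : (forall n, (0 <= a n)%E) ->
    a n @[n --> \oo] --> 0%E -> 0 < e -> \forall n \near \oo, (a n < e%:E)%E.
  by move=> a0 ac e0; exact: ((ge0_cvge0P a0).1 ac).
(* A single index serves both sides: [T n] is close to [D] and [cut u n] is close to [u]. *)
have app (e : R) : 0 < e -> exists n,
    (csqint (fun om => D om - T n om)%R <= e%:E)%E /\ (sqint (u \- cut u n)%R <= e%:E)%E.
  move=> e0; have e4 : 0 < e / 4 by rewrite divr_gt0.
  have n1 := near_ _ _ (fun n => csqint_ge0 _) (fourier_cvg L1) e4.
  have n2 := near_ _ _ (fun n => csqint_ge0 _) (fourier_cvg L2) e4.
  have n3 := near_ _ _ (fun n => sqint_ge0 _) (cvg_cut mvu fu) e0.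
  have [n _ /(_ n (leqnn n)) [H1 [H2 H3]]] := filterI n1 (filterI n2 n3).
  exists n; split; last exact: ltW.
  have -> : (fun om => D om - T n om) = (fun om => (F1 om - fourier_trunc v1 n om) +
      (fourier_trunc v2 n om - F2 om)).
    apply/funext => om; rewrite /T /u (fourier_truncB n m1 f1 m2 f2) /D.
    have E (a b c d : R[i]) : a - b - (c - d) = (a - c) + (d - b) by ring.
    exact: E.
  have := csqint_young ltr01 (cmeasurableB cF1 (ct1 n)) (cmeasurableB (ct2 n) cF2).
  move/le_trans; apply; rewrite invr1 (_ : 1 + 1 = 2 :> R); last by ring.
  by rewrite (csqintC (fourier_trunc v2 n) F2); exact: (B2 _ _ _ H1 H2).
have [n1 [H1 _]] := app 1 ltr01.
have tfin n : (csqint (T n) < +oo)%E.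
  by rewrite TE; exact: le_lt_trans (sqint_cut_le n mvu) fu.
have split1 n : D = (fun om => T n om + (D om - T n om)).
  by apply/funext => om; rewrite addrC subrK.
have split2 n : T n = (fun om => D om + (T n om - D om)).
  by apply/funext => om; rewrite addrC subrK.
have Dfin : csqint D \is a fin_num.
  rewrite ge0_fin_numE ?csqint_ge0// (split1 n1).
  apply: (le_lt_trans (csqint_young ltr01 (cT n1) (cmeasurableB cD (cT n1)))).
  rewrite invr1 (_ : 1 + 1 = 2 :> R); last by ring.
  by rewrite lte_add_pinfty// lte_mul_pinfty// (le_lt_trans H1)// ltry.
have ufin : sqint u \is a fin_num by rewrite ge0_fin_numE// sqint_ge0.
have cfin n : sqint (cut u n) \is a fin_num.
  by rewrite ge0_fin_numE ?sqint_ge0// (le_lt_trans (sqint_cut_le n mvu)).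
rewrite -[csqint _]/(csqint D) -(fineK Dfin) -(fineK ufin); congr EFin.
apply/eqP; rewrite eq_le; apply/andP; split.
  apply: le_of_young => eta e eta0 e0.
  have e1 : 0 <= 1 + eta by rewrite addr_ge0// ltW.
  have e2 : 0 <= 1 + eta^-1 by rewrite addr_ge0// invr_ge0 ltW.
  have [n [Hn _]] := app e e0.
  have H := csqint_young eta0 (cT n) (cmeasurableB cD (cT n)).
  rewrite -(split1 n) TE in H.
  have : (csqint D <= (1 + eta)%:E * sqint u + (1 + eta^-1)%:E * e%:E)%E.
    by apply: (le_trans H); apply: leeD; rewrite lee_wpmul2l// sqint_cut_le.
  rewrite -(fineK Dfin) -(fineK ufin) -!EFinM -EFinD lee_fin => /le_trans; apply.
  by rewrite lerD2r ler_wpM2l// lerDl ltW.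
(* For the reverse inequality the intermediate quantity is [sqint (cut u n)], which equals
   [csqint (T n)]. *)
apply: le_of_young2; first by rewrite fine_ge0// csqint_ge0.
move=> eta e eta0 e0.
have e1 : 0 <= 1 + eta by rewrite addr_ge0// ltW.
have e2 : 0 <= 1 + eta^-1 by rewrite addr_ge0// invr_ge0 ltW.
have [n [Hn Hc]] := app e e0.
exists (fine (sqint (cut u n))); split.
  have mc := measurable_cut n mvu.
  have H := sqint_young eta0 mc (measurable_funB mvu mc).
  rewrite (_ : cut u n \+ (u \- cut u n) = u) in H; last by apply/funext => t /=; ring.
  have : (sqint u <= (1 + eta)%:E * sqint (cut u n) + (1 + eta^-1)%:E * e%:E)%E.
    by apply: (le_trans H); apply: leeD => //; rewrite lee_wpmul2l.
  by rewrite -(fineK ufin) -(fineK (cfin n)) -!EFinM -EFinD lee_fin.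
have H := csqint_young eta0 cD (cmeasurableB (cT n) cD).
rewrite -(split2 n) TE (csqintC (T n) D) in H.
have : (sqint (cut u n) <= (1 + eta)%:E * csqint D + (1 + eta^-1)%:E * e%:E)%E.
  by apply: (le_trans H); apply: leeD => //; rewrite lee_wpmul2l.
by rewrite -(fineK Dfin) -(fineK (cfin n)) -!EFinM -EFinD lee_fin.
Unshelve. all: by end_near. Qed.

End fourier_L2.

(** * Bounds for the symbol and a Gronwall inequality *)

Section kernel_bounds.
Context {R : realType}.
Local Notation mu := (@lebesgue_measure R).

Lemma half_complex (a b : R) : (a +i* b) / 2 = (a / 2) +i* (b / 2).
Proof.
apply: (mulIf (x := 2)); first by rewrite pnatr_eq0.
rewrite divfK ?pnatr_eq0// mulr_natr mulr2n.
by apply/eqP; rewrite eq_complex/=; apply/andP; split; apply/eqP; field.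
Qed.

Lemma ccoshE (a b : R) : ccosh (a +i* b) =
  ((expR a + expR (- a)) / 2 * cos b) +i* ((expR a - expR (- a)) / 2 * sin b).
Proof.
rewrite /ccosh /cexp /= cosN sinN half_complex.
by apply/eqP; rewrite eq_complex/=; apply/andP; split; apply/eqP; field.
Qed.

Lemma csinhE (a b : R) : csinh (a +i* b) =
  ((expR a - expR (- a)) / 2 * cos b) +i* ((expR a + expR (- a)) / 2 * sin b).
Proof.
rewrite /csinh /cexp /= cosN sinN half_complex.
by apply/eqP; rewrite eq_complex/=; apply/andP; split; apply/eqP; field.
Qed.

Lemma cabs_ge0 (z : R[i]) : 0 <= cabs z.
Proof. exact: sqrtr_ge0. Qed.

Lemma cabsM (z w : R[i]) : cabs (z * w) = cabs z * cabs w.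
Proof.
apply/eqP; rewrite -(eqrXn2 (n := 2))// ?mulr_ge0 ?cabs_ge0//.
by apply/eqP; rewrite exprMn !cabs_sqr; case: z w => [a b] [c d]/=; ring.
Qed.

Lemma cabs_divM (z k : R[i]) : k != 0 -> cabs (z / k) * cabs k = cabs z.
Proof. by move=> k0; rewrite -cabsM divfK. Qed.

Lemma cabs_real (x : R) : 0 <= x -> cabs x%:C = x.
Proof. by move=> x0; rewrite /cabs/= expr0n addr0 sqrtr_sqr ger0_norm. Qed.

Lemma cabs_leP (z : R[i]) (r : R) : 0 <= r ->
  complex.Re z ^+ 2 + complex.Im z ^+ 2 <= r ^+ 2 -> cabs z <= r.
Proof. by move=> r0; rewrite -cabs_sqr ler_sqr// nnegrE cabs_ge0. Qed.

Lemma sin_sqr_le (b : R) : sin b ^+ 2 <= b ^+ 2.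
Proof.
wlog b0 : b / 0 <= b.
  move=> H; have [/H//|b0] := leP 0 b.
  by rewrite -sqrrN -sinN -[leRHS]sqrrN; apply: H; rewrite oppr_ge0 ltW.
have [c _] := MVT_segment b0 (fun x _ => is_derive_sin x)
  (continuous_subspaceT (@continuous_sin R)).
rewrite sin0 !subr0 => ->; rewrite exprMn ler_piMl ?sqr_ge0//.
Qed.

(** [|cosh (a + ib)|^2 = cosh^2 a cos^2 b + sinh^2 a sin^2 b] is at most [cosh^2 a]. *)
Lemma cabs_ccosh (a b : R) : 0 <= a -> cabs (ccosh (a +i* b)) <= expR a.
Proof.
move=> a0; apply: cabs_leP; first exact: expR_ge0.
rewrite ccoshE /=.
have e1 : expR (- a) <= expR a by rewrite ler_expR; lra.
have := expR_ge0 (- a); move: (expR a) (expR (- a)) e1 => E F EF F0.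
have h : ((E - F) / 2) ^+ 2 <= ((E + F) / 2) ^+ 2 by nra.
apply: (@le_trans _ _ (((E + F) / 2) ^+ 2 * (cos b ^+ 2 + sin b ^+ 2))).
  rewrite mulrDr -!exprMn lerD2l [leLHS]exprMn [leRHS]exprMn.
  by rewrite ler_wpM2r// sqr_ge0.
by rewrite cos2Dsin2 mulr1; nra.
Qed.

(* [|sinh (a + ib)|^2 = sinh^2 a + sin^2 b]. *)
Lemma cabs_csinh (a b : R) : 0 <= a ->
  cabs (csinh (a +i* b)) <= cabs (a +i* b) * expR a.
Proof.
move=> a0; apply: cabs_leP; first by rewrite mulr_ge0 ?cabs_ge0 ?expR_ge0.
rewrite exprMn cabs_sqr csinhE /=.
have EF1 : expR a * expR (- a) = 1 by rewrite -expRD subrr expR0.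
have e1 : expR (- a) <= expR a by rewrite ler_expR; lra.
have E1 : 1 <= expR a by rewrite -[leLHS]expR0 ler_expR.
(* This is [sinh a <= a e^a] in disguise, obtained from [e^(-2a) >= 1 - 2a]. *)
have h : expR (- a) >= expR a * (1 - 2 * a).
  have -> : expR (- a) = expR a * expR (- (2 * a)).
    by rewrite -expRD; congr expR; ring.
  by rewrite ler_wpM2l ?expR_ge0// expR_ge1Dx.
move: (expR a) (expR (- a)) EF1 e1 E1 h => E F EF1 e1 E1 h.
have cs := cos2Dsin2 b; have sb := sin_sqr_le b.
have -> : ((E - F) / 2 * cos b) ^+ 2 + ((E + F) / 2 * sin b) ^+ 2
        = ((E - F) / 2) ^+ 2 * (cos b ^+ 2 + sin b ^+ 2) + (E * F) * sin b ^+ 2.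
  by field.
rewrite cs EF1 mulr1 mul1r [leRHS]mulrDl; apply: lerD.
  rewrite -exprMn ler_sqr ?nnegrE; first by lra.
    by rewrite divr_ge0// subr_ge0.
  by rewrite mulr_ge0// (le_trans _ E1).
apply: (le_trans sb); rewrite ler_peMr ?sqr_ge0//.
by rewrite -[leLHS](expr1n _ 2) ler_sqr ?nnegrE// (le_trans _ E1).
Qed.

Section symbol.
Variable alpha : R.
Hypothesis alpha01 : 0 < alpha < 1.

Let c := cos (alpha * pi / 4).

Lemma cos_alpha_gt0 : 0 < c.
Proof.
have [a0 a1] := andP alpha01; have p0 := @pi_gt0 R.
apply: cos_gt0_pihalf; apply/andP; split; nra.
Qed.

Lemma Re_ksym om : complex.Re (ksym alpha om) = `|om| `^ (alpha / 2) * c.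
Proof. by rewrite /ksym/= mul0r subr0. Qed.

Lemma Re_ksym_ge0 om : 0 <= complex.Re (ksym alpha om).
Proof. by rewrite Re_ksym mulr_ge0 ?powR_ge0// ltW// cos_alpha_gt0. Qed.

Lemma ksym_mul om (x : R) : ksym alpha om * x%:C =
  (complex.Re (ksym alpha om) * x) +i* (complex.Im (ksym alpha om) * x).
Proof.
case: (ksym alpha om) => a b /=.
by apply/eqP; rewrite eq_complex/=; apply/andP; split; apply/eqP; ring.
Qed.

Lemma ksym_neq0 om : om != 0 -> ksym alpha om != 0.
Proof.
move=> om0; rewrite eq_complex negb_and; apply/orP; left.
by rewrite Re_ksym/= gt_eqF// mulr_gt0 ?cos_alpha_gt0// powR_gt0// normr_gt0.
Qed.

Lemma ksym0 : complex.Re (ksym alpha 0) = 0.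
Proof.
rewrite Re_ksym normr0 powR0 ?mul0r// gt_eqF// divr_gt0//.
by have /andP[] := alpha01.
Qed.

Lemma cabs_ccosh_ksym om x : 0 <= x ->
  cabs (ccosh (ksym alpha om * x%:C)) <= expR (x * complex.Re (ksym alpha om)).
Proof.
move=> x0; rewrite ksym_mul [x * _]mulrC.
by apply: cabs_ccosh; rewrite mulr_ge0// Re_ksym_ge0.
Qed.

(** Dividing [|sinh (k y)| <= |k| y e^(y Re k)] by [|k|] removes the singularity at [k = 0]. At
    [om = 0] the conventional value [y] satisfies the same bound because [Re k = 0]. *)
Lemma cabs_sinhk om y : 0 <= y ->
  cabs (sinhk alpha om y) <= y * expR (y * complex.Re (ksym alpha om)).
Proof.
move=> y0; rewrite /sinhk; have [->|om0] := eqVneq om 0.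
  by rewrite cabs_real// ksym0 mulr0 expR0 mulr1.
have k0 := ksym_neq0 om0.
have ck : 0 < cabs (ksym alpha om).
  rewrite lt_neqAle cabs_ge0 andbT; apply: contra k0 => /eqP ck.
  have := cabs_sqr (ksym alpha om); rewrite -ck expr0n => /esym/eqP.
  by rewrite paddr_eq0 ?sqr_ge0// !sqrf_eq0 eq_complex.
rewrite -(ler_pM2r ck) cabs_divM//.
have := @cabs_csinh (complex.Re (ksym alpha om) * y) (complex.Im (ksym alpha om) * y).
rewrite -ksym_mul mulr_ge0 ?Re_ksym_ge0// => /(_ isT)/le_trans; apply.
rewrite cabsM cabs_real// [_ * y as X in expR X]mulrC.
by rewrite le_eqVlt; apply/orP; left; apply/eqP; ring.
Qed.

Lemma measurable_sinhk (om x : R) :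
  measurable_fun setT (fun z : R => complex.Re (sinhk alpha om (x - z))) /\
  measurable_fun setT (fun z : R => complex.Im (sinhk alpha om (x - z))).
Proof.
rewrite /sinhk; have [om0|om0] := eqVneq om 0.
  by split => //=; exact: measurable_funB.
have ml (r : R) : measurable_fun setT (fun z : R => r * (x - z)).
  by apply: measurable_funM => //; exact: measurable_funB.
have me (r : R) : measurable_fun setT (fun z : R => expR (r * (x - z))).
  by apply: measurableT_comp => //; exact: ml.
have meN (r : R) : measurable_fun setT (fun z : R => expR (- (r * (x - z)))).
  by apply: measurableT_comp => //; apply: measurable_funN; exact: ml.
set k := ksym alpha om; set a := complex.Re k; set b := complex.Im k.
have m1 : measurable_fun setT (fun z : R => (expR (a * (x - z)) - expR (- (a * (x - z)))) / 2 * cos (b * (x - z))).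
  apply: measurable_funM; last exact: (measurableT_comp measurable_cos (ml b)).
  by apply: measurable_funM => //; apply: measurable_funB; [exact: me|exact: meN].
have m2 : measurable_fun setT (fun z : R => (expR (a * (x - z)) + expR (- (a * (x - z)))) / 2 * sin (b * (x - z))).
  apply: measurable_funM; last exact: (measurableT_comp measurable_sin (ml b)).
  by apply: measurable_funM => //; apply: measurable_funD; [exact: me|exact: meN].
case: (k^-1) => p q.
split; [under eq_fun do rewrite /k ksym_mul -/k csinhE /=|
        under eq_fun do rewrite /k ksym_mul -/k csinhE /=].
  by apply: measurable_funB; exact: measurable_funM.
by apply: measurable_funD; exact: measurable_funM.
Qed.

Lemma powR_cutoff_le (eps om : R) : 0 < eps -> `|om| <= 1 / eps ->
  `|om| `^ (alpha / 2) <= eps `^ (- (alpha / 2)).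
Proof.
move=> e0 ome; have [a0 _] := andP alpha01.
have -> : eps `^ (- (alpha / 2)) = (1 / eps) `^ (alpha / 2).
  by rewrite div1r -(powR_inv1 (ltW e0)) -powRrM mulN1r.
by apply: ge0_ler_powR => //; rewrite ?nnegrE ?divr_ge0// ltW// ?divr_gt0.
Qed.

Lemma Re_ksym_le (eps om : R) : 0 < eps -> `|om| <= 1 / eps ->
  complex.Re (ksym alpha om) <= eps `^ (- (alpha / 2)) * c.
Proof.
move=> e0 ome; rewrite Re_ksym ler_wpM2r ?powR_cutoff_le//.
by rewrite ltW// cos_alpha_gt0.
Qed.

Lemma Re_ksym_ge (eps om : R) : 0 < eps -> 1 / eps <= `|om| ->
  eps `^ (- (alpha / 2)) * c <= complex.Re (ksym alpha om).
Proof.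
move=> e0 ome; have [a0 _] := andP alpha01.
rewrite Re_ksym ler_wpM2r//; first by rewrite ltW// cos_alpha_gt0.
have -> : eps `^ (- (alpha / 2)) = (1 / eps) `^ (alpha / 2).
  by rewrite div1r -(powR_inv1 (ltW e0)) -powRrM mulN1r.
by apply: ge0_ler_powR => //; rewrite ?nnegrE ?divr_ge0// ltW// ?divr_gt0.
Qed.

End symbol.
End kernel_bounds.

(** * Cauchy-Schwarz and Gronwall on an interval *)

Section real_inequalities.
Context {R : realType}.
Local Notation mu := (@lebesgue_measure R).

Lemma lebesgue_itv0_lty (x : R) : (mu `[0%R, x] < +oo)%E.
Proof. by rewrite lebesgue_measure_itv/=; case: ifP => // _; rewrite -EFinB ltry. Qed.

(** The variance is nonnegative: expand the integral of [(p - m)^2], where [m] is the mean of [p]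
    over the interval. *)
Lemma cauchy_schwarz_itv (x : R) (p : R -> R) : 0 <= x ->
  measurable_fun `[0, x] p ->
  (\int[mu]_(z in `[0%R, x]) (p z ^+ 2)%:E < +oo)%E ->
  (\int[mu]_(z in `[0, x]) p z) ^+ 2 <= x * \int[mu]_(z in `[0, x]) p z ^+ 2.
Proof.
rewrite le_eqVlt => /predU1P[<-|x0] mp poo.
  by rewrite set_itv1 !Rintegral_set1 mul0r expr0n.
have ip : mu.-integrable `[0, x] (EFin \o p).
  apply: sq_integrable_integrable => //; exact: lebesgue_itv0_lty.
have mp2 : measurable_fun `[0, x] (fun z => p z ^+ 2) by exact: measurable_funX.
have ip2 : mu.-integrable `[0, x] (EFin \o (fun z => p z ^+ 2)).
  apply/integrableP; split; first exact/measurable_EFinP.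
  apply: le_lt_trans poo; rewrite le_eqVlt; apply/orP; left; apply/eqP.
  by apply: eq_integral => t _; rewrite /= ger0_norm// sqr_ge0.
set P := \int[mu]_(z in `[0, x]) p z; set Q := \int[mu]_(z in `[0, x]) p z ^+ 2.
have ic (r : R) : mu.-integrable `[0, x] (EFin \o cst r).
  apply: sq_integrable_integrable => //; first exact: lebesgue_itv0_lty.
  by rewrite /= (integral_cst _ _ (r ^+ 2)%:E)// lte_mul_pinfty ?lee_fin ?sqr_ge0// lebesgue_itv0_lty.
have iZ (r : R) : mu.-integrable `[0, x] (EFin \o (fun z => r * p z)).
  rewrite (_ : EFin \o _ = (fun z => r%:E * (EFin \o p) z)%E)//.
  exact: integrableZl.
pose m := P / x.
have : 0 <= \int[mu]_(z in `[0, x]) (p z ^+ 2 - (2 * m) * p z + m ^+ 2).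
  apply: Rintegral_ge0 => z _.
  by rewrite (_ : _ + _ = (p z - m) ^+ 2) ?sqr_ge0//; ring.
have iB : mu.-integrable `[0, x] (EFin \o (fun z => p z ^+ 2 - (2 * m) * p z)).
  rewrite (_ : EFin \o _ = ((EFin \o (fun z => p z ^+ 2)%R) \- (EFin \o (fun z => 2 * m * p z)%R))%E)//.
  exact: integrableB.
rewrite RintegralD//; try exact: ic.
rewrite RintegralB//; try exact: iZ.
have E3 : \int[mu]_(z in `[0, x]) (m ^+ 2) = m ^+ 2 * x.
  by rewrite Rintegral_cst//= lebesgue_measure_itv/= lte_fin x0 -EFinD/= subr0.
rewrite RintegralZl// -/P -/Q E3.
have -> : Q - 2 * m * P + m ^+ 2 * x = Q - P ^+ 2 / x.
  by rewrite /m; field; rewrite gt_eqF.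
by rewrite subr_ge0 ler_pdivrMr// mulrC.
Qed.

Lemma Rintegral_expR (l y : R) : 0 < l -> 0 <= y ->
  \int[mu]_(z in `[0, y]) expR (l * z) = (expR (l * y) - 1) / l.
Proof.
move=> l0; rewrite le_eqVlt => /predU1P[<-|y0].
  by rewrite set_itv1 Rintegral_set1 mulr0 expR0 subrr mul0r.
have dl (x : R) : is_derive x 1 (fun z : R => l^-1 * expR (l * z)) (expR (l * x)).
  have h1 : is_derive x 1 (fun z : R => l * z) l.
    apply: (is_derive_eq (@is_deriveZ _ _ _ id l x 1 1 _)).
    by rewrite /GRing.scale /= mulr1.
  have h2 := @is_derive1_comp R expR _ x _ _ (is_derive_expR _) h1.
  apply: (is_derive_eq (@is_deriveZ _ _ _ _ l^-1 x 1 _ h2)).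
  by rewrite /GRing.scale/= mulrCA mulVf ?mulr1// gt_eqF.
have dcont f f' : (forall x : R, is_derive x 1 f (f' x : R)) -> continuous f.
  move=> df x; apply: differentiable_continuous; apply/derivable1_diffP.
  exact: ex_derive.
have cE : continuous (fun z : R => expR (l * z)).
  move=> x; apply: (@continuous_comp _ _ _ (fun z : R => l * z) expR); last exact: continuous_expR.
  by apply: cvgMr; exact: cvg_id.
rewrite /Rintegral (@continuous_FTC2 _ _ (fun z : R => l^-1 * expR (l * z)))//.
- by rewrite mulr0 expR0 -EFinB/=; field; rewrite gt_eqF.
- exact: continuous_subspaceT.
- split.
  + by move=> x _; apply: ex_derive; exact: dl.
  + by apply: cvg_at_right_filter; exact: (dcont _ _ dl).
  + by apply: cvg_at_left_filter; exact: (dcont _ _ dl).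
- by move=> x _; rewrite derive1E; apply: derive_val; exact: dl.
Qed.

(* Evaluate the integral inequality at a maximum point of [phi y * exp (- l y)]. *)
Lemma gronwall (phi : R -> R) (x l B : R) : 0 <= x -> 0 < l ->
  {within `[0, x], continuous phi} ->
  (forall y, 0 <= y <= x -> phi y <= B + l * \int[mu]_(z in `[0, y]) phi z) ->
  phi x <= B * expR (l * x).
Proof.
move=> x0 l0 cphi H.
have cE : continuous (fun z : R => expR (- (l * z))).
  move=> y; apply: (@continuous_comp _ _ _ (fun z : R => - (l * z)) expR); last exact: continuous_expR.
  by apply: cvgN; apply: cvgMr; exact: cvg_id.
have cm : {within `[0, x], continuous (fun y => phi y * expR (- (l * y)))}.
  move=> y; apply: cvgM; first exact: cphi.
  exact: (continuous_subspaceT cE).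
have [y yx Hy] := EVT_max x0 cm.
move: (yx); rewrite in_itv/= => /andP[y0 y1].
set S := phi y * expR (- (l * y)) in Hy.
have EK (r : R) : expR (- r) * expR r = 1 by rewrite -expRD addNr expR0.
have phiS z : 0 <= z <= x -> phi z <= S * expR (l * z).
  move=> zx; have := Hy z; rewrite in_itv/= => /(_ zx) h.
  have := ler_wpM2r (expR_ge0 (l * z)) h.
  by rewrite -mulrA EK mulr1.
have ie (r b : R) : mu.-integrable `[0, b] (EFin \o (fun z : R => r * expR (l * z))).
  apply: continuous_compact_integrable; first exact: segment_compact.
  apply: continuous_subspaceT => z; apply: cvgMr.
  apply: (@continuous_comp _ _ _ (fun z : R => l * z) expR); last exact: continuous_expR.
  by apply: cvgMr; exact: cvg_id.
have ie1 b : mu.-integrable `[0, b] (EFin \o (fun z : R => expR (l * z))).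
  by have := ie 1 b; congr (integrable _ _ _); apply/funext => z /=; rewrite mul1r.
have iphi : mu.-integrable `[0, y] (EFin \o phi).
  apply: continuous_compact_integrable; first exact: segment_compact.
  apply: continuous_subspaceW cphi; apply: subset_itvl; by rewrite bnd_simp.
(* At the maximum point, [S e^(l y) = phi y <= B + S (e^(l y) - 1)], and the exponential terms
   cancel. *)
have SB : S <= B.
  have h1 : phi y <= B + l * \int[mu]_(z in `[0, y]) phi z by apply: H; rewrite y0 y1.
  have h2 : \int[mu]_(z in `[0, y]) phi z <= S * ((expR (l * y) - 1) / l).
    rewrite -Rintegral_expR// -RintegralZl//.
    apply: le_Rintegral => //.
    move=> z; rewrite /= in_itv/= => /andP[z0 zy]; apply: phiS.
    by rewrite z0 (le_trans zy).
  have Sy : phi y = S * expR (l * y) by rewrite /S -mulrA EK mulr1.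
  have h3 := ler_wpM2l (ltW l0) h2.
  have h4 : l * (S * ((expR (l * y) - 1) / l)) = S * expR (l * y) - S.
    by field; rewrite gt_eqF.
  by move: h1 h3; rewrite h4 Sy; lra.
apply: (le_trans (phiS x _)); first by rewrite x0 lexx.
by rewrite ler_wpM2r// expR_ge0.
Qed.

End real_inequalities.

(** * Slices of the nonlinear term *)

Section slices.
Context {R : realType}.
Local Notation mu := (@lebesgue_measure R).

Lemma ae_impl (P S : R -> Prop) : {ae mu, forall x, P x} ->
  (forall x, P x -> S x) -> {ae mu, forall x, S x}.
Proof.
move=> [N [mN N0 sN]] PS; exists N; split => // x nS.
by apply: sN => Px; exact: nS (PS _ Px).
Qed.

Lemma ae_impl2 (P Q S : R -> Prop) : {ae mu, forall x, P x} ->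
  {ae mu, forall x, Q x} -> (forall x, P x -> Q x -> S x) ->
  {ae mu, forall x, S x}.
Proof.
move=> aP aQ PQS; apply: (negligibleS _ (negligibleU aP aQ)) => x nS.
have [Px|nP] := pselect (P x); last by left.
by right => Qx; exact: nS (PQS _ Px Qx).
Qed.

Lemma measurable_nonlinearity (f : R -> R -> R -> R) (z : R) (v : R -> R) :
  Linfty_strip f -> 0 <= z <= 1 -> measurable_fun setT v ->
  measurable_fun setT (fun t => f z t (v t)).
Proof.
move=> /sub_Lfun_mfun; rewrite inE => mf z01 mv.
have mp : measurable_fun setT (fun t : R => ((z, t), v t)).
  apply: measurable_fun_pair => //; exact: pair1_measurable.
have := measurableT_comp mf mp.
congr (measurable_fun _ _); apply/funext => t /=.
by rewrite patchE mem_set.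
Qed.

(** The transform of the zero function is a chosen representative whose pointwise values are not
    known. Its norm is kept as a finite constant, and the isometry for the difference with it gives
    the bound. *)
Lemma fourier_norm_le (v : R -> R) : v \in @L2 R ->
  (csqint (fourier v) <= 2%:E * sqint v + 2%:E * csqint (fourier (fun=> (0%R : R))))%E.
Proof.
move=> vL; have zL : (fun=> 0) \in @L2 R.
  apply/L2P; split; first exact: measurable_cst.
  by rewrite /sqint; under eq_integral do rewrite expr0n; rewrite integral0.
have cv := fourier_cmeasurable vL; have cz := fourier_cmeasurable zL.
have := csqint_young ltr01 (cmeasurableB cv cz) cz.
rewrite (fourier_isometry vL zL) invr1 (_ : 1 + 1 = 2 :> R); last by ring.
rewrite (_ : (fun om => _) = fourier v); last first.
  by apply/funext => om; rewrite subrK.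
by rewrite (_ : v \- (fun=> 0) = v)//; apply/funext => t /=; rewrite subr0.
Qed.

(** [q] makes the squared norm of the slice equal, for almost every [z], to a measurable function of
    [z]. Tonelli's theorem bounds the integral of that function, so almost every slice is in L2. *)
Lemma strip_slices (f : R -> R -> R -> R) (w : R -> R -> R) :
  Linfty_strip f -> nonlinearity_L2 f -> CL2 w ->
  exists q : R * R -> R, [/\ measurable_fun setT q,
    (\int[mu]_z \int[mu]_t (q (z, t) ^+ 2)%:E < +oo)%E &
    {ae mu, forall z, 0 < z < 1 -> (fun t => f z t (w z t)) \in @L2 R /\
       sqint (fun t => f z t (w z t)) = (\int[mu]_t (q (z, t) ^+ 2)%:E)%E}].
Proof.
move=> fi fL wC; have [q qL qE] := fL _ wC.
set S := [set p : R * R | 0 < p.1 < 1] in qL.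
have mq : measurable_fun setT (q \_ S).
  by have := sub_Lfun_mfun qL; rewrite inE.
have iq := Lfun2_integrable_sqr qL.
pose h p := ((q \_ S) p ^+ 2)%:E.
have mh : measurable_fun setT h by apply/measurable_EFinP; exact: measurable_funX.
have h0 p : (0 <= h p)%E by rewrite lee_fin sqr_ge0.
have fin : (\int[mu]_z \int[mu]_t h (z, t) < +oo)%E.
  have := @fubini_tonelli1 _ _ _ _ R mu mu h mh h0; rewrite /fubini_F => <-.
  have /integrableP[_] := iq; apply: le_lt_trans.
  rewrite le_eqVlt; apply/orP; left; apply/eqP.
  by apply: eq_integral => p _; rewrite /= ger0_norm// sqr_ge0.
exists (q \_ S); split => //.
have mG := @measurable_fun_fubini_tonelli_F _ _ _ _ R mu h mh h0.
have aG : {ae mu, forall z, (\int[mu]_t h (z, t) < +oo)%E}.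
  have iG : mu.-integrable setT (fubini_F mu h).
    apply/integrableP; split => //.
    by under eq_integral do rewrite gee0_abs ?integral_ge0//.
  apply: ae_impl (integrable_ae measurableT iG) _ => z /(_ I).
  by rewrite ge0_fin_numE// integral_ge0.
apply: ae_impl2 qE aG _ => z qz Gz z01.
have z01' : 0 <= z <= 1 by have /andP[/ltW -> /ltW ->] := z01.
have [mw _] := (L2P _).1 (wC.1 z z01').
have mf := measurable_nonlinearity fi z01' mw.
have E : sqint (fun t => f z t (w z t)) = (\int[mu]_t h (z, t))%E.
  apply: ge0_ae_eq_integral => //.
  - exact: measurable_sqr.
  - exact: (measurable_fun_pair2 _ mh).
  - by move=> t _; rewrite lee_fin sqr_ge0.
  - apply: ae_impl (qz z01) _ => t qt _.
    by rewrite /h patchE mem_set// qt.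
split=> //; apply/L2P; split=> //; by rewrite E.
Qed.

(** The parts of [Q] are extended by 0 outside the strip, so that Tonelli's theorem applies on the
    whole plane. The slice norms in [omega] are integrable in [z] by [strip_slices]; exchanging the
    order gives square-integrability in [z] for almost every [omega], as Cauchy-Schwarz on the
    integral term requires. *)
Lemma solution_slices (f : R -> R -> R -> R) (w : R -> R -> R) (Q : R * R -> R[i]) :
  Linfty_strip f -> nonlinearity_L2 f -> CL2 w -> fourier_nonlinearity f w Q ->
  exists Qr Qi : R * R -> R, [/\ measurable_fun setT Qr, measurable_fun setT Qi,
    (forall z om, 0 <= z <= 1 -> Q (z, om) = Qr (z, om) +i* Qi (z, om)),
    {ae mu, forall z, 0 < z < 1 -> (fun t => f z t (w z t)) \in @L2 R /\
       {ae mu, forall om, Q (z, om) = fourier (fun t => f z t (w z t)) om}} &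
    {ae mu, forall om,
      (\int[mu]_(z in `[0%R, 1%R]) (Qr (z, om) ^+ 2 + Qi (z, om) ^+ 2)%:E < +oo)%E}].
Proof.
move=> fi fL wC [mQr mQi QE].
have [q [mq qfin qE]] := strip_slices fi fL wC.
set S := [set p : R * R | 0 <= p.1 <= 1] in mQr mQi.
have mS : measurable S.
  have := @measurable_fst _ _ (measurableTypeR R) (measurableTypeR R) measurableT
    _ (measurable_itv `[0, 1]).
  by rewrite setTI; congr measurable; apply/seteqP; split => p; rewrite /S /= in_itv.
pose Qr := (fun p => complex.Re (Q p)) \_ S.
pose Qi := (fun p => complex.Im (Q p)) \_ S.
have mr : measurable_fun setT Qr by apply/(measurable_restrictT _ _).1.
have mi : measurable_fun setT Qi by apply/(measurable_restrictT _ _).1.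
have QS z om : 0 <= z <= 1 -> Q (z, om) = Qr (z, om) +i* Qi (z, om).
  move=> z01; rewrite /Qr /Qi !patchE mem_set//; by case: (Q _).
exists Qr, Qi; split => //.
  apply: ae_impl2 qE QE _ => z H1 H2 z01; split; first exact: (H1 z01).1.
  exact: H2.
pose h p := (Qr p ^+ 2 + Qi p ^+ 2)%:E.
have mh : measurable_fun setT h.
  by apply/measurable_EFinP; apply: measurable_funD; exact: measurable_funX.
have h0 p : (0 <= h p)%E by rewrite lee_fin addr_ge0 ?sqr_ge0.
pose C := csqint (fourier (fun=> (0%R : R))).
have zL : (fun=> 0) \in @L2 R.
  apply/L2P; split; first exact: measurable_cst.
  by rewrite /sqint; under eq_integral do rewrite expr0n; rewrite integral0.
have Cfin : (C < +oo)%E by exact: csqint_fourier_lty.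
have C0 : (0 <= C)%E by exact: csqint_ge0.
pose G z := (\int[mu]_t (q (z, t) ^+ 2)%:E)%E.
have mq2 : measurable_fun setT (fun p => (q p ^+ 2)%:E).
  by apply/measurable_EFinP; exact: measurable_funX.
have q20 p : (0 <= (q p ^+ 2)%:E)%E by rewrite lee_fin sqr_ge0.
have mG : measurable_fun setT G.
  exact: (@measurable_fun_fubini_tonelli_F _ _ _ _ R mu (fun p => (q p ^+ 2)%:E) mq2 q20).
have G0 z : (0 <= G z)%E by exact: integral_ge0.
have mF := @measurable_fun_fubini_tonelli_F _ _ _ _ R mu h mh h0.
have fin : (\int[mu]_(z in `[0%R, 1%R]) \int[mu]_om h (z, om) < +oo)%E.
  apply: (@le_lt_trans _ _ (\int[mu]_(z in `[0%R, 1%R]) (2%:E * G z + 2%:E * C))%E).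
    apply: ae_ge0_le_integral => //.
    - by move=> z _; apply: integral_ge0.
    - exact: measurable_funTS.
    - by move=> z _; rewrite adde_ge0// mule_ge0.
    - apply: measurable_funTS; apply: emeasurable_funD => //.
      exact: emeasurable_funM.
    (* The slices are controlled only for [0 < z < 1]; the two end points form a null set. *)
    - have ends : {ae mu, forall z : R, z != 0 /\ z != 1}.
        exists [set 0; 1]; split.
        + exact: measurableU.
        + have : countable [set (0 : R); 1] by apply: finite_set_countable.
          exact: countable_lebesgue_measure0.
        + move=> z /=; case: (eqVneq z 0) => [->|z0]; first by left.
          case: (eqVneq z 1) => [->|z1]; first by right.
          by case.
      have aH : {ae mu, forall z, 0 < z < 1 -> (\int[mu]_om h (z, om) <= 2%:E * G z + 2%:E * C)%E}.
        apply: ae_impl2 qE QE _ => z H1 H2 z01.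
        have z01' : 0 <= z <= 1 by have /andP[/ltW -> /ltW ->] := z01.
        have [fzL fzE] := H1 z01; rewrite /G -fzE.
        apply: le_trans (fourier_norm_le fzL).
        rewrite le_eqVlt; apply/orP; left; apply/eqP.
        have [cf1 cf2] := fourier_cmeasurable fzL.
        apply: ge0_ae_eq_integral => //.
        + exact: (measurable_fun_pair2 _ mh).
        + apply: (eq_measurable_fun (fun om => (complex.Re (fourier (fun t => f z t (w z t)) om) ^+ 2 +
             complex.Im (fourier (fun t => f z t (w z t)) om) ^+ 2)%:E)).
            by move=> om _; rewrite cabs_sqr.
          by apply/measurable_EFinP; apply: measurable_funD; exact: measurable_funX.
        + by move=> om _; rewrite lee_fin sqr_ge0.
        + apply: ae_impl (H2 z01) _ => om Qom _.
          by rewrite cabs_sqr -Qom QS.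
      apply: ae_impl2 ends aH _ => z [z0 z1] H; rewrite /= in_itv/= => /andP[z0' z1'].
      by apply: H; rewrite !lt_neqAle eq_sym z0 z0' z1 z1'.
  have E1 : (\int[mu]_(z in `[0%R, 1%R]) (2%:E * G z + 2%:E * C) =
      \int[mu]_(z in `[0%R, 1%R]) (2%:E * G z) + \int[mu]_(z in `[0%R, 1%R]) (2%:E * C))%E.
    apply: ge0_integralD => //.
    - by move=> z _; rewrite mule_ge0.
    - by apply: measurable_funTS; exact: emeasurable_funM.
    - by move=> z _; rewrite mule_ge0.
  rewrite E1 ge0_integralZl_EFin//; last exact: measurable_funTS.
  have E2 : (\int[mu]_(z in `[0%R, 1%R]) (2%:E * C) = 2%:E * C * mu `[0%R, 1%R])%E.
    by rewrite -integral_cst.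
  have Gfin : (\int[mu]_(z in `[0%R, 1%R]) G z < +oo)%E.
    by apply: le_lt_trans qfin; apply: ge0_subset_integral.
  have C2fin : (2%:E * C)%E \is a fin_num by rewrite fin_numM// ge0_fin_numE.
  rewrite E2; apply: lte_add_pinfty; first exact: lte_mul_pinfty.
  apply: lte_mul_pinfty => //; first by rewrite mule_ge0.
  exact: lebesgue_itv0_lty.
have hout z om : ~ (0 <= z <= 1) -> h (z, om) = 0%E.
  move=> z01; have zS : (z, om) \notin S by apply/negP; rewrite inE.
  by rewrite /h /Qr /Qi !patchE (negbTE zS) expr0n addr0.
have hE (F : R -> \bar R) : (forall z, ~ (0 <= z <= 1) -> F z = 0%E) ->
    (\int[mu]_(z in `[0%R, 1%R]) F z = \int[mu]_z F z)%E.
  move=> F0; rewrite integral_mkcond; apply: eq_integral => z _; rewrite patchE.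
  case: ifPn => // z01; rewrite F0// => z01'; case/negP: z01.
  by rewrite inE/= in_itv.
have fin2 : (\int[mu]_om \int[mu]_z h (z, om) < +oo)%E.
  rewrite -fubini_tonelli// -hE// => z z01.
  by rewrite integral0_eq// => om _; exact: hout.
have mFG := @measurable_fun_fubini_tonelli_G _ _ _ _ R mu h mh h0.
have iG : mu.-integrable setT (fubini_G mu h).
  apply/integrableP; split => //.
  by under eq_integral do rewrite gee0_abs ?integral_ge0//.
apply: ae_impl (integrable_ae measurableT iG) _ => om /(_ I).
rewrite ge0_fin_numE ?integral_ge0// /fubini_G -hE//.
by move=> z z01; exact: hout.
Qed.

End slices.

(** * Cauchy-Schwarz for complex-valued integrals *)

Section cintegral_bound.
Context {R : realType}.
Local Notation mu := (@lebesgue_measure R).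

Definition cmeasurable_on (D : set R) (F : R -> R[i]) :=
  measurable_fun D (fun z => complex.Re (F z)) /\
  measurable_fun D (fun z => complex.Im (F z)).

Lemma cmeasurable_onM D (F G : R -> R[i]) : cmeasurable_on D F ->
  cmeasurable_on D G -> cmeasurable_on D (fun z => F z * G z).
Proof.
move=> [F1 F2] [G1 G2]; split.
  rewrite (_ : (fun z => _) = (fun z => complex.Re (F z) * complex.Re (G z) -
      complex.Im (F z) * complex.Im (G z))).
    by apply: measurable_funB; exact: measurable_funM.
  by apply/funext => z; case: (F z) (G z) => [a b] [c d].
rewrite (_ : (fun z => _) = (fun z => complex.Re (F z) * complex.Im (G z) +
    complex.Im (F z) * complex.Re (G z))).
  by apply: measurable_funD; exact: measurable_funM.
by apply/funext => z; case: (F z) (G z) => [a b] [c d].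
Qed.

Lemma cmeasurable_onB D (F G : R -> R[i]) : cmeasurable_on D F ->
  cmeasurable_on D G -> cmeasurable_on D (fun z => F z - G z).
Proof.
move=> [F1 F2] [G1 G2]; split.
  by under eq_fun do rewrite ReB; exact: measurable_funB.
by under eq_fun do rewrite ImB; exact: measurable_funB.
Qed.

Lemma measurable_cabs_sqr D (F : R -> R[i]) : cmeasurable_on D F ->
  measurable_fun D (fun z => cabs (F z) ^+ 2).
Proof.
move=> [F1 F2]; under eq_fun do rewrite cabs_sqr.
by apply: measurable_funD; exact: measurable_funX.
Qed.

(* Cauchy--Schwarz is applied to the real and imaginary parts separately. *)
Lemma cintegral_sub_le (x : R) (F G : R -> R[i]) : 0 <= x ->
  cmeasurable_on `[0, x] F -> cmeasurable_on `[0, x] G ->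
  (\int[mu]_(z in `[0%R, x]) (cabs (F z) ^+ 2)%:E < +oo)%E ->
  (\int[mu]_(z in `[0%R, x]) (cabs (G z) ^+ 2)%:E < +oo)%E ->
  ((cabs (cintegral `[0, x] F - cintegral `[0, x] G) ^+ 2)%:E <=
   x%:E * \int[mu]_(z in `[0%R, x]) (cabs (F z - G z) ^+ 2)%:E)%E.
Proof.
move=> x0 mF mG fF fG.
have part (p : R[i] -> R) (H : R -> R[i]) :
    (forall z, p z ^+ 2 <= cabs z ^+ 2) -> cmeasurable_on `[0, x] H ->
    measurable_fun `[0, x] (fun z => p (H z)) ->
    (\int[mu]_(z in `[0%R, x]) (cabs (H z) ^+ 2)%:E < +oo)%E ->
    (\int[mu]_(z in `[0%R, x]) (p (H z) ^+ 2)%:E < +oo)%E.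
  move=> pc mH mp; apply: le_lt_trans; apply: ge0_le_integral => //.
  - by move=> z _; rewrite lee_fin sqr_ge0.
  - by apply/measurable_EFinP; exact: measurable_funX.
  - by apply/measurable_EFinP; exact: measurable_cabs_sqr.
  - by move=> z _; rewrite lee_fin.
have Rle (z : R[i]) : complex.Re z ^+ 2 <= cabs z ^+ 2 by rewrite cabs_sqr lerDl sqr_ge0.
have Ile (z : R[i]) : complex.Im z ^+ 2 <= cabs z ^+ 2 by rewrite cabs_sqr lerDr sqr_ge0.
have sqi (p : R -> R) : measurable_fun `[0, x] p ->
    (\int[mu]_(z in `[0%R, x]) (p z ^+ 2)%:E < +oo)%E -> mu.-integrable `[0, x] (EFin \o p).
  by move=> mp fp; apply: sq_integrable_integrable => //; exact: lebesgue_itv0_lty.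
have iF1 := sqi _ mF.1 (part _ _ Rle mF mF.1 fF).
have iF2 := sqi _ mF.2 (part _ _ Ile mF mF.2 fF).
have iG1 := sqi _ mG.1 (part _ _ Rle mG mG.1 fG).
have iG2 := sqi _ mG.2 (part _ _ Ile mG mG.2 fG).
have mD := cmeasurable_onB mF mG.
have fD : (\int[mu]_(z in `[0%R, x]) (cabs (F z - G z) ^+ 2)%:E < +oo)%E.
  apply: (@le_lt_trans _ _ (\int[mu]_(z in `[0%R, x])
      (2 * cabs (F z) ^+ 2 + 2 * cabs (G z) ^+ 2)%:E)%E).
    apply: ge0_le_integral => //.
    - by move=> z _; rewrite lee_fin sqr_ge0.
    - by apply/measurable_EFinP; exact: measurable_cabs_sqr.
    - apply/measurable_EFinP; apply: measurable_funD; apply: measurable_funM => //;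
        exact: measurable_cabs_sqr.
    - move=> z _; rewrite lee_fin !cabs_sqr ReB ImB.
      move: (complex.Re (F z)) (complex.Im (F z)) (complex.Re (G z)) (complex.Im (G z)) => a b c d.
      by have := sqr_ge0 (a + c); have := sqr_ge0 (b + d); nra.
  have mF2 := measurable_cabs_sqr mF; have mG2 := measurable_cabs_sqr mG.
  rewrite ge0_integralD_real//; last 4 first.
  - exact: measurable_funM.
  - exact: measurable_funM.
  - by move=> z _; rewrite mulr_ge0// sqr_ge0.
  - by move=> z _; rewrite mulr_ge0// sqr_ge0.
  have p2 : (0 : R) <= 2 by [].
  rewrite (ge0_integralZl_real _ mF2 (fun z _ => sqr_ge0 _) p2)//.
  rewrite (ge0_integralZl_real _ mG2 (fun z _ => sqr_ge0 _) p2)//.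
  by rewrite lte_add_pinfty// lte_mul_pinfty.
set J := (\int[mu]_(z in `[0%R, x]) _)%E in fD *.
have f1 := part _ _ Rle mD mD.1 fD; have f2 := part _ _ Ile mD mD.2 fD.
have c1 := cauchy_schwarz_itv x0 mD.1 f1; have c2 := cauchy_schwarz_itv x0 mD.2 f2.
have JE : J = (\int[mu]_(z in `[0, x]) complex.Re (F z - G z) ^+ 2 +
               \int[mu]_(z in `[0, x]) complex.Im (F z - G z) ^+ 2)%:E.
  rewrite EFinD /Rintegral !fineK.
  - rewrite -ge0_integralD_real//.
    + by apply: eq_integral => z _; rewrite cabs_sqr.
    + by apply: measurable_funX; exact: mD.1.
    + by apply: measurable_funX; exact: mD.2.
    + by move=> z _; exact: sqr_ge0.
    + by move=> z _; exact: sqr_ge0.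
  - by rewrite ge0_fin_numE// integral_ge0// => z _; rewrite lee_fin sqr_ge0.
  - by rewrite ge0_fin_numE// integral_ge0// => z _; rewrite lee_fin sqr_ge0.
rewrite JE -EFinM lee_fin mulrDr cabs_sqr /cintegral ReB ImB /=.
apply: lerD.
  rewrite -RintegralB//; apply: le_trans c1; rewrite le_eqVlt; apply/orP; left; apply/eqP.
  by congr (_ ^+ 2); apply: eq_Rintegral => z _; rewrite ReB.
rewrite -RintegralB//; apply: le_trans c2; rewrite le_eqVlt; apply/orP; left; apply/eqP.
by congr (_ ^+ 2); apply: eq_Rintegral => z _; rewrite ImB.
Qed.

End cintegral_bound.

(** * The L2 distance between two elements of C([0,1]; L2) *)

Section distance_in_CL2.
Context {R : realType}.
Local Notation mu := (@lebesgue_measure R).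
Variables w u : R -> R -> R.
Hypothesis wC : CL2 w.
Hypothesis uC : CL2 u.

(** The [2] stands for L2: the distance is not squared. On [[0, 1]] the norm is finite and [fine]
    loses nothing. *)
Definition dist2 (z : R) : R := fine (L2norm (w z \- u z)).

Lemma dist2_ge0 z : 0 <= dist2 z.
Proof. by apply: fine_ge0; exact: Lnorm_ge0. Qed.

Lemma dist2E z : 0 <= z <= 1 -> L2norm (w z \- u z)%R = (dist2 z)%:E /\
  sqint (w z \- u z)%R = (dist2 z ^+ 2)%:E.
Proof.
move=> z01; have [_ f] := (L2P _).1 (L2B (wC.1 z z01) (uC.1 z z01)).
rewrite /dist2; have [[r [r0 -> ->]]|[_ E]] := L2norm_cases (w z \- u z); first by [].
by rewrite E in f.
Qed.

Lemma L2norm_triangle (a b : R -> R) : a \in @L2 R -> b \in @L2 R ->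
  (L2norm (a \+ b)%R <= L2norm a + L2norm b)%E.
Proof.
move=> /L2P[ma _] /L2P[mb _].
by have := @minkowski_EFin _ _ R mu a b 2 ma mb; apply; rewrite ler1n.
Qed.

(** By the triangle inequality in both directions. Continuity makes the integral of the squared
    distance finite and provides the maximum point in Gronwall's inequality. *)
Lemma dist2_continuous : {within `[0, 1], continuous dist2}.
Proof.
apply/subspace_continuousP => z; rewrite /= in_itv/= => z01.
apply/cvgrPdist_lt => e e0.
have e2 : 0 < e / 2 by rewrite divr_gt0.
have n1 : \forall y \near within `[0, 1] (nbhs z), (L2norm (w y \- w z)%R < (e / 2)%:E)%E.
  exact: ((ge0_cvge0P (fun y => Lnorm_ge0 _ _ _)).1 (wC.2 z z01) _ e2).
have n2 : \forall y \near within `[0, 1] (nbhs z), (L2norm (u y \- u z)%R < (e / 2)%:E)%E.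
  exact: ((ge0_cvge0P (fun y => Lnorm_ge0 _ _ _)).1 (uC.2 z z01) _ e2).
have n3 : \forall y \near within `[0, 1] (nbhs z), y \in `[0, 1].
  by apply: withinT; exact: nbhs_filter.
apply: filterS (filterI n3 (filterI n1 n2)) => y [yI [h1 h2]].
have y01 : 0 <= y <= 1 by move: yI; rewrite in_itv.
have wz := wC.1 z z01; have wy := wC.1 y y01.
have uz := uC.1 z z01; have uy := uC.1 y y01.
have LN (a b : R -> R) : L2norm (a \- b) = L2norm (b \- a).
  rewrite /L2norm -oppe_Lnorm; apply: eq_Lnorm => t /=.
  by rewrite opprB.
have key (a b a' b' : R -> R) : a \in @L2 R -> b \in @L2 R -> a' \in @L2 R -> b' \in @L2 R ->
    (L2norm (a \- b)%R <= L2norm (a' \- b')%R + (L2norm (a \- a')%R + L2norm (b \- b')%R))%E.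
  move=> La Lb La' Lb'.
  have -> : a \- b = (a' \- b') \+ ((a \- a') \+ (b' \- b)).
    by apply/funext => t /=; ring.
  have LL : (a \- a') \+ (b' \- b) \in @L2 R.
    have -> : (a \- a') \+ (b' \- b) = (a \- a') \- (b \- b').
      by apply/funext => t /=; ring.
    exact: L2B (L2B La La') (L2B Lb Lb').
  apply: (le_trans (L2norm_triangle (L2B La' Lb') LL)).
  by rewrite leeD2l// (LN b b') L2norm_triangle// L2B.
have [Ey _] := dist2E y01; have [Ez _] := dist2E z01.
have := key _ _ _ _ wy uy wz uz; have := key _ _ _ _ wz uz wy uy.
rewrite Ey Ez (LN (w z) (w y)) (LN (u z) (u y)).
have : (L2norm (w y \- w z)%R + L2norm (u y \- u z)%R < e%:E)%E.
  by rewrite [e]splitr EFinD lteD.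
have P (v : R -> R) : (0 <= L2norm v)%E by exact: Lnorm_ge0.
move: (L2norm (w y \- w z)) (L2norm (u y \- u z)) (P (w y \- w z)) (P (u y \- u z)).
move=> a b a0 b0 abe.
have abf : (a + b)%E \is a fin_num.
  by rewrite ge0_fin_numE ?adde_ge0// (lt_trans abe)// ltry.
move: abe; rewrite -(fineK abf) -!EFinD !lee_fin lte_fin => h3 h4 h5.
change (`|dist2 z - dist2 y| < e).
by rewrite ltr_norml; apply/andP; split; lra.
Qed.

Lemma dist2_continuousW x : x <= 1 -> {within `[0, x], continuous dist2}.
Proof.
move=> x1; apply: continuous_subspaceW dist2_continuous.
by apply: subset_itvl; rewrite bnd_simp.
Qed.

End distance_in_CL2.

(** * The integral term on the retained frequencies *)

Section kernel_integral.
Context {R : realType}.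
Local Notation mu := (@lebesgue_measure R).
Variables (alpha eps x : R).
Hypothesis alpha01 : 0 < alpha < 1.
Hypothesis eps0 : 0 < eps.
Hypothesis x01 : 0 <= x <= 1.

Let A := eps `^ (- (alpha / 2)) * cos (alpha * pi / 4).

Lemma rate_ge0 : 0 <= A.
Proof. by rewrite mulr_ge0 ?powR_ge0// ltW// cos_alpha_gt0. Qed.

(** The factor [y] of [cabs_sinhk] is at most 1 and is dropped, which gives the kernel the same
    growth rate as the hyperbolic cosine. *)
Lemma cabs_sinhk_sqr (om y : R) : `|om| <= 1 / eps -> 0 <= y <= 1 ->
  cabs (sinhk alpha om y) ^+ 2 <= expR (2 * A * y).
Proof.
move=> ome /andP[y0 y1].
have -> : expR (2 * A * y) = expR (y * A) ^+ 2.
  by rewrite expr2 -expRD; congr expR; ring.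
rewrite ler_sqr ?nnegrE ?cabs_ge0 ?expR_ge0//.
apply: (le_trans (cabs_sinhk alpha01 om y0)).
apply: (@le_trans _ _ (1 * expR (y * complex.Re (ksym alpha om)))).
  by rewrite ler_wpM2r ?expR_ge0.
by rewrite mul1r ler_expR ler_wpM2l// Re_ksym_le.
Qed.

Lemma cabs_ccosh_sqr (om : R) : `|om| <= 1 / eps ->
  cabs (ccosh (ksym alpha om * x%:C)) ^+ 2 <= expR (2 * A * x).
Proof.
move=> ome; have [x0 x1] := andP x01.
have -> : expR (2 * A * x) = expR (x * A) ^+ 2.
  by rewrite expr2 -expRD; congr expR; ring.
rewrite ler_sqr ?nnegrE ?cabs_ge0 ?expR_ge0//.
apply: (le_trans (cabs_ccosh_ksym alpha01 om x0)).
by rewrite ler_expR ler_wpM2l// Re_ksym_le.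
Qed.

(** Both integrals have the same kernel, so Cauchy-Schwarz leaves the squared kernel against the
    squared difference of the two sources. Finiteness over [[0, 1]] of each source makes the
    integrals meaningful separately. *)
Lemma kernel_integral_sub_le (om : R) (ar ai br bi : R -> R) : `|om| <= 1 / eps ->
  measurable_fun setT ar -> measurable_fun setT ai ->
  measurable_fun setT br -> measurable_fun setT bi ->
  (\int[mu]_(z in `[0%R, 1%R]) (ar z ^+ 2 + ai z ^+ 2)%:E < +oo)%E ->
  (\int[mu]_(z in `[0%R, 1%R]) (br z ^+ 2 + bi z ^+ 2)%:E < +oo)%E ->
  ((cabs (cintegral `[0, x] (fun z => sinhk alpha om (x - z) * (ar z +i* ai z)) -
          cintegral `[0, x] (fun z => sinhk alpha om (x - z) * (br z +i* bi z))) ^+ 2)%:E <=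
   \int[mu]_(z in `[0%R, x]) (expR (2 * A * (x - z)) *
      ((ar z - br z) ^+ 2 + (ai z - bi z) ^+ 2))%:E)%E.
Proof.
move=> ome mar mai mbr mbi fa fb; have [x0 x1] := andP x01.
have [mk1 mk2] := measurable_sinhk alpha om x.
have mk : cmeasurable_on `[0, x] (fun z => sinhk alpha om (x - z)).
  by split; exact: measurable_funTS.
have ma : cmeasurable_on `[0, x] (fun z => ar z +i* ai z).
  by split=> /=; exact: measurable_funTS.
have mb : cmeasurable_on `[0, x] (fun z => br z +i* bi z).
  by split=> /=; exact: measurable_funTS.
have A0 := rate_ge0.
have kz z : `[0, x]%classic z -> cabs (sinhk alpha om (x - z)) ^+ 2 <= expR (2 * A * (x - z)).
  rewrite /= in_itv/= => /andP[z0 zx]; apply: cabs_sinhk_sqr => //; lra.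
have fin (pr pi : R -> R) : measurable_fun setT pr -> measurable_fun setT pi ->
   (\int[mu]_(z in `[0%R, 1%R]) (pr z ^+ 2 + pi z ^+ 2)%:E < +oo)%E ->
   (\int[mu]_(z in `[0%R, x]) (cabs (sinhk alpha om (x - z) * (pr z +i* pi z)) ^+ 2)%:E < +oo)%E.
  move=> mr mi f.
  have m : cmeasurable_on `[0, x] (fun z => pr z +i* pi z).
    by split=> /=; exact: measurable_funTS.
  have m2 : measurable_fun setT (fun z => pr z ^+ 2 + pi z ^+ 2).
    by apply: measurable_funD; exact: measurable_funX.
  apply: (@le_lt_trans _ _ (\int[mu]_(z in `[0%R, x]) (expR (2 * A) * (pr z ^+ 2 + pi z ^+ 2))%:E)%E).
    apply: ge0_le_integral => //.
    - by move=> z _; rewrite lee_fin sqr_ge0.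
    - by apply/measurable_EFinP; apply: measurable_cabs_sqr; exact: cmeasurable_onM.
    - by apply/measurable_EFinP; apply: measurable_funM => //; exact: measurable_funTS.
    - move=> z zx; rewrite lee_fin cabsM exprMn [X in _ * X]cabs_sqr/= ler_wpM2r ?addr_ge0 ?sqr_ge0//.
      apply: (le_trans (kz z zx)); rewrite ler_expR.
      by move: zx; rewrite /= in_itv/= => /andP[z0 zx]; nra.
  rewrite ge0_integralZl_real//; last 2 first.
  - exact: measurable_funTS.
  - by move=> z _; rewrite addr_ge0 ?sqr_ge0.
  rewrite lte_mul_pinfty// ?lee_fin ?expR_ge0//.
  apply: le_lt_trans f; apply: ge0_subset_integral => //.
  - by apply/measurable_EFinP; exact: measurable_funTS.
  - by move=> z _; rewrite lee_fin addr_ge0 ?sqr_ge0.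
  - by apply: subset_itvl; rewrite bnd_simp.
have mka := cmeasurable_onM mk ma; have mkb := cmeasurable_onM mk mb.
have H := cintegral_sub_le x0 mka mkb (fin _ _ mar mai fa) (fin _ _ mbr mbi fb).
apply: (le_trans H).
(* The length [x] of the interval, contributed by Cauchy-Schwarz, is at most 1. *)
apply: (@le_trans _ _ (1%:E * \int[mu]_(z in `[0%R, x]) (cabs (sinhk alpha om (x - z) * (ar z +i* ai z) -
   sinhk alpha om (x - z) * (br z +i* bi z)) ^+ 2)%:E)%E).
  by rewrite lee_wpmul2r ?lee_fin// integral_ge0// => z _; rewrite lee_fin sqr_ge0.
rewrite mul1e; apply: ge0_le_integral => //.
- by move=> z _; rewrite lee_fin sqr_ge0.
- by apply/measurable_EFinP; apply: measurable_cabs_sqr; exact: cmeasurable_onB.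
- apply/measurable_EFinP; apply: measurable_funTS; apply: measurable_funM.
    apply: measurableT_comp => //; apply: measurable_funM => //; exact: measurable_funB.
  by apply: measurable_funD; apply: measurable_funX; exact: measurable_funB.
- move=> z zx; rewrite lee_fin -mulrBr cabsM exprMn [X in _ * X]cabs_sqr/=.
  by rewrite ler_wpM2r ?addr_ge0 ?sqr_ge0// kz.
Qed.

End kernel_integral.

(** * Stability estimate *)

Section energy_inequality.
Context {R : realType}.
Local Notation mu := (@lebesgue_measure R).

Lemma eq_cintegral (D : set R) (F G : R -> R[i]) : {in D, F =1 G} ->
  cintegral D F = cintegral D G.
Proof.
by move=> FG; rewrite /cintegral; congr (_ +i* _); apply: eq_Rintegral => z zD; rewrite FG.
Qed.

(** Young's inequality with [eta = 1], applied to [p + q] against [r] and then to [p] against [q].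
    The weight 4 leads to [(2 delta)^2] and the weight 2 to the Gronwall rate [2 K^2]. *)
Lemma cabs_sqr3 (p q r : R[i]) :
  cabs (p + q - r) ^+ 2 <= 4 * cabs p ^+ 2 + 4 * cabs q ^+ 2 + 2 * cabs r ^+ 2.
Proof.
rewrite !cabs_sqr; case: p q r => [a b] [c d] [e f] /=.
have := sqr_ge0 (a + c + e); have := sqr_ge0 (a - c).
have := sqr_ge0 (b + d + f); have := sqr_ge0 (b - d); nra.
Qed.

Lemma cabs_sqr3M (a p b q r : R[i]) : cabs (a * p + b * q - r) ^+ 2 <=
  4 * (cabs a ^+ 2 * cabs p ^+ 2) + 4 * (cabs b ^+ 2 * cabs q ^+ 2) + 2 * cabs r ^+ 2.
Proof. by rewrite -!exprMn -!cabsM; exact: cabs_sqr3. Qed.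

Let weighted_sum_le (E a b p q r : R) : a <= E -> b <= E -> 0 <= p -> 0 <= q ->
  4 * (a * p) + 4 * (b * q) + 2 * r <= 4 * E * (p + q) + 2 * r.
Proof.
move=> aE bE p0 q0; rewrite lerD2r -mulrA -mulrDr ler_wpM2l// mulrDr.
by rewrite lerD// ler_wpM2r.
Qed.

Let integral_scaled_sum_le (p q : R -> R) (k e : R) (s t : \bar R) : 0 <= k ->
  measurable_fun setT p -> measurable_fun setT q ->
  (forall y, 0 <= p y) -> (forall y, 0 <= q y) ->
  (\int[mu]_y (p y)%:E = s)%E -> (\int[mu]_y (q y)%:E = t)%E -> (s + t <= e%:E)%E ->
  (\int[mu]_y (k * (p y + q y))%:E <= (k * e)%:E)%E.
Proof.
move=> k0 mp mq p0 q0 ps qt ste.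
rewrite ge0_integralZl_real//; last 2 first.
- exact: measurable_funD.
- by move=> y _; exact: addr_ge0.
by rewrite ge0_integralD_real// ps qt EFinM lee_wpmul2l.
Qed.

Let integral_sum3 (p q r : R -> \bar R) : (forall y, 0 <= p y)%E ->
  (forall y, 0 <= q y)%E -> (forall y, 0 <= r y)%E ->
  measurable_fun setT p -> measurable_fun setT q -> measurable_fun setT r ->
  (\int[mu]_y (p y + 2%:E * q y + r y) =
   \int[mu]_y p y + 2%:E * \int[mu]_y q y + \int[mu]_y r y)%E.
Proof.
move=> p0 q0 r0 mp mq mr.
have m2 : measurable_fun setT (fun y => 2%:E * q y)%E by exact: emeasurable_funM.
have q2 y : (0 <= 2%:E * q y)%E by rewrite mule_ge0.
rewrite ge0_integralD//; last 2 first.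
- by move=> y _; rewrite adde_ge0.
- exact: emeasurable_funD.
by rewrite ge0_integralD// ge0_integralZl_EFin.
Qed.

(** For nonnegative norms, [r + s <= d] implies [r^2 + s^2 <= d^2]; bounding the two errors jointly
    saves a factor 2. *)
Lemma sqint_noise (a b : R -> R) (d : R) : 0 <= d ->
  (L2norm a + L2norm b <= d%:E)%E -> (sqint a + sqint b <= (d ^+ 2)%:E)%E.
Proof.
move=> d0; have [[r [r0 -> ->]]|[-> _]] := L2norm_cases a; last first.
  by have [[s [s0 -> _]]|[-> _]] := L2norm_cases b; rewrite ?addye// leye_eq.
have [[s [s0 -> ->]]|[-> _]] := L2norm_cases b; last by rewrite addey// leye_eq.
by rewrite -!EFinD !lee_fin => rs; nra.
Qed.

Variables (alpha K M1 delta eps : R) (f : R -> R -> R -> R).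
Variables (g h gd hd : R -> R) (u w : R -> R -> R).
Hypothesis alpha01 : 0 < alpha < 1.
Hypothesis fi : Linfty_strip f.
Hypothesis K0 : 0 < K.
Hypothesis flip : forall x t v1 v2 : R, 0 <= x <= 1 ->
  `|f x t v1 - f x t v2| <= K * `|v1 - v2|.
Hypothesis fL : nonlinearity_L2 f.
Hypothesis gL : g \in @L2 R.
Hypothesis hL : h \in @L2 R.
Hypothesis gdL : gd \in @L2 R.
Hypothesis hdL : hd \in @L2 R.
Hypothesis delta0 : 0 < delta.
Hypothesis noise : (L2norm (gd \- g)%R + L2norm (hd \- h)%R <= delta%:E)%E.
Hypothesis eps0 : 0 < eps.
Hypothesis wS : solves_regularized alpha eps f gd hd w.
Hypothesis uS : solves_exact alpha f g h u.
Hypothesis apriori : forall x : R, 0 <= x < 1 ->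
  (\int[mu]_om (expR (2 * (1 - x) * complex.Re (ksym alpha om))
     * cabs (fourier (u x) om) ^+ 2)%:E < (M1 ^+ 2)%:E)%E.

Let A := eps `^ (- (alpha / 2)) * cos (alpha * pi / 4).
Let wC : CL2 w := wS.1.
Let uC : CL2 u := uS.1.
Let d := dist2 w u.

(** The isometry brings the difference back to the variable [t], where the Lipschitz condition holds
    pointwise. *)
Lemma slice_difference (z : R) (Qw Qu : R -> R[i]) (Qwr Qwi Qur Qui : R -> R) :
  0 <= z <= 1 ->
  measurable_fun setT Qwr -> measurable_fun setT Qwi ->
  measurable_fun setT Qur -> measurable_fun setT Qui ->
  (fun t => f z t (w z t)) \in @L2 R -> (fun t => f z t (u z t)) \in @L2 R ->
  (forall om, Qw om = Qwr om +i* Qwi om) -> (forall om, Qu om = Qur om +i* Qui om) ->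
  {ae mu, forall om, Qw om = fourier (fun t => f z t (w z t)) om} ->
  {ae mu, forall om, Qu om = fourier (fun t => f z t (u z t)) om} ->
  (\int[mu]_om ((Qwr om - Qur om) ^+ 2 + (Qwi om - Qui om) ^+ 2)%:E <=
   (K ^+ 2 * d z ^+ 2)%:E)%E.
Proof.
move=> z01 m1 m2 m3 m4 wL uL wE uE aw au.
have [mfw _] := (L2P _).1 wL; have [mfu _] := (L2P _).1 uL.
have mD := cmeasurableB (fourier_cmeasurable wL) (fourier_cmeasurable uL).
apply: (@le_trans _ _ (csqint (fun om => fourier (fun t => f z t (w z t)) om -
   fourier (fun t => f z t (u z t)) om)%R)).
  rewrite le_eqVlt; apply/orP; left; apply/eqP.
  apply: ge0_ae_eq_integral => //.
  - apply/measurable_EFinP; apply: measurable_funD; apply: measurable_funX; exact: measurable_funB.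
  - by apply/measurable_EFinP; exact: measurable_cabs_sqr.
  - by move=> om _; rewrite lee_fin addr_ge0 ?sqr_ge0.
  - by move=> om _; rewrite lee_fin sqr_ge0.
  - apply: ae_impl2 aw au _ => om Ew Eu _.
    by rewrite -Ew -Eu wE uE cabs_sqr.
rewrite (fourier_isometry wL uL).
have [_ dE] := dist2E wC uC z01.
have [mwu _] := (L2P _).1 (L2B (wC.1 z z01) (uC.1 z z01)).
rewrite EFinM /d -dE /sqint -ge0_integralZl_real ?sqr_ge0//; last 2 first.
- exact: measurable_funX.
- by move=> t _; exact: sqr_ge0.
apply: ge0_le_integral => //.
- by move=> t _; rewrite lee_fin sqr_ge0.
- by apply: measurable_sqr; exact: measurable_funB.
- by apply/measurable_EFinP; apply: measurable_funM => //; exact: measurable_funX.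
- move=> t _; rewrite lee_fin /= -exprMn.
  rewrite -(real_normK (num_real (f z t (w z t) - _))) -(real_normK (num_real (K * _))).
  by rewrite ler_sqr// normrM (gtr0_norm K0); exact: flip.
Qed.

(** The three terms are nonnegative. A retained frequency is covered by the first two, a discarded
    one by the third alone, so no cross term between the two ranges arises. The third is a constant
    times the density of the a priori bound, ready to be integrated. *)
Lemma pointwise_estimate (x om : R) (Qw Qu : R * R -> R[i])
    (Qwr Qwi Qur Qui : R * R -> R) : 0 <= x < 1 ->
  measurable_fun setT Qwr -> measurable_fun setT Qwi ->
  measurable_fun setT Qur -> measurable_fun setT Qui ->
  (forall z om, 0 <= z <= 1 -> Qw (z, om) = Qwr (z, om) +i* Qwi (z, om)) ->
  (forall z om, 0 <= z <= 1 -> Qu (z, om) = Qur (z, om) +i* Qui (z, om)) ->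
  (\int[mu]_(z in `[0%R, 1%R]) (Qwr (z, om) ^+ 2 + Qwi (z, om) ^+ 2)%:E < +oo)%E ->
  (\int[mu]_(z in `[0%R, 1%R]) (Qur (z, om) ^+ 2 + Qui (z, om) ^+ 2)%:E < +oo)%E ->
  fourier (w x) om = (\1_(`[- (1 / eps), 1 / eps] : set R) om)%:C *
    solution_formula alpha gd hd Qw x om ->
  fourier (u x) om = solution_formula alpha g h Qu x om ->
  ((cabs (fourier (w x) om - fourier (u x) om) ^+ 2)%:E <=
   (4 * expR (2 * A * x) * (cabs (fourier gd om - fourier g om) ^+ 2 +
      cabs (fourier hd om - fourier h om) ^+ 2))%:E +
   2%:E * \int[mu]_(z in `[0%R, x]) (expR (2 * A * (x - z)) *
      ((Qwr (z, om) - Qur (z, om)) ^+ 2 + (Qwi (z, om) - Qui (z, om)) ^+ 2))%:E +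
   (expR (- (2 * A * (1 - x))) * (expR (2 * (1 - x) * complex.Re (ksym alpha om)) *
      cabs (fourier (u x) om) ^+ 2))%:E)%E.
Proof.
move=> /andP[x0 x1] m1 m2 m3 m4 wE uE fw fu WE UE.
have x01 : 0 <= x <= 1 by rewrite x0 ltW.
set G := (\int[mu]_(z in `[0%R, x]) _)%E.
have G0 : (0 <= G)%E.
  apply: integral_ge0 => z _; rewrite lee_fin mulr_ge0 ?expR_ge0//.
  by rewrite addr_ge0 ?sqr_ge0.
have T1 : 0 <= 4 * expR (2 * A * x) * (cabs (fourier gd om - fourier g om) ^+ 2 +
      cabs (fourier hd om - fourier h om) ^+ 2).
  by rewrite !mulr_ge0 ?expR_ge0// addr_ge0 ?sqr_ge0.
have T3 : 0 <= expR (- (2 * A * (1 - x))) * (expR (2 * (1 - x) * complex.Re (ksym alpha om)) *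
      cabs (fourier (u x) om) ^+ 2).
  apply: mulr_ge0; first exact: expR_ge0.
  by apply: mulr_ge0; [exact: expR_ge0|exact: sqr_ge0].
have [omI|omI] := boolP (om \in `[- (1 / eps), 1 / eps]); last first.
  have -> : fourier (w x) om = 0.
    rewrite WE indicE (_ : (om \in _) = false) ?mul0r//.
    by apply: contraNF omI; rewrite inE.
  have ome : 1 / eps <= `|om|.
    move: omI; rewrite in_itv/= -ler_norml -ltNge; exact: ltW.
  apply: (@le_trans _ _ (expR (- (2 * A * (1 - x))) * (expR (2 * (1 - x) * complex.Re (ksym alpha om)) *
      cabs (fourier (u x) om) ^+ 2))%:E); last first.
    by rewrite leeDr// adde_ge0// mule_ge0.
  rewrite lee_fin sub0r [leLHS](_ : _ = cabs (fourier (u x) om) ^+ 2); last first.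
    by rewrite !cabs_sqr; case: (fourier (u x) om) => [a b]/=; rewrite !sqrrN.
  (* The two exponentials combine to [exp (2 (1 - x) (Re k - A))], which is at least 1 because
     [Re k >= A] beyond the cutoff. *)
  rewrite mulrA -expRD ler_peMl ?sqr_ge0// -[leLHS]expR0 ler_expR.
  have := Re_ksym_ge alpha01 eps0 ome; rewrite -/A => h1.
  have x2 : 0 <= 2 * (1 - x) by rewrite mulr_ge0// subr_ge0 ltW.
  by rewrite addrC subr_ge0 mulrAC ler_wpM2l.
have ome : `|om| <= 1 / eps by move: omI; rewrite in_itv/= -ler_norml.
rewrite -[leLHS]adde0; apply: leeD => //.
pose Iw := cintegral `[0, x] (fun z => sinhk alpha om (x - z) * (Qwr (z, om) +i* Qwi (z, om))).
pose Iu := cintegral `[0, x] (fun z => sinhk alpha om (x - z) * (Qur (z, om) +i* Qui (z, om))).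
have IG : ((cabs (Iw - Iu) ^+ 2)%:E <= G)%E.
  apply: kernel_integral_sub_le => //.
  - exact: (measurable_fun_pair1 _ m1).
  - exact: (measurable_fun_pair1 _ m2).
  - exact: (measurable_fun_pair1 _ m3).
  - exact: (measurable_fun_pair1 _ m4).
have sub01 z : z \in `[0, x]%classic -> 0 <= z <= 1.
  by rewrite inE/= in_itv/= => /andP[-> zx]; rewrite (le_trans zx)// ltW.
set a := ccosh (ksym alpha om * x%:C); set b := sinhk alpha om x.
have W2 : fourier (w x) om = a * fourier gd om + b * fourier hd om - Iw.
  rewrite WE indicE mem_set// mul1r /solution_formula -/a -/b; congr (_ - _).
  by apply: eq_cintegral => z zx; rewrite wE// sub01.
have U2 : fourier (u x) om = a * fourier g om + b * fourier h om - Iu.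
  rewrite UE /solution_formula -/a -/b; congr (_ - _).
  by apply: eq_cintegral => z zx; rewrite uE// sub01.
have E (p q r s t v y z : R[i]) :
    p * q + r * s - t - (p * v + r * y - z) = p * (q - v) + r * (s - y) - (t - z) by ring.
rewrite W2 U2 E.
have ab : cabs a ^+ 2 <= expR (2 * A * x) by exact: cabs_ccosh_sqr.
have bb : cabs b ^+ 2 <= expR (2 * A * x) by exact: cabs_sinhk_sqr.
apply: (@le_trans _ _ ((4 * expR (2 * A * x) * (cabs (fourier gd om - fourier g om) ^+ 2 +
      cabs (fourier hd om - fourier h om) ^+ 2))%:E + 2%:E * (cabs (Iw - Iu) ^+ 2)%:E)%E); last first.
  by rewrite leeD2l// lee_wpmul2l.
rewrite -EFinM -EFinD lee_fin.
exact: (le_trans (cabs_sqr3M a (fourier gd om - fourier g om) b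
  (fourier hd om - fourier h om) (Iw - Iu)) (weighted_sum_le _ ab bb (sqr_ge0 _) (sqr_ge0 _))).
Qed.

(** The pointwise estimate is integrated over [omega]. In the middle term Tonelli's theorem brings
    the integral over [omega] inside, where [slice_difference] bounds it for almost every [z]. *)
Theorem energy_inequality (x : R) : 0 <= x < 1 ->
  d x ^+ 2 <= 4 * expR (2 * A * x) * delta ^+ 2 +
    2 * \int[mu]_(z in `[0, x]) (expR (2 * A * (x - z)) * (K ^+ 2 * d z ^+ 2)) +
    expR (- (2 * A * (1 - x))) * M1 ^+ 2.
Proof.
move=> x01; have /andP[x0 x1] := x01.
have x01' : 0 <= x <= 1 by rewrite x0 ltW.
have [_ [Qw Qw1 Qw2]] := wS; have [_ [Qu Qu1 Qu2]] := uS.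
have [Qwr [Qwi [m1 m2 wE wz wfin]]] := solution_slices fi fL wC Qw1.
have [Qur [Qui [m3 m4 uE uz ufin]]] := solution_slices fi fL uC Qu1.
have wxL := wC.1 x x01'; have uxL := uC.1 x x01'.
have [_ dE] := dist2E wC uC x01'.
pose D p := (Qwr p - Qur p) ^+ 2 + (Qwi p - Qui p) ^+ 2.
have D0 p : 0 <= D p by rewrite addr_ge0 ?sqr_ge0.
have mD : measurable_fun setT D.
  by apply: measurable_funD; apply: measurable_funX; exact: measurable_funB.
pose k (z : R) := expR (2 * A * (x - z)).
have k0 z : 0 <= k z by exact: expR_ge0.
have mk : measurable_fun setT k.
  by apply: measurableT_comp => //; apply: measurable_funM => //; exact: measurable_funB.
pose I : set R := [set` `[0, x]].
have mI : measurable I by exact: measurable_itv.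
(* Restricting the kernel to [[0, x]] turns the integral over a strip into one over the plane. *)
pose H (p : R * R) := ((k \_ I) p.1 * D p)%:E.
have mkI : measurable_fun setT (k \_ I).
  by apply/(measurable_restrictT _ _).1 => //; exact: measurable_funTS.
have mH : measurable_fun setT H.
  apply/measurable_EFinP; apply: measurable_funM => //.
  exact: (measurableT_comp mkI measurable_fst).
have H0 p : (0 <= H p)%E.
  by rewrite lee_fin mulr_ge0// patchE; case: ifP.
pose G om := (\int[mu]_(z in `[0%R, x]) (k z * D (z, om))%:E)%E.
have GE om : G om = (\int[mu]_z H (z, om))%E.
  rewrite /G integral_mkcond; apply: eq_integral => z _.
  by rewrite /H /= !patchE; case: ifP => //; rewrite mul0r.
have mG : measurable_fun setT G.
  rewrite (_ : G = fubini_G mu H); last by apply/funext => om; rewrite GE.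
  exact: (@measurable_fun_fubini_tonelli_G _ _ _ _ R mu H mH H0).
have G0 om : (0 <= G om)%E.
  by apply: integral_ge0 => z _; rewrite lee_fin mulr_ge0.
pose cst1 := 4 * expR (2 * A * x).
have c10 : 0 <= cst1 by rewrite mulr_ge0// expR_ge0.
pose gap (a b : R -> R) om := cabs (fourier a om - fourier b om) ^+ 2.
have gap0 a b om : 0 <= gap a b om by exact: sqr_ge0.
have mgap a b : a \in @L2 R -> b \in @L2 R -> measurable_fun setT (gap a b).
  move=> aL bL; apply: measurable_cabs_sqr.
  exact: (cmeasurableB (fourier_cmeasurable aL) (fourier_cmeasurable bL)).
have Igap a b : a \in @L2 R -> b \in @L2 R -> (\int[mu]_om (gap a b om)%:E = sqint (a \- b)%R)%E.
  by move=> aL bL; exact: fourier_isometry.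
pose T1 om := cst1 * (gap gd g om + gap hd h om).
pose cst3 := expR (- (2 * A * (1 - x))).
pose V om := expR (2 * (1 - x) * complex.Re (ksym alpha om)) * cabs (fourier (u x) om) ^+ 2.
have mV : measurable_fun setT V.
  apply: measurable_funM; last by apply: measurable_cabs_sqr; exact: fourier_cmeasurable.
  apply: measurableT_comp => //; apply: measurable_funM => //.
  under eq_fun do rewrite Re_ksym.
  apply: measurable_funM => //.
  apply: (@measurableT_comp _ _ _ _ _ _ (@powR R ^~ (alpha / 2))) => //.
have V0 om : 0 <= V om by rewrite mulr_ge0 ?expR_ge0 ?sqr_ge0.
have mT1 : measurable_fun setT T1.
  by apply: measurable_funM => //; apply: measurable_funD; exact: mgap.
have T10 om : 0 <= T1 om by rewrite mulr_ge0// addr_ge0.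
have mT1' : measurable_fun setT (fun om => (T1 om)%:E) by exact/measurable_EFinP.
have m2G : measurable_fun setT (fun om => 2%:E * G om)%E by exact: emeasurable_funM.
have mT3' : measurable_fun setT (fun om => (cst3 * V om)%:E).
  by apply/measurable_EFinP; exact: measurable_funM.
have est : (sqint (w x \- u x)%R <=
    \int[mu]_om ((T1 om)%:E + 2%:E * G om + (cst3 * V om)%:E))%E.
  rewrite -(Igap _ _ wxL uxL); apply: ae_ge0_le_integral => //.
  - by move=> om _; rewrite lee_fin.
  - by apply/measurable_EFinP; exact: mgap.
  - by move=> om _; rewrite !adde_ge0 ?lee_fin ?mule_ge0// mulr_ge0// expR_ge0.
  - exact: (emeasurable_funD (emeasurable_funD mT1' m2G) mT3').
  - have aeW := ae_impl2 (Qw2 x x01') wfin (fun om h1 h2 => conj h1 h2).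
    have aeU := ae_impl2 (Qu2 x x01') ufin (fun om h1 h2 => conj h1 h2).
    refine (ae_impl2 aeW aeU _) => om [W1 W2] [U1 U2] _.
    exact: (pointwise_estimate x01 m1 m2 m3 m4 wE uE W2 U2 W1 U1).
have I1 : (\int[mu]_om (T1 om)%:E <= (cst1 * delta ^+ 2)%:E)%E.
  exact: (integral_scaled_sum_le c10 (mgap _ _ gdL gL) (mgap _ _ hdL hL)
    (gap0 gd g) (gap0 hd h) (Igap _ _ gdL gL) (Igap _ _ hdL hL)
    (sqint_noise (ltW delta0) noise)).
have I3 : (\int[mu]_om (cst3 * V om)%:E <= (cst3 * M1 ^+ 2)%:E)%E.
  rewrite ge0_integralZl_real ?expR_ge0// EFinM lee_wpmul2l ?lee_fin ?expR_ge0//.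
  exact/ltW/apriori.
have cd : {within `[0, x], continuous d} by apply: dist2_continuousW => //; exact: ltW.
have ck : continuous k.
  move=> z; apply: (@continuous_comp _ _ _ (fun z : R => 2 * A * (x - z)) expR);
    last exact: continuous_expR.
  by apply: cvgMr; apply: cvgB; [exact: cvg_cst|exact: cvg_id].
pose J z := k z * (K ^+ 2 * d z ^+ 2).
have iJ : mu.-integrable `[0, x] (EFin \o J).
  apply: continuous_compact_integrable; first exact: segment_compact.
  move=> z; apply: cvgM; first exact: (continuous_subspaceT ck).
  apply: cvgMr; apply: (@continuous_comp _ _ _ (from_subspace `[0, x] d) (fun r : R => r ^+ 2)).
    exact: cd.
  exact: exprn_continuous.
have J0 z : 0 <= J z by rewrite mulr_ge0// mulr_ge0// sqr_ge0.
have I2 : (\int[mu]_om G om <= (\int[mu]_(z in `[0, x]) J z)%:E)%E.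
  have JE : ((\int[mu]_(z in `[0, x]) J z)%:E = \int[mu]_(z in `[0%R, x]) (J z)%:E)%E.
    by rewrite /Rintegral fineK//; apply: integrable_fin_num.
  rewrite JE.
  under eq_integral do rewrite GE.
  rewrite -fubini_tonelli// [leRHS]integral_mkcond.
  have mJ : measurable_fun `[0, x] (EFin \o J) := measurable_int mu iJ.
  apply: ae_ge0_le_integral => //.
  - by move=> z _; exact: integral_ge0.
  - exact: (@measurable_fun_fubini_tonelli_F _ _ _ _ R mu H mH H0).
  - by move=> z _; rewrite patchE; case: ifP => // _; rewrite lee_fin.
  - by apply/(measurable_restrictT _ _).1.
  (* Only the left end point has to be removed: [z <= x < 1] already excludes 1. *)
  - have ends : {ae mu, forall z : R, z != 0}.
      exists [set 0]; split => //; first exact: lebesgue_measure_set1.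
      by move=> z /= nz; case: (eqVneq z 0) => // z0; case: (nz z0).
    have aeQ : {ae mu, forall z : R, 0 < z < 1 -> (\int[mu]_om (D (z, om))%:E <= (K ^+ 2 * d z ^+ 2)%:E)%E}.
      apply: ae_impl2 wz uz _ => z Hw Hu z01.
      have [wzL wzE] := Hw z01; have [uzL uzE] := Hu z01.
      have z01' : 0 <= z <= 1 by have /andP[/ltW -> /ltW ->] := z01.
      apply: (slice_difference z01' _ _ _ _ wzL uzL (fun om => wE z om z01')
        (fun om => uE z om z01') wzE uzE).
      + exact: (measurable_fun_pair2 _ m1).
      + exact: (measurable_fun_pair2 _ m2).
      + exact: (measurable_fun_pair2 _ m3).
      + exact: (measurable_fun_pair2 _ m4).
    apply: ae_impl2 ends aeQ _ => z z0 Hz _; rewrite /H /= !patchE.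
    case: ifPn => [zI|_]; last first.
      by rewrite integral0_eq// => om _; rewrite mul0r.
    have /andP[zz0 zx] : 0 <= z <= x by move: zI; rewrite inE /I/= in_itv.
    have zz : 0 < z < 1 by rewrite lt_neqAle eq_sym z0 zz0 (le_lt_trans zx).
    rewrite ge0_integralZl_real//; last exact: (measurable_fun_pair2 _ mD).
    by rewrite /J /= EFinM lee_wpmul2l ?lee_fin// Hz.
have sumE : (\int[mu]_om ((T1 om)%:E + 2%:E * G om + (cst3 * V om)%:E) =
   \int[mu]_om (T1 om)%:E + 2%:E * \int[mu]_om G om + \int[mu]_om (cst3 * V om)%:E)%E.
  have p1 om : (0 <= (T1 om)%:E)%E by rewrite lee_fin.
  have p3 om : (0 <= (cst3 * V om)%:E)%E by rewrite lee_fin mulr_ge0// expR_ge0.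
  exact: (integral_sum3 p1 G0 p3 mT1' mG mT3').
have I2' : (2%:E * \int[mu]_om G om <= (2 * \int[mu]_(z in `[0, x]) J z)%:E)%E.
  by rewrite EFinM lee_wpmul2l.
have tot := leeD (leeD I1 I2') I3.
rewrite -sumE in tot; have := le_trans est tot.
by rewrite dE -!EFinD lee_fin.
Qed.

End energy_inequality.

(** * Gronwall's inequality for the weighted squared distance *)

Section stability.
Context {R : realType}.
Local Notation mu := (@lebesgue_measure R).
Variables (alpha K M1 delta eps : R) (f : R -> R -> R -> R).
Variables (g h gd hd : R -> R) (u w : R -> R -> R).
Hypothesis alpha01 : 0 < alpha < 1.
Hypothesis fi : Linfty_strip f.
Hypothesis K0 : 0 < K.
Hypothesis flip : forall x t v1 v2 : R, 0 <= x <= 1 ->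
  `|f x t v1 - f x t v2| <= K * `|v1 - v2|.
Hypothesis fL : nonlinearity_L2 f.
Hypothesis gL : g \in @L2 R.
Hypothesis hL : h \in @L2 R.
Hypothesis gdL : gd \in @L2 R.
Hypothesis hdL : hd \in @L2 R.
Hypothesis delta0 : 0 < delta.
Hypothesis noise : (L2norm (gd \- g)%R + L2norm (hd \- h)%R <= delta%:E)%E.
Hypothesis eps0 : 0 < eps.
Hypothesis wS : solves_regularized alpha eps f gd hd w.
Hypothesis uS : solves_exact alpha f g h u.
Hypothesis M10 : 0 < M1.
Hypothesis apriori : forall x : R, 0 <= x < 1 ->
  (\int[mu]_om (expR (2 * (1 - x) * complex.Re (ksym alpha om))
     * cabs (fourier (u x) om) ^+ 2)%:E < (M1 ^+ 2)%:E)%E.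

Let A := eps `^ (- (alpha / 2)) * cos (alpha * pi / 4).

(** The weight [e^(-2Ay)] cancels the growth [e^(2A(y-z))] of the kernel up to the weight at [z], so
    that [phi] satisfies a linear integral inequality with constant rate. *)
Lemma stability_estimate (x : R) : 0 <= x < 1 ->
  (L2norm (w x \- u x)%R <=
   ((2 * delta + M1 * expR (- A)) * expR (K ^+ 2) * expR (A * x))%:E)%E.
Proof.
move=> /andP[x0 x1]; have wC := wS.1; have uC := uS.1.
have x01 : 0 <= x <= 1 by rewrite x0 ltW.
have [-> _] := dist2E wC uC x01; set d := dist2 w u.
have d0 : 0 <= d x by exact: dist2_ge0.
pose phi y := expR (- (2 * A * y)) * d y ^+ 2.
have cE : continuous (fun y : R => expR (- (2 * A * y))).
  move=> y; apply: (@continuous_comp _ _ _ (fun z : R => - (2 * A * z)) expR);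
    last exact: continuous_expR.
  by apply: cvgN; apply: cvgMr; exact: cvg_id.
have cphi : {within `[0, x], continuous phi}.
  move=> z; apply: cvgM; first exact: (continuous_subspaceT cE).
  apply: (@continuous_comp _ _ _ (from_subspace `[0, x] d) (fun r : R => r ^+ 2)).
    by apply: dist2_continuousW => //; exact: ltW.
  exact: exprn_continuous.
have EK (a b : R) : expR a * expR b = expR (a + b) by rewrite expRD.
(* Multiplied by [e^(-2Ay)], the discarded-frequency term [e^(-2A(1-y)) M1^2] becomes
   [e^(-2A) M1^2], so [B] is the same for all [y]. *)
set B := 4 * delta ^+ 2 + expR (- (2 * A)) * M1 ^+ 2.
have K2 : 0 < 2 * K ^+ 2 by rewrite mulr_gt0// exprn_gt0.
have ineq y : 0 <= y <= x -> phi y <= B + 2 * K ^+ 2 * \int[mu]_(z in `[0, y]) phi z.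
  move=> /andP[y0 yx]; have y01 : 0 <= y < 1 by rewrite y0 (le_lt_trans yx).
  have H := energy_inequality alpha01 fi K0 flip fL gL hL gdL hdL delta0 noise eps0 wS uS apriori y01.
  have iphi : mu.-integrable `[0, y] (EFin \o phi).
    apply: continuous_compact_integrable; first exact: segment_compact.
    by apply: continuous_subspaceW cphi; apply: subset_itvl; rewrite bnd_simp.
  have IE : \int[mu]_(z in `[0, y]) (expR (2 * A * (y - z)) * (K ^+ 2 * d z ^+ 2)) =
      expR (2 * A * y) * K ^+ 2 * \int[mu]_(z in `[0, y]) phi z.
    rewrite -RintegralZl//; apply: eq_Rintegral => z _; rewrite /phi.
    have -> : expR (2 * A * (y - z)) = expR (2 * A * y) * expR (- (2 * A * z)).
      by rewrite EK; congr expR; ring.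
    by ring.
  move: H; rewrite -/A -/d IE => H.
  have := ler_wpM2l (expR_ge0 (- (2 * A * y))) H; rewrite -/(phi y).
  move/le_trans; apply.
  have E1 : expR (- (2 * A * y)) * expR (2 * A * y) = 1 by rewrite EK addNr expR0.
  have E2 : expR (- (2 * A * y)) * expR (- (2 * A * (1 - y))) = expR (- (2 * A)).
    by rewrite EK; congr expR; ring.
  move: (\int[mu]_(z in _) phi z) E1 E2 => I E1 E2.
  rewrite /B -E2 le_eqVlt; apply/orP; left; apply/eqP.
  move: (expR (- (2 * A * y))) (expR (2 * A * y)) (expR (- (2 * A * (1 - y)))) E1 E2
    => p q r E1 _.
  transitivity (p * q * (4 * delta ^+ 2 + 2 * K ^+ 2 * I) + p * r * M1 ^+ 2).
    by ring.
  by rewrite E1 mul1r; ring.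
have gr := gronwall x0 K2 cphi ineq.
rewrite lee_fin.
set a := expR (A * x); set b := expR (- A); set k := expR (K ^+ 2).
have a0 : 0 < a by exact: expR_gt0.
have b0 : 0 < b by exact: expR_gt0.
have k0 : 0 < k by exact: expR_gt0.
have a2 : expR (2 * A * x) = a ^+ 2 by rewrite /a expr2 EK; congr expR; ring.
have b2 : expR (- (2 * A)) = b ^+ 2 by rewrite /b expr2 EK; congr expR; ring.
(* Since [x <= 1], the Gronwall factor is at most the square of [e^(K^2)]. *)
have k2 : expR (2 * K ^+ 2 * x) <= k ^+ 2.
  rewrite [leRHS]expr2 /k EK ler_expR.
  have := exprn_gt0 2 K0; move: (K ^+ 2) => q q0; nra.
have rhs0 : 0 <= 2 * delta + M1 * b by rewrite addr_ge0// mulr_ge0// ltW.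
rewrite -ler_sqr ?nnegrE//; last by rewrite !mulr_ge0// ltW.
have dphi : d x ^+ 2 = a ^+ 2 * phi x.
  by rewrite /phi mulrA -a2 EK subrr expR0 mul1r.
have B0 : 0 <= B by rewrite addr_ge0// mulr_ge0 ?expR_ge0 ?sqr_ge0.
(* Completing the square adds only the nonnegative cross term [4 delta M1 b]. *)
have Ble : B <= (2 * delta + M1 * b) ^+ 2.
  rewrite /B b2; move: b b0 {a2 b2 rhs0} => b b0; rewrite -subr_ge0.
    rewrite (_ : _ - _ = 4 * (delta * M1 * b)); last by ring.
  by rewrite !mulr_ge0// ltW.
rewrite dphi !exprMn mulrC ler_wpM2r ?sqr_ge0//.
apply: (le_trans gr); apply: ler_pM => //; exact: expR_ge0.
Qed.

End stability.

(** * The error bound for arbitrary [eps] and for the chosen one *)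

Theorem theorem3p1 (R : realType) (alpha K M1 delta eps : R)
    (f : R -> R -> R -> R) (g h gd hd : R -> R) (u w : R -> R -> R)
    (alpha01 : 0 < alpha < 1)
    (f_bounded : Linfty_strip f)
    (K_gt0 : 0 < K)
    (f_lipschitz : forall x t v1 v2 : R, 0 <= x <= 1 ->
       `|f x t v1 - f x t v2| <= K * `|v1 - v2|)
    (f_L2 : nonlinearity_L2 f)
    (g_L2 : g \in @L2 R) (h_L2 : h \in @L2 R)
    (gd_L2 : gd \in @L2 R) (hd_L2 : hd \in @L2 R)
    (delta_gt0 : 0 < delta)
    (noise : (L2norm (gd \- g)%R + L2norm (hd \- h)%R <= delta%:E)%E)
    (eps_gt0 : 0 < eps)
    (w_regularized :
       unique_in_CL2 (solves_regularized alpha eps f gd hd) w)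
    (u_exact : unique_in_CL2 (solves_exact alpha f g h) u)
    (M1_gt0 : 0 < M1)
    (u_apriori : forall x : R, 0 <= x < 1 ->
       (\int[lebesgue_measure]_om
          (expR (2 * (1 - x) * complex.Re (ksym alpha om))
           * cabs (fourier (u x) om) ^+ 2)%:E < (M1 ^+ 2)%:E)%E) :
  let C1 := 4 * expR (K ^+ 2) + 2 * M1 * expR (K ^+ 2) in
  let c := cos (alpha * pi / 4) in
  (forall x : R, 0 <= x < 1 ->
     (L2norm (w x \- u x)%R <=
      (C1 * expR (x * eps `^ (- (alpha / 2)) * c) * delta
       + C1 * expR ((x - 1) * eps `^ (- (alpha / 2)) * c))%:E)%E) /\
  (delta < 1 -> eps = (c / ln (1 / delta)) `^ (2 / alpha) ->
   forall x : R, 0 <= x < 1 ->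
     (L2norm (w x \- u x)%R <= (C1 * delta `^ (1 - x))%:E)%E).
Proof.
move=> C1 c.
have H := stability_estimate alpha01 f_bounded K_gt0 f_lipschitz f_L2 g_L2 h_L2
  gd_L2 hd_L2 delta_gt0 noise eps_gt0 w_regularized.1 u_exact.1 M1_gt0 u_apriori.
rewrite -/c in H; set A := eps `^ (- (alpha / 2)) * c in H.
have k0 : 0 < expR (K ^+ 2) by exact: expR_gt0.
split=> [x x01|delta1 epsE x x01]; apply: (le_trans (H x x01)); rewrite lee_fin.
  have -> : expR (x * eps `^ (- (alpha / 2)) * c) = expR (A * x).
    by congr expR; rewrite /A; ring.
  have -> : expR ((x - 1) * eps `^ (- (alpha / 2)) * c) = expR (- A) * expR (A * x).
    by rewrite -expRD; congr expR; rewrite /A; ring.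
  rewrite /C1; move: (expR (K ^+ 2)) k0 (expR (A * x)) (expR_gt0 (A * x))
    (expR (- A)) (expR_gt0 (- A)) => k k0 a a0 b b0.
  (* The slack between the stated constant [C1] and the sharper estimate is explicitly
     nonnegative. *)
  rewrite -subr_ge0 (_ : _ - _ = k * a * (2 * delta + 2 * M1 * delta + 4 * b + M1 * b)); last by ring.
  by rewrite !mulr_ge0 ?(ltW k0) ?(ltW a0)// !addr_ge0 ?mulr_ge0// ltW.
have [a0 a1] := andP alpha01.
have c0 : 0 < c by exact: cos_alpha_gt0.
have L0 : 0 < ln (1 / delta) by rewrite ln_gt0// div1r invf_gt1.
(* The exponents [2 / alpha] and [- (alpha / 2)] multiply to -1, so [A] is [c] divided by
   [c / ln (1 / delta)]. *)
have AE : A = - ln delta.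
  rewrite /A epsE -powRrM.
  have -> : 2 / alpha * - (alpha / 2) = -1 by field; rewrite gt_eqF.
  rewrite powR_inv1 ?divr_ge0 ?ltW// invf_div divfK ?gt_eqF//.
  by rewrite div1r lnV// posrE.
have bE : expR (- A) = delta by rewrite AE opprK lnK// posrE.
(* With [A = - ln delta], the factor [e^(A x)] is [delta^(-x)]. *)
have -> : delta `^ (1 - x) = delta * expR (A * x).
  rewrite /powR gt_eqF// -{2}bE -expRD; congr expR.
  by rewrite AE; ring.
rewrite bE /C1; move: (expR (K ^+ 2)) k0 (expR (A * x)) (expR_gt0 (A * x)) => k k0 a a00.
rewrite -subr_ge0 (_ : _ - _ = k * a * delta * (2 + M1)); last by ring.
by rewrite !mulr_ge0 ?(ltW k0) ?(ltW a00) ?(ltW delta_gt0)// addr_ge0// ltW.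
Qed.
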